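(* Let $\mathcal{C}$ be a $C^*$-2-category and let $\iota\colon N\to M$ be an arrow (1-cell) of $\mathcal{C}$ satisfying the following assumptions. (1) $\iota$ has a dual (conjugate) $\bar\iota\colon M\to N$ with intertwiners $\bar R\colon M\to\iota\times\bar\iota$ and $R\colon N\to\bar\iota\times\iota$ satisfying the conjugacy equations $$(\bar R^*\times\iota)\circ(\iota\times R)=\iota,\qquad (\bar\iota\times\bar R^* )\circ(R\times\bar\iota)=\bar\iota .$$ (2) $\iota$ is of depth 2, i.e. $\iota\times\bar\iota\times\iota$ is a direct summand of a finite multiple of $\iota$. (3) $\operatorname{End}N$ is a finite dimensional $C^*$-algebra. Then $A:=\operatorname{End}(\iota\times\bar\iota)$ and $B:=\operatorname{End}(\bar\iota\times\iota)$ are finite dimensional $C^*$-algebras and there exists a non-degenerate bilinear form $\langle\ ,\ \rangle\colon A\times B\to\mathbb{C}$ which makes $A$ and $B$ into $C^*$-weak Hopf algebras in duality.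
   Context: **$C^*$-2-categories.** A 2-category has 0-cells, 1-cells (arrows) and 2-cells (intertwiners), with a horizontal composition $s\times t$, defined for $s\colon\alpha\to\alpha'$ ($\alpha,\alpha'\colon M\to L$) and $t\colon\beta\to\beta'$ ($\beta,\beta'\colon N\to M$), and a vertical composition $s\circ t\colon\alpha\to\gamma$ for $t\colon\alpha\to\beta$, $s\colon\beta\to\gamma$ with $\alpha,\beta,\gamma\colon N\to M$ parallel; both are associative and satisfy the interchange law $(s\circ t)\times(s'\circ t')=(s\times s')\circ(t\times t')$. A 0-cell $M$ is identified with its unit arrow $\mathrm{id}_M\colon M\to M$ (a partial unit for $\times$), and a 1-cell $\alpha$ with its identity 2-cell $1_\alpha$ (a partial unit for $\circ$). $\operatorname{Hom}(\alpha,\beta)$ is the set of 2-cells $\alpha\to\beta$, $\operatorname{End}\alpha=\operatorname{Hom}(\alpha,\alpha)$, and $\operatorname{End}N=\operatorname{End}(\mathrm{id}_N)$ for a 0-cell $N$. It is a $C^*$-2-category (in the sense of Longo–Roberts) if each $\operatorname{Hom}(\alpha,\beta)$ is a complex Banach space, both compositions are bilinear, and there is an antilinear involution $t\in\operatorname{Hom}(\alpha,\beta)\mapsto t^*\in\operatorname{Hom}(\beta,\alpha)$ with $(s\circ t)^*=t^*\circ s^*$, $(s\times t)^*=s^*\times t^*$, $\|s\circ t\|\le\|s\|\,\|t\|$, $\|t^*\circ t\|=\|t\|^2$ and $t^*\circ t$ positive; in particular $\operatorname{End}\alpha$ is a unital $C^*$-algebra under $\circ$. ''$\iota\times\bar\iota\times\iota$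 is a direct summand of a finite multiple of $\iota$'' means that there are finitely many $V_i\in\operatorname{Hom}(\iota,\iota\times\bar\iota\times\iota)$ with $\sum_iV_i\circ V_i^*$ equal to the identity 2-cell of $\iota\times\bar\iota\times\iota$. **$C^*$-weak Hopf algebras.** A weak bialgebra over a field $K$ is a $K$-space $A$ with an associative unital algebra structure and a coassociative counital coalgebra structure $(\Delta,\varepsilon)$ (Sweedler notation $\Delta(a)=a_{(1)}\otimes a_{(2)}$) such that for all $a,b,c\in A$: $\Delta(ab)=\Delta(a)\Delta(b)$; $\varepsilon(ab_{(1)})\varepsilon(b_{(2)}c)=\varepsilon(abc)=\varepsilon(ab_{(2)})\varepsilon(b_{(1)}c)$; and $(\Delta(1)\otimes 1)(1\otimes\Delta(1))=(\Delta\otimes\mathrm{id})\Delta(1)=(1\otimes\Delta(1))(\Delta(1)\otimes 1)$. A weak Hopf algebra is a weak bialgebra with a linear map $S\colon A\to A$ satisfying $a_{(1)}S(a_{(2)})=\varepsilon(1_{(1)}a)1_{(2)}$, $S(a_{(1)})a_{(2)}=1_{(1)}\varepsilon(a1_{(2)})$, $S(a_{(1)})a_{(2)}S(a_{(3)})=S(a)$ for all $a$. A $C^*$-weak Hopf algebra is a weak Hopf algebra over $\mathbb{C}$ in which $A$ is a finite dimensional $C^*$-algebra and $\Delta$ is a $^*$-algebra map. **Duality.** That the form makes $A$ and $B$ into $C^*$-weak Hopf algebras in duality means: with their given $C^*$-algebra structures (product $\circ$, involution $^*$) and the coalgebra structures defined by $\langle\Delta_A(a),b\otimes b'\rangle=\langle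 a,bb'\rangle$, $\varepsilon_A(a)=\langle a,1_B\rangle$, $\langle a\otimes a',\Delta_B(b)\rangle=\langle aa',b\rangle$, $\varepsilon_B(b)=\langle 1_A,b\rangle$ (where $\langle a\otimes a',b\otimes b'\rangle=\langle a,b\rangle\langle a',b'\rangle$), both $A$ and $B$ are $C^*$-weak Hopf algebras, and the form identifies $B$ with the dual $C^*$-weak Hopf algebra of $A$, the involution of the dual being given by $\langle a,b^*\rangle=\overline{\langle S_A(a)^*,b\rangle}$. *)

(* Defs.v *)
(* The complex numbers are R[i] for R : realType. *)
From HB Require Import structures.
From mathcomp Require Import all_boot all_order all_algebra sesquilinear.
From mathcomp Require Import generic_quotient.
From mathcomp Require Import boolp classical_sets reals topology normedtype.
From mathcomp Require Import complex.

Set Implicit Arguments.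
Unset Strict Implicit.
Unset Printing Implicit Defensive.
Import Order.TTheory GRing.Theory Num.Theory.
Import numFieldNormedType.Exports.
Local Open Scope quotient_scope.
Local Open Scope ring_scope.

(* Tensor product of two K-vector spaces: formal sums of pairs, two of them
   being identified when every bilinear map takes the same value on them. *)

Section TensorProduct.
Variable K : fieldType.
Variables A B : lmodType K.

Definition is_bilinear (V : lmodType K) (f : A -> B -> V) : Prop :=
  (forall b, linear (f^~ b)) /\ (forall a, linear (f a)).

Definition tens_eval (V : zmodType) (f : A -> B -> V) (s : seq (A * B)) : V :=
  \sum_(p <- s) f p.1 p.2.

Definition tens_rel (s t : seq (A * B)) : bool :=
  `[< forall (V : lmodType K) (f : A -> B -> V),
        is_bilinear f -> tens_eval f s = tens_eval f t >].

Lemma tens_rel_equiv : equiv_class_of tens_rel.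
Proof.
split.
- by move=> s; apply/asboolP.
- by move=> s t; apply/asboolP/asboolP => h V f hf; rewrite h.
- by move=> s t u /asboolP h /asboolP h'; apply/asboolP => V f hf; rewrite h ?h'.
Qed.

Canonical tens_equiv := EquivRelPack tens_rel_equiv.

Definition tens := {eq_quot tens_equiv}.
HB.instance Definition _ := Choice.on tens.
HB.instance Definition _ := EqQuotient.on tens.

Definition pure_tens (a : A) (b : B) : tens := \pi_tens [:: (a, b)].

(* The linear map A (x) B -> V induced by a bilinear map f : A -> B -> V.
   It is meaningful only if f preserves [tens_rel], e.g. if f is bilinear
   (lemma [tens_liftE]) or conjugate-bilinear. *)
Definition tens_lift (V : zmodType) (f : A -> B -> V) (t : tens) : V :=
  tens_eval f (repr t).

Lemma tens_lift_pi (V : lmodType K) (f : A -> B -> V) s :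
  is_bilinear f -> tens_lift f (\pi_tens s) = tens_eval f s.
Proof. by move=> hf; move: (reprK (\pi_tens s)) => /eqmodP /asboolP; apply. Qed.

Lemma tens_liftE (V : lmodType K) (f : A -> B -> V) a b :
  is_bilinear f -> tens_lift f (pure_tens a b) = f a b.
Proof. by move=> hf; rewrite tens_lift_pi// /tens_eval big_seq1. Qed.

Lemma tens_eqP (x y : tens) :
  (forall (V : lmodType K) (f : A -> B -> V),
     is_bilinear f -> tens_lift f x = tens_lift f y) -> x = y.
Proof.
by move=> h; rewrite -[x]reprK -[y]reprK; apply/eqmodP/asboolP.
Qed.

Let tzero : tens := \pi_tens [::].
Let tadd (x y : tens) : tens := \pi_tens (repr x ++ repr y).
Let tscale (k : K) (x : tens) : tens :=
  \pi_tens [seq (k *: p.1, p.2) | p <- repr x].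
Let topp (x : tens) : tens := tscale (-1) x.

Section Lift.
Variables (V : lmodType K) (f : A -> B -> V) (hf : is_bilinear f).

Let lift0 : tens_lift f tzero = 0.
Proof. by rewrite tens_lift_pi// /tens_eval big_nil. Qed.

Let liftD x y : tens_lift f (tadd x y) = tens_lift f x + tens_lift f y.
Proof. by rewrite tens_lift_pi// /tens_eval big_cat. Qed.

Let liftZ k x : tens_lift f (tscale k x) = k *: tens_lift f x.
Proof.
rewrite tens_lift_pi// /tens_eval big_map scaler_sumr.
by apply: eq_bigr => p _ /=; rewrite (scalable_linear (hf.1 p.2)).
Qed.

Lemma tens_lift_raw :
  [/\ tens_lift f tzero = 0,
      forall x y, tens_lift f (tadd x y) = tens_lift f x + tens_lift f y
    & forall k x, tens_lift f (tscale k x) = k *: tens_lift f x].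
Proof. by []. Qed.
End Lift.

Let taddA : associative tadd.
Proof.
move=> x y z; apply: tens_eqP => V f /tens_lift_raw[_ D _].
by rewrite !D addrA.
Qed.
Let taddC : commutative tadd.
Proof.
by move=> x y; apply: tens_eqP => V f /tens_lift_raw[_ D _]; rewrite !D addrC.
Qed.
Let tadd0 : left_id tzero tadd.
Proof.
by move=> x; apply: tens_eqP => V f /tens_lift_raw[O D _]; rewrite !D O add0r.
Qed.
Let taddN : left_inverse tzero topp tadd.
Proof.
move=> x; apply: tens_eqP => V f /tens_lift_raw[O D Z].
by rewrite !D O Z scaleN1r addNr.
Qed.

HB.instance Definition _ :=
  GRing.isZmodule.Build tens taddA taddC tadd0 taddN.

Let tscaleA a b x : tscale a (tscale b x) = tscale (a * b) x.
Proof.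
by apply: tens_eqP => V f /tens_lift_raw[_ _ Z]; rewrite !Z scalerA.
Qed.
Let tscale1 : left_id 1 tscale.
Proof.
by move=> x; apply: tens_eqP => V f /tens_lift_raw[_ _ Z]; rewrite !Z scale1r.
Qed.
Let tscaleDr : right_distributive tscale +%R.
Proof.
move=> k x y; apply: tens_eqP => V f /tens_lift_raw[_ D Z].
by rewrite !(D, Z) scalerDr.
Qed.
Let tscaleDl x : {morph tscale^~ x : a b / a + b}.
Proof.
move=> a b; apply: tens_eqP => V f /tens_lift_raw[_ D Z].
by rewrite !(D, Z) scalerDl.
Qed.

HB.instance Definition _ := GRing.Zmodule_isLmodule.Build K tens
  tscaleA tscale1 tscaleDr tscaleDl.

Lemma tens_lift_linear (V : lmodType K) (f : A -> B -> V) :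
  is_bilinear f -> linear (tens_lift f).
Proof.
by move=> /tens_lift_raw[_ D Z] k x y; rewrite (D (tscale k x) y) Z.
Qed.

Lemma tens_lift0 (V : lmodType K) (f : A -> B -> V) :
  is_bilinear f -> tens_lift f 0 = 0.
Proof. by move=> /tens_lift_raw[]. Qed.

Lemma tens_liftD (V : lmodType K) (f : A -> B -> V) x y :
  is_bilinear f -> tens_lift f (x + y) = tens_lift f x + tens_lift f y.
Proof. by move=> /tens_lift_raw[_ + _]; apply. Qed.

Lemma tens_liftZ (V : lmodType K) (f : A -> B -> V) k x :
  is_bilinear f -> tens_lift f (k *: x) = k *: tens_lift f x.
Proof. by move=> /tens_lift_raw[_ _ +]; apply. Qed.

Lemma pure_tens_bilinear : is_bilinear pure_tens.
Proof.
by split=> [b k a a'|a k b b']; apply: tens_eqP => V f hf;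
  rewrite tens_liftD// tens_liftZ// !tens_liftE//; [apply: hf.1 | apply: hf.2].
Qed.

Lemma tens_piE s : \pi_tens s = \sum_(p <- s) pure_tens p.1 p.2.
Proof.
apply: tens_eqP => V f hf; rewrite tens_lift_pi// /tens_eval.
elim: s => [|p s IH]; first by rewrite !big_nil tens_lift0.
by rewrite !big_cons tens_liftD// IH tens_liftE.
Qed.

Lemma tens_ind (P : tens -> Prop) :
  P 0 -> (forall x y, P x -> P y -> P (x + y)) ->
  (forall a b, P (pure_tens a b)) -> forall t, P t.
Proof.
move=> P0 PD Pp t; rewrite -[t]reprK tens_piE.
by elim: (repr t) => [|p s IH]; rewrite ?big_nil ?big_cons//; apply: PD.
Qed.

Lemma tens_lift_unique (V : lmodType K) (g h : tens -> V) :
  linear g -> linear h ->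
  (forall a b, g (pure_tens a b) = h (pure_tens a b)) -> g =1 h.
Proof.
move=> lg lh e; apply: tens_ind => // [|x y gx gy].
  by have := zmod_morphism_linear lg; have := zmod_morphism_linear lh;
    move=> /(_ 0 0) + /(_ 0 0); rewrite !subrr => -> ->.
by have := lg 1 x y; have := lh 1 x y; rewrite !scale1r gx gy => -> ->.
Qed.

End TensorProduct.

Notation "a \ox b" := (pure_tens a b)
  (at level 40, left associativity) : ring_scope.

Definition tens_map (K : fieldType) (A B A' B' : lmodType K)
    (f : A -> A') (g : B -> B') : tens A B -> tens A' B' :=
  tens_lift (fun a b => f a \ox g b).

Definition tens_assoc (K : fieldType) (A B C : lmodType K) :
    tens A (tens B C) -> tens (tens A B) C :=
  tens_lift (fun a => tens_lift (fun b c => (a \ox b) \ox c)).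

Section TensorMaps.
Variables (K : fieldType).

Let map_bil (A B A' B' : lmodType K) (f : {linear A -> A'})
    (g : {linear B -> B'}) : is_bilinear (fun a b => f a \ox g b).
Proof.
split=> [b k x y|a k x y]; rewrite linearP.
  by rewrite (pure_tens_bilinear _ _).1.
by rewrite (pure_tens_bilinear _ _).2.
Qed.

Lemma tens_mapE (A B A' B' : lmodType K) (f : {linear A -> A'})
    (g : {linear B -> B'}) a b : tens_map f g (a \ox b) = f a \ox g b.
Proof. exact: (tens_liftE _ _ (map_bil f g)). Qed.

Let assoc_bil (A B C : lmodType K) (a : A) :
  is_bilinear (fun (b : B) (c : C) => (a \ox b) \ox c).
Proof.
split=> [c k x y|b k x y]; last by rewrite (pure_tens_bilinear _ _).2.
by rewrite (pure_tens_bilinear _ _).2 (pure_tens_bilinear _ _).1.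
Qed.

Let assoc_bil2 (A B C : lmodType K) :
  is_bilinear (fun (a : A) (t : tens B C) =>
    tens_lift (fun b c => (a \ox b) \ox c) t).
Proof.
split=> [t k x y|a k s t]; last exact: tens_lift_linear (assoc_bil B C a) _ _ _.
elim/tens_ind: t => [|t u IH IH'|b c].
- by rewrite !(tens_lift0 (assoc_bil B C _)) scaler0 addr0.
- by rewrite !(tens_liftD _ _ (assoc_bil B C _)) IH IH' scalerDr addrACA.
- rewrite !(tens_liftE _ _ (assoc_bil B C _)).
  by rewrite (pure_tens_bilinear _ _).1 (pure_tens_bilinear _ _).1.
Qed.

Lemma tens_assocE (A B C : lmodType K) (a : A) (b : B) (c : C) :
  tens_assoc (a \ox (b \ox c)) = (a \ox b) \ox c.
Proof.
rewrite /tens_assoc (tens_liftE _ _ (@assoc_bil2 A B C)).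
exact: (tens_liftE _ _ (assoc_bil B C a)).
Qed.

End TensorMaps.

(* The library's [algType] excludes the zero algebra, which has to be allowed
   here: the endomorphism algebra of a 1-cell may vanish. *)

HB.mixin Record isUnitalAlgebra (K : fieldType) A of GRing.Lmodule K A := {
  amul : A -> A -> A;
  aone : A;
  amul_bilinear : is_bilinear amul;
  amulA : associative amul;
  amul1l : left_id aone amul;
  amul1r : right_id aone amul
}.

#[short(type="unitalAlgType")]
HB.structure Definition UnitalAlgebra (K : fieldType) :=
  {A of GRing.Lmodule K A & isUnitalAlgebra K A}.

Arguments aone {K} s.
Notation "a ** b" := (amul a b) (at level 40, left associativity) : ring_scope.

Section TensorAlgebra.
Variables (K : fieldType) (A B : unitalAlgType K).

Let mul_pure (a : A) (b : B) : tens A B -> tens A B :=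
  tens_lift (fun a' b' => (a ** a') \ox (b ** b')).

Definition tens_mul (s t : tens A B) : tens A B :=
  tens_lift (fun a b => mul_pure a b t) s.

Let mul_pure_bil a b :
  is_bilinear (fun (a' : A) (b' : B) => (a ** a') \ox (b ** b')).
Proof.
split=> [b' k x y|a' k x y].
  by rewrite (amul_bilinear.2 a) (pure_tens_bilinear _ _).1.
by rewrite (amul_bilinear.2 b) (pure_tens_bilinear _ _).2.
Qed.

Let mul_pureE a b a' b' :
  mul_pure a b (a' \ox b') = (a ** a') \ox (b ** b').
Proof. exact: (tens_liftE _ _ (mul_pure_bil a b)). Qed.

Let mul_bil (t : tens A B) : is_bilinear (fun a b => mul_pure a b t).
Proof.
have D a b := tens_liftD _ _ (mul_pure_bil a b).
have Z0 a b := tens_lift0 (mul_pure_bil a b).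
split=> [b k x y|a k x y]; elim/tens_ind: t => [|t u IHt IHu|a' b'].
- by rewrite /mul_pure !Z0 scaler0 addr0.
- by rewrite /mul_pure !D -!/(mul_pure _ _ _) IHt IHu scalerDr addrACA.
- by rewrite !mul_pureE (amul_bilinear.1 a') (pure_tens_bilinear _ _).1.
- by rewrite /mul_pure !Z0 scaler0 addr0.
- by rewrite /mul_pure !D -!/(mul_pure _ _ _) IHt IHu scalerDr addrACA.
- by rewrite !mul_pureE (amul_bilinear.1 b') (pure_tens_bilinear _ _).2.
Qed.

Lemma tens_mulE a b a' b' :
  tens_mul (a \ox b) (a' \ox b') = (a ** a') \ox (b ** b').
Proof. by rewrite /tens_mul (tens_liftE _ _ (mul_bil _)) mul_pureE. Qed.

Let tens_mul_bilinear : is_bilinear tens_mul.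
Proof.
split=> [t|s k x y]; first exact: tens_lift_linear (mul_bil t).
elim/tens_ind: s => [|s s' IH IH'|a b].
- by rewrite /tens_mul !(tens_lift0 (mul_bil _)) scaler0 addr0.
- rewrite /tens_mul !(tens_liftD _ _ (mul_bil _)) -!/(tens_mul _ _) IH IH'.
  by rewrite scalerDr addrACA.
- rewrite /tens_mul !(tens_liftE _ _ (mul_bil _)).
  exact: tens_lift_linear (mul_pure_bil a b) _ _ _.
Qed.

Let mul0t t : tens_mul 0 t = 0.
Proof. exact: tens_lift0 (mul_bil t). Qed.
Let mult0 t : tens_mul t 0 = 0.
Proof.
by have := tens_mul_bilinear.2 t (-1) 0 0; rewrite scaler0 addr0 scaleN1r addNr.
Qed.
Let mulDt s s' t : tens_mul (s + s') t = tens_mul s t + tens_mul s' t.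
Proof. exact: tens_liftD (mul_bil t). Qed.
Let multD t s s' : tens_mul t (s + s') = tens_mul t s + tens_mul t s'.
Proof. by have := tens_mul_bilinear.2 t 1 s s'; rewrite !scale1r. Qed.

Let tens_mulA : associative tens_mul.
Proof.
move=> s t u; elim/tens_ind: s => [|s s' IH IH'|a b].
- by rewrite !mul0t.
- by rewrite !mulDt IH IH'.
elim/tens_ind: t => [|t t' IH IH'|a' b'].
- by rewrite mult0 !mul0t mult0.
- by rewrite multD !mulDt multD IH IH'.
elim/tens_ind: u => [|u u' IH IH'|a'' b''].
- by rewrite !mult0.
- by rewrite !multD IH IH'.
- by rewrite !tens_mulE !amulA.
Qed.

Let tens_one : tens A B := aone A \ox aone B.

Let tens_mul1l : left_id tens_one tens_mul.
Proof.
elim/tens_ind => [|t t' IH IH'|a b]; first by rewrite mult0.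
  by rewrite multD IH IH'.
by rewrite tens_mulE !amul1l.
Qed.

Let tens_mul1r : right_id tens_one tens_mul.
Proof.
elim/tens_ind => [|t t' IH IH'|a b]; first by rewrite mul0t.
  by rewrite mulDt IH IH'.
by rewrite tens_mulE !amul1r.
Qed.

HB.instance Definition _ := isUnitalAlgebra.Build K (tens A B)
  tens_mul_bilinear tens_mulA tens_mul1l tens_mul1r.

End TensorAlgebra.

(* Sweedler notation: an expression E bilinear in a(1) and a(2) is written
   [tens_lift (fun x y => E x y) (Delta a)]. *)

Record weak_bialgebra (K : fieldType) (A : unitalAlgType K) := WeakBialgebra {
  Delta : {linear A -> tens A A};
  eps : {scalar A};
  DeltaA : forall a,
    tens_map Delta idfun (Delta a) = tens_assoc (tens_map idfun Delta (Delta a));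
  eps_l : forall a, tens_lift (fun x y => eps x *: y) (Delta a) = a;
  eps_r : forall a, tens_lift (fun x y => eps y *: x) (Delta a) = a;
  DeltaM : forall a b, Delta (a ** b) = Delta a ** Delta b;
  epsM12 : forall a b c,
    tens_lift (fun x y => eps (a ** x) * eps (y ** c) : K^o) (Delta b)
    = eps (a ** b ** c);
  epsM21 : forall a b c,
    tens_lift (fun x y => eps (a ** y) * eps (x ** c) : K^o) (Delta b)
    = eps (a ** b ** c);
  Delta1l :
    (Delta (aone A) \ox aone A) ** tens_assoc (aone A \ox Delta (aone A))
    = tens_map Delta idfun (Delta (aone A));
  Delta1r :
    tens_assoc (aone A \ox Delta (aone A)) ** (Delta (aone A) \ox aone A)
    = tens_map Delta idfun (Delta (aone A))
}.

Record weak_hopf (K : fieldType) (A : unitalAlgType K) := WeakHopf {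
  wh_bialg :> weak_bialgebra A;
  antipode : {linear A -> A};
  antipode_r : forall a,
    tens_lift (fun x y => x ** antipode y) (Delta wh_bialg a)
    = tens_lift (fun x y => eps wh_bialg (x ** a) *: y)
        (Delta wh_bialg (aone A));
  antipode_l : forall a,
    tens_lift (fun x y => antipode x ** y) (Delta wh_bialg a)
    = tens_lift (fun x y => eps wh_bialg (a ** y) *: x)
        (Delta wh_bialg (aone A));
  antipode_lr : forall a,
    tens_lift (fun t z => tens_lift (fun x y => antipode x ** y ** antipode z) t)
      (tens_map (Delta wh_bialg) idfun (Delta wh_bialg a))
    = antipode a
}.


HB.mixin Record isCstarAlgebra (R : realType) A
    of CompleteNormedModule R[i] A & UnitalAlgebra R[i] A := {
  adj : A -> A;
  adj_antilinear : forall (c : R[i]) (a b : A),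
    adj (c *: a + b) = c^* *: adj a + adj b;
  adjK : involutive adj;
  adjM : forall a b : A, adj (a ** b) = adj b ** adj a;
  norm_amul : forall a b : A, `|a ** b| <= `|a| * `|b|;
  norm_adj_amul : forall a : A, `|adj a ** a| = `|a| ^+ 2
}.

#[short(type="cstarAlgType")]
HB.structure Definition CstarAlgebra (R : realType) :=
  {A of CompleteNormedModule R[i] A & UnitalAlgebra R[i] A & isCstarAlgebra R A}.

Definition finite_dimensional (K : fieldType) (V : lmodType K) : Prop :=
  exists (n : nat) (f : V -> 'rV[K]_n), linear f /\ bijective f.

Definition conj_space (R : realType) (V : lmodType R[i]) : Type := V.

Section ConjSpace.
Variables (R : realType) (V : lmodType R[i]).
HB.instance Definition _ := GRing.Zmodule.on (conj_space V).

Let cscale (k : R[i]) (v : conj_space V) : conj_space V := k^* *: (v : V).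
Let cscaleA a b v : cscale a (cscale b v) = cscale (a * b) v.
Proof. by rewrite /cscale scalerA rmorphM. Qed.
Let cscale1 : left_id 1 cscale.
Proof. by move=> v; rewrite /cscale rmorph1 scale1r. Qed.
Let cscaleDr : right_distributive cscale +%R.
Proof. by move=> k v w; apply: scalerDr. Qed.
Let cscaleDl v : {morph cscale^~ v : a b / a + b}.
Proof. by move=> a b; rewrite /cscale rmorphD scalerDl. Qed.
HB.instance Definition _ := GRing.Zmodule_isLmodule.Build R[i] (conj_space V)
  cscaleA cscale1 cscaleDr cscaleDl.
End ConjSpace.

Section TensorAdjoint.
Variables (R : realType) (A B : cstarAlgType R).

Definition tens_adj : tens A B -> tens A B :=
  tens_lift (fun a b => adj a \ox adj b).

Let adj_bil :
  @is_bilinear _ A B (conj_space (tens A B)) (fun a b => adj a \ox adj b).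
Proof.
split=> [b k x y|a k x y].
  by rewrite adj_antilinear (pure_tens_bilinear _ _).1.
by rewrite adj_antilinear (pure_tens_bilinear _ _).2.
Qed.

Lemma tens_adjE a b : tens_adj (a \ox b) = adj a \ox adj b.
Proof. exact: (tens_liftE _ _ adj_bil). Qed.

Lemma tens_adj_antilinear (k : R[i]) (s t : tens A B) :
  tens_adj (k *: s + t) = k^* *: tens_adj s + tens_adj t.
Proof. exact: (tens_lift_linear adj_bil). Qed.

End TensorAdjoint.

Record cstar_weak_hopf (R : realType) (A : cstarAlgType R) := CstarWeakHopf {
  cwh_wh :> weak_hopf A;
  cwh_fin : finite_dimensional A;
  Delta_adj : forall a, Delta cwh_wh (adj a) = tens_adj (Delta cwh_wh a)
}.

Definition nondegenerate_form (R : realType) (A B : lmodType R[i])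
    (form : A -> B -> R[i]) : Prop :=
  (forall a, (forall b, form a b = 0) -> a = 0) /\
  (forall b, (forall a, form a b = 0) -> b = 0).

(* [dual_DeltaA] to [dual_epsB] say that the coalgebra structure on each side is
   dual to the algebra structure on the other; the antipode of the dual of hA is
   the transpose of that of hA. *)
Record in_duality (R : realType) (A B : cstarAlgType R)
    (hA : cstar_weak_hopf A) (hB : cstar_weak_hopf B)
    (form : A -> B -> R[i]) : Prop := InDuality {
  dual_DeltaA : forall a b b',
    tens_lift (fun x y => form x b * form y b' : R[i]^o) (Delta hA a)
    = form a (b ** b');
  dual_epsA : forall a, eps hA a = form a (aone B);
  dual_DeltaB : forall a a' b,
    tens_lift (fun x y => form a x * form a' y : R[i]^o) (Delta hB b)
    = form (a ** a') b;
  dual_epsB : forall b, eps hB b = form (aone A) b;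
  dual_antipode : forall a b, form (antipode hA a) b = form a (antipode hB b);
  dual_adj : forall a b, form a (adj b) = (form (adj (antipode hA a)) b)^*
}.


(* [cell1 N M] is the type of arrows from N to M, and [comp1 alpha beta] is
   the product alpha x beta, in which beta comes first. *)
Record two_cat_data (R : realType) := TwoCatData {
  cell0 :> Type;
  cell1 : cell0 -> cell0 -> Type;
  cell2 : forall N M : cell0, cell1 N M -> cell1 N M -> completeNormedModType R[i];
  unit1 : forall M : cell0, cell1 M M;
  comp1 : forall N M L : cell0, cell1 M L -> cell1 N M -> cell1 N L;
  id2 : forall (N M : cell0) (a : cell1 N M), cell2 a a;
  vcomp : forall (N M : cell0) (a b c : cell1 N M),
    cell2 b c -> cell2 a b -> cell2 a c;
  hcomp : forall (N M L : cell0) (a a' : cell1 M L) (b b' : cell1 N M),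
    cell2 a a' -> cell2 b b' -> cell2 (comp1 a b) (comp1 a' b');
  star : forall (N M : cell0) (a b : cell1 N M), cell2 a b -> cell2 b a
}.

Arguments unit1 {R C} M : rename.
Arguments id2 {R C N M} a : rename.

Declare Scope cell_scope.
Delimit Scope cell_scope with cell.
Notation "a \x b" := (comp1 a b)
  (at level 40, left associativity) : cell_scope.
Notation "s \o t" := (vcomp s t) : cell_scope.
Notation "s \xx t" := (hcomp s t)
  (at level 40, left associativity) : cell_scope.
Notation "t ^*" := (star t) : cell_scope.

(* An equality of 1-cells, regarded as an identity 2-cell. The 2-category is
   strict, but its 1-cells are associative and unital only up to propositional
   equality; these identity 2-cells bridge the resulting change of types. *)
Definition eq2 (R : realType) (C : two_cat_data R) (N M : C) (a b : cell1 N M)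
    (e : a = b) : cell2 a b :=
  match e in _ = b' return cell2 a b' with erefl => id2 a end.

Record cstar_two_cat (R : realType) := CstarTwoCat {
  tc_data :> two_cat_data R;

  comp1A : forall (N M L P : tc_data)
      (a : cell1 L P) (b : cell1 M L) (c : cell1 N M),
    (a \x (b \x c))%cell = (a \x b \x c)%cell;
  comp1l : forall (N M : tc_data) (a : cell1 N M), (unit1 M \x a)%cell = a;
  comp1r : forall (N M : tc_data) (a : cell1 N M), (a \x unit1 N)%cell = a;

  vcompA : forall (N M : tc_data) (a b c d : cell1 N M)
      (s : cell2 c d) (t : cell2 b c) (u : cell2 a b),
    (s \o (t \o u))%cell = (s \o t \o u)%cell;
  vcomp1l : forall (N M : tc_data) (a b : cell1 N M) (t : cell2 a b),
    (id2 b \o t)%cell = t;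
  vcomp1r : forall (N M : tc_data) (a b : cell1 N M) (t : cell2 a b),
    (t \o id2 a)%cell = t;

  hcompA : forall (N M L P : tc_data) (a a' : cell1 L P) (b b' : cell1 M L)
      (c c' : cell1 N M) (s : cell2 a a') (t : cell2 b b') (u : cell2 c c'),
    (eq2 (comp1A a' b' c') \o (s \xx (t \xx u)))%cell
    = (s \xx t \xx u \o eq2 (comp1A a b c))%cell;
  hcomp1l : forall (N M : tc_data) (a b : cell1 N M) (t : cell2 a b),
    (eq2 (comp1l b) \o (id2 (unit1 M) \xx t))%cell = (t \o eq2 (comp1l a))%cell;
  hcomp1r : forall (N M : tc_data) (a b : cell1 N M) (t : cell2 a b),
    (eq2 (comp1r b) \o (t \xx id2 (unit1 N)))%cell = (t \o eq2 (comp1r a))%cell;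
  hcomp_id2 : forall (N M L : tc_data) (a : cell1 M L) (b : cell1 N M),
    (id2 a \xx id2 b)%cell = id2 (a \x b)%cell;
  interchange : forall (N M L : tc_data) (a b c : cell1 M L) (a' b' c' : cell1 N M)
      (s : cell2 b c) (t : cell2 a b) (s' : cell2 b' c') (t' : cell2 a' b'),
    ((s \o t) \xx (s' \o t'))%cell = ((s \xx s') \o (t \xx t'))%cell;

  vcomp_bilinear : forall (N M : tc_data) (a b c : cell1 N M),
    is_bilinear (@vcomp R tc_data N M a b c);
  hcomp_bilinear : forall (N M L : tc_data) (a a' : cell1 M L) (b b' : cell1 N M),
    is_bilinear (@hcomp R tc_data N M L a a' b b');

  star_antilinear : forall (N M : tc_data) (a b : cell1 N M)
      (k : R[i]) (s t : cell2 a b),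
    star (k *: s + t) = k^* *: star s + star t;
  starK : forall (N M : tc_data) (a b : cell1 N M) (t : cell2 a b),
    (t^*^*)%cell = t;
  star_vcomp : forall (N M : tc_data) (a b c : cell1 N M)
      (s : cell2 b c) (t : cell2 a b),
    ((s \o t)^*)%cell = (t^* \o s^*)%cell;
  star_hcomp : forall (N M L : tc_data) (a a' : cell1 M L) (b b' : cell1 N M)
      (s : cell2 a a') (t : cell2 b b'),
    ((s \xx t)^*)%cell = (s^* \xx t^*)%cell;
  norm_vcomp : forall (N M : tc_data) (a b c : cell1 N M)
      (s : cell2 b c) (t : cell2 a b),
    `|(s \o t)%cell| <= `|s| * `|t|;
  norm_star_vcomp : forall (N M : tc_data) (a b : cell1 N M) (t : cell2 a b),
    `|(t^* \o t)%cell| = `|t| ^+ 2;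
  (* positivity of t^* o t in End a, i.e. being of the form u^* o u *)
  star_vcomp_pos : forall (N M : tc_data) (a b : cell1 N M) (t : cell2 a b),
    exists u : cell2 a a, (t^* \o t)%cell = (u^* \o u)%cell
}.

Definition End2 (R : realType) (C : cstar_two_cat R) (N M : C)
    (a : cell1 N M) : Type := cell2 a a.

Section EndAlgebra.
Variables (R : realType) (C : cstar_two_cat R) (N M : C) (a : cell1 N M).

HB.instance Definition _ := CompleteNormedModule.on (End2 a).

Let eA : associative (fun s t : End2 a => (s \o t)%cell : End2 a).
Proof. exact: vcompA. Qed.
Let e1l : left_id (id2 a : End2 a) (fun s t : End2 a => (s \o t)%cell : End2 a).
Proof. exact: vcomp1l. Qed.
Let e1r : right_id (id2 a : End2 a) (fun s t : End2 a => (s \o t)%cell : End2 a).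
Proof. exact: vcomp1r. Qed.

HB.instance Definition _ := isUnitalAlgebra.Build R[i] (End2 a)
  (vcomp_bilinear a a a) eA e1l e1r.

Let estarK : involutive (fun t : End2 a => (t^*)%cell : End2 a).
Proof. exact: starK. Qed.

HB.instance Definition _ := isCstarAlgebra.Build R (End2 a)
  (@star_antilinear R C N M a a) estarK (@star_vcomp R C N M a a a)
  (@norm_vcomp R C N M a a a) (@norm_star_vcomp R C N M a a).

End EndAlgebra.

(* The conjugacy equations for Rbar : M -> iota x iotab, R : N -> iotab x iota;
   unit and associativity identities are inserted as identity 2-cells. *)
Definition conjugacy_equations (R : realType) (C : cstar_two_cat R) (N M : C)
    (iota : cell1 N M) (iotab : cell1 M N)
    (Rbar : cell2 (unit1 M) (iota \x iotab)%cell)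
    (R0 : cell2 (unit1 N) (iotab \x iota)%cell) : Prop :=
  (eq2 (comp1l iota) \o (Rbar^* \xx id2 iota)
     \o eq2 (comp1A iota iotab iota)
     \o (id2 iota \xx R0) \o eq2 (esym (comp1r iota)))%cell = id2 iota
  /\
  (eq2 (comp1r iotab) \o (id2 iotab \xx Rbar^*)
     \o eq2 (esym (comp1A iotab iota iotab))
     \o (R0 \xx id2 iotab) \o eq2 (esym (comp1l iotab)))%cell = id2 iotab.

Definition depth2 (R : realType) (C : cstar_two_cat R) (N M : C)
    (iota : cell1 N M) (iotab : cell1 M N) : Prop :=
  exists (n : nat) (V : 'I_n -> cell2 iota (iota \x iotab \x iota)%cell),
    \sum_(i < n) (V i \o (V i)^*)%cell = id2 (iota \x iotab \x iota)%cell.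

(* Main.v *)
Require Import Defs.
From HB Require Import structures.
From mathcomp Require Import all_boot all_order all_algebra sesquilinear.
From mathcomp Require Import boolp reals topology normedtype.
From mathcomp Require Import complex ring.
Set Implicit Arguments.
Unset Strict Implicit.
Unset Printing Implicit Defensive.
Import Order.TTheory GRing.Theory Num.Theory.
Import numFieldNormedType.Exports.
Local Open Scope ring_scope.

(** Let u be the unit arrow of N and L = End iota. Two vectors R, Rb that solve the
    conjugacy equations bend strands, and this gives a linear bijection F : A -> B (the
    quarter turn, [turn]) and an antimultiplicative bijection rot : B -> B (the half
    turn, [half_turn]). The algebra L acts on one strand of iotab x iota by i, hence on the
    other one by j = rot i, and likewise on those of iota x iotab. Closing an element of B
    with R and Rb and applying a faithful positive functional phi of End N gives a faithful
    positive functional psi on B.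

    Finite dimension. Vectors of Hom (u, iotab x iota) of norm one that are orthogonal over
    End N are bounded in number ([orthogonal_bound]): this is Bessel's inequality for the
    inner product phi (s^* t). So this space, and with it L, is finite dimensional; by
    depth two so is B, and F carries this over to A.

    Normalisation. Twisting R by an invertible positive element of L, and Rb by its inverse,
    one may arrange that the two ways of closing elements of L, on the left and on the
    right, give the same functional tau ([normalised_exists]). Then psi is invariant under rot.
    The square of rot is the modular automorphism of psi and its own inverse, so it is
    trivial by positivity, and psi and tau are traces. Moreover tau is tr (delta^-2 .), where
    delta is central in L and tr is the regular trace of L, which is distinguished by
    having dual bases n_k, n^k with sum of the n^k n_k equal to 1.

    The form is <a, b> = psi (F(a) i(delta) b j(delta)). Depth two, turned by the half
    turn, says that B has a basis over j(L) ([quasi_basis]) in terms of which F of a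
    product can be computed ([turn_quasi]); as tr has index one, it follows that the
    coproducts transposed to the products are multiplicative ([exchange]). As every b in B
    has b F(1) in i(L) F(1), the functional <1, . b> only depends on an element of L, and this
    yields the axioms of the counits. Finally psi (F(c a) F(1)) = psi (F(c) rot (F(a))), so the
    exchange identity, closed up with F(1), computes b_(2) T(b_(1)) for a conjugate T of
    rot by an element of the legs ([sum_antipode]); this gives the antipode axioms, with
    antipode T^-1.

    These identities are collected in [hopf_pairing], a list of conditions on a pairing that
    is stable under exchanging the two algebras ([hopf_pairing_sym]). It makes each of them
    a C*-weak Hopf algebra ([hopf_of_pairing]), hence the two in duality.

    A 2-cell t is handled through the natural family of its whiskerings t x id_x, for all
    arrows x, with words of arrows bracketed to the right ([fam]); in this form the
    associators disappear. *)

(** * Bilinear maps and C*-algebras *)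

Section Bilinear.
Variables (K : fieldType) (U V W : lmodType K) (f : U -> V -> W).
Hypothesis hf : is_bilinear f.

Lemma bilDl x y v : f (x + y) v = f x v + f y v.
Proof. by have := hf.1 v 1 x y; rewrite !scale1r. Qed.
Lemma bilDr x y z : f x (y + z) = f x y + f x z.
Proof. by have := hf.2 x 1 y z; rewrite !scale1r. Qed.
Lemma bil0l v : f 0 v = 0.
Proof. by apply: (addrI (f 0 v)); rewrite -bilDl !addr0. Qed.
Lemma bil0r x : f x 0 = 0.
Proof. by apply: (addrI (f x 0)); rewrite -bilDr !addr0. Qed.
Lemma bilZl k x v : f (k *: x) v = k *: f x v.
Proof. by have := hf.1 v k x 0; rewrite !addr0 bil0l addr0. Qed.
Lemma bilZr k x v : f x (k *: v) = k *: f x v.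
Proof. by have := hf.2 x k v 0; rewrite !addr0 bil0r addr0. Qed.
Lemma bilNl x v : f (- x) v = - f x v.
Proof. by rewrite -scaleN1r bilZl scaleN1r. Qed.
Lemma bilNr x v : f x (- v) = - f x v.
Proof. by rewrite -scaleN1r bilZr scaleN1r. Qed.
Lemma bilBl x y v : f (x - y) v = f x v - f y v.
Proof. by rewrite bilDl bilNl. Qed.
Lemma bilBr x v w : f x (v - w) = f x v - f x w.
Proof. by rewrite bilDr bilNr. Qed.
Lemma bil_suml I (r : seq I) (P : pred I) (F : I -> U) v :
  f (\sum_(i <- r | P i) F i) v = \sum_(i <- r | P i) f (F i) v.
Proof. by elim/big_rec2: _ => [|i x y _ <-]; rewrite ?bil0l ?bilDl. Qed.
Lemma bil_sumr I (r : seq I) (P : pred I) (F : I -> V) u :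
  f u (\sum_(i <- r | P i) F i) = \sum_(i <- r | P i) f u (F i).
Proof. by elim/big_rec2: _ => [|i x y _ <-]; rewrite ?bil0r ?bilDr. Qed.
End Bilinear.

Section LinearFun.
Variables (K : fieldType) (U V : lmodType K) (f : U -> V).
Hypothesis hf : linear f.

Lemma funD x y : f (x + y) = f x + f y.
Proof. by have := hf 1 x y; rewrite !scale1r. Qed.
Lemma fun0 : f 0 = 0.
Proof. by apply: (addrI (f 0)); rewrite -funD !addr0. Qed.
Lemma funZ k x : f (k *: x) = k *: f x.
Proof. by have := hf k x 0; rewrite fun0 !addr0. Qed.
Lemma funN x : f (- x) = - f x.
Proof. by rewrite -scaleN1r funZ scaleN1r. Qed.
Lemma funB x y : f (x - y) = f x - f y.
Proof. by rewrite funD funN. Qed.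
Lemma fun_sum I (r : seq I) (P : pred I) (F : I -> U) :
  f (\sum_(i <- r | P i) F i) = \sum_(i <- r | P i) f (F i).
Proof. by elim/big_rec2: _ => [|i x y _ <-]; rewrite ?fun0 ?funD. Qed.
End LinearFun.

Section UnitalAlgebraTheory.
Variables (K : fieldType) (A : unitalAlgType K).
Implicit Types a b c : A.
Let bm := @amul_bilinear K A.

Lemma amulDl a b c : (a + b) ** c = a ** c + b ** c. Proof. exact: (bilDl bm). Qed.
Lemma amulDr a b c : a ** (b + c) = a ** b + a ** c. Proof. exact: (bilDr bm). Qed.
Lemma amulBl a b c : (a - b) ** c = a ** c - b ** c. Proof. exact: (bilBl bm). Qed.
Lemma amulBr a b c : a ** (b - c) = a ** b - a ** c. Proof. exact: (bilBr bm). Qed.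
Lemma amulZl k a b : (k *: a) ** b = k *: (a ** b). Proof. exact: (bilZl bm). Qed.
Lemma amulZr k a b : a ** (k *: b) = k *: (a ** b). Proof. exact: (bilZr bm). Qed.
Lemma amul0l a : 0 ** a = 0. Proof. exact: (bil0l bm). Qed.
Lemma amul0r a : a ** 0 = 0. Proof. exact: (bil0r bm). Qed.
Lemma amulNl a b : (- a) ** b = - (a ** b). Proof. exact: (bilNl bm). Qed.
Lemma amulNr a b : a ** (- b) = - (a ** b). Proof. exact: (bilNr bm). Qed.
Lemma amul_suml I (r : seq I) (P : pred I) (F : I -> A) a :
  (\sum_(i <- r | P i) F i) ** a = \sum_(i <- r | P i) F i ** a.
Proof. exact: (bil_suml bm). Qed.
Lemma amul_sumr I (r : seq I) (P : pred I) (F : I -> A) a :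
  a ** (\sum_(i <- r | P i) F i) = \sum_(i <- r | P i) a ** F i.
Proof. exact: (bil_sumr bm). Qed.
End UnitalAlgebraTheory.

Section CstarTheory.
Variables (R : realType) (A : cstarAlgType R).
Implicit Types a b c : A.

Lemma adjD a b : adj (a + b) = adj a + adj b.
Proof. by have := adj_antilinear 1 a b; rewrite !scale1r rmorph1 scale1r. Qed.
Lemma adj0 : adj (0 : A) = 0.
Proof. by apply: (addrI (adj 0)); rewrite -adjD !addr0. Qed.
Lemma adjZ (k : R[i]) a : adj (k *: a) = k^* *: adj a.
Proof. by have := adj_antilinear k a 0; rewrite !addr0 adj0 addr0. Qed.
Lemma adjN a : adj (- a) = - adj a.
Proof. by rewrite -scaleN1r adjZ rmorphN rmorph1 scaleN1r. Qed.
Lemma adjB a b : adj (a - b) = adj a - adj b.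
Proof. by rewrite adjD adjN. Qed.
Lemma adj_sum I (r : seq I) (P : pred I) (F : I -> A) :
  adj (\sum_(i <- r | P i) F i) = \sum_(i <- r | P i) adj (F i).
Proof. by elim/big_rec2: _ => [|i x y _ <-]; rewrite ?adj0 ?adjD. Qed.
Lemma adj1 : adj (aone A) = aone A.
Proof. by rewrite -[LHS]amul1r -{2}[aone A]adjK -adjM amul1r adjK. Qed.

Lemma adj_amul_eq0 a : adj a ** a = 0 -> a = 0.
Proof.
move=> h; have := norm_adj_amul a; rewrite h normr0 => /esym/eqP.
by rewrite expf_eq0 /= normr_eq0 => /eqP.
Qed.
End CstarTheory.

(** * Spectral resolution of self-adjoint elements *)

Lemma mxtrace_idem (K : fieldType) n (M : 'M[K]_n) :
  M *m M = M -> \tr M = (\rank M)%:R.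
Proof.
move=> hM; rewrite -{1}(mulmx_base M) mxtrace_mulC.
suff -> : row_base M *m col_base M = 1%:M by rewrite mxtrace1.
have h : col_base M *m (row_base M *m col_base M) *m row_base M
       = col_base M *m 1%:M *m row_base M.
  by rewrite mulmx1 mulmxA -mulmxA !mulmx_base.
have /row_fullP[L hL] := col_base_full M.
have /row_freeP[N hN] := row_base_free M.
move: L N h hL hN; move: (col_base M) (row_base M) => C Q L N h hL hN.
move/(congr1 (fun X => L *m X *m N)): h => /=.
by rewrite !mulmxA hL !mul1mx -!mulmxA hN !mulmx1.
Qed.

Section MatrixOfEndomorphism.
Variables (K : fieldType) (V : lmodType K) (n : nat).
Variables (rv : V -> 'rV[K]_n) (vr : 'rV[K]_n -> V).
Hypotheses (rv_lin : linear rv) (rvK : cancel rv vr) (vrK : cancel vr rv).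

(** Matrices act on rows, so composition is reversed. *)
Definition endo_mx (g : V -> V) : 'M[K]_n :=
  \matrix_(i < n) rv (g (vr (delta_mx 0 i))).

Lemma vr_linear : linear vr.
Proof. by move=> k x y; apply: (can_inj rvK); rewrite rv_lin !vrK. Qed.

Lemma mul_endo_mx (g : V -> V) x : linear g -> rv x *m endo_mx g = rv (g x).
Proof.
move=> hg; rewrite mulmx_sum_row.
have -> : x = \sum_i (rv x 0 i) *: vr (delta_mx 0 i).
  apply: (can_inj rvK); rewrite (fun_sum rv_lin) {1}[rv x]row_sum_delta.
  by apply: eq_bigr => i _; rewrite (funZ rv_lin) vrK.
rewrite (fun_sum hg) !(fun_sum rv_lin); apply: eq_bigr => i _.
rewrite rowK (funZ hg) (funZ rv_lin) summxE; congr (_ *: _).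
rewrite (bigD1 i)//= big1 ?addr0 => [|j /negPf ji].
  by rewrite (funZ rv_lin) vrK !mxE !eqxx mulr1.
by rewrite (funZ rv_lin) vrK !mxE eqxx eq_sym ji mulr0.
Qed.

Lemma endo_mx_eq (g : V -> V) (M : 'M[K]_n) : linear g ->
  (forall x, rv x *m M = rv (g x)) -> endo_mx g = M.
Proof.
move=> hg h; apply/row_matrixP => i; rewrite !rowE.
by rewrite -[delta_mx 0 i]vrK h mul_endo_mx.
Qed.

End MatrixOfEndomorphism.

Section LeftRegular.
Variables (R : realType) (D : cstarAlgType R) (n : nat).
Notation K := R[i].
Variables (rv : D -> 'rV[K]_n) (vr : 'rV[K]_n -> D).
Hypotheses (rv_lin : linear rv) (rvK : cancel rv vr) (vrK : cancel vr rv).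
Implicit Types x y z w : D.

Definition lreg x : 'M[K]_n := endo_mx rv vr (amul x).
Definition rtrace x : K := \tr (lreg x).

Let amul_lin x : linear (amul x).
Proof. exact: (@amul_bilinear K D).2. Qed.

Let lregE x y : rv y *m lreg x = rv (x ** y).
Proof. exact: (mul_endo_mx rv_lin rvK vrK). Qed.

Lemma lregM x y : lreg (x ** y) = lreg y *m lreg x.
Proof.
apply: (endo_mx_eq rv_lin rvK vrK) => // z.
by rewrite mulmxA !lregE amulA.
Qed.

Lemma lreg_lin : linear lreg.
Proof.
move=> k x y; apply: (endo_mx_eq rv_lin rvK vrK) => // z.
by rewrite mulmxDr -scalemxAr !lregE amulDl amulZl rv_lin.
Qed.

Lemma lreg_inj x : lreg x = 0 -> x = 0.
Proof.
move=> h; apply: (can_inj rvK); rewrite -[x]amul1r -lregE h mulmx0.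
by rewrite (fun0 rv_lin).
Qed.

Lemma rtrace_lin : linear (rtrace : D -> K^o).
Proof. by move=> k x y; rewrite /rtrace lreg_lin linearP. Qed.

Lemma rtraceC x y : rtrace (x ** y) = rtrace (y ** x).
Proof. by rewrite /rtrace !lregM mxtrace_mulC. Qed.

Lemma rtrace_idem x : x ** x = x -> rtrace x = (\rank (lreg x))%:R.
Proof. by move=> h; rewrite /rtrace mxtrace_idem// -lregM h. Qed.

(** The trace of an idempotent is a rank; the lower bound is what makes the regular
    trace faithful and, later, dominant over every y^* y. *)
Lemma rtrace_idem_ge1 x : x ** x = x -> x != 0 -> 1 <= rtrace x.
Proof.
move=> /rtrace_idem-> x0; rewrite ler1n lt0n mxrank_eq0.
by apply: contra x0 => /eqP/lreg_inj->.
Qed.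

(** A vector annihilated by (z - mu)^2, with z self-adjoint, is annihilated by
    z - mu: this is why a self-adjoint element is diagonalisable, and the
    condition that y^* y = 0 forces y = 0 is all it takes. *)
Lemma selfadj_reduced z mu w v : adj z = z -> v = z ** w - mu *: w ->
  z ** v = mu *: v -> v = 0.
Proof.
move=> hz hv zv; apply: adj_amul_eq0.
have e : adj v ** z = mu^* *: adj v by rewrite -{1}hz -adjM zv adjZ.
have /eqP : mu *: (adj v ** v) = mu^* *: (adj v ** v).
  by rewrite -amulZr -zv amulA e amulZl.
rewrite -subr_eq0 -scalerBl scaler_eq0 subr_eq0 => /orP[/eqP mur|/eqP//].
by rewrite {2}hv amulBr amulA e -mur amulZl amulZr subrr.
Qed.

Definition shifts z (s : seq K) y := foldl (fun y mu => z ** y - mu *: y) y s.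

(** Each factor z - mu is removed in turn: y is corrected by multiples of the
    eigenvectors already found for z y - mu y, and what remains is killed by
    (z - mu)^2, hence by z - mu. *)
Lemma eigen_decomp z (hz : adj z = z) s : forall y, shifts z s y = 0 ->
  exists (t : seq K) (E : K -> D),
    [/\ uniq t, forall l, l \in t -> z ** E l = l *: E l,
        y = \sum_(l <- t) E l &
        forall c, c ** z = z ** c -> c ** y = y ** c ->
          forall l, c ** E l = E l ** c].
Proof.
elim: s => [|mu s IH] y /= h.
  exists [::], (fun=> 0); split=> //; first by rewrite big_nil.
  by move=> *; rewrite amul0l amul0r.
have [t [E [ut zE sE cE]]] := IH _ h.
pose w := y - \sum_(l <- t | l != mu) (l - mu)^-1 *: E l.
pose E' l := if l == mu then w else (l - mu)^-1 *: E l.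
have hsum : \sum_(l <- t | l != mu) (l - mu)^-1 *: E l
          = \sum_(l <- [seq l <- t | l != mu]) E' l.
  by rewrite big_filter; apply: eq_bigr => l /negPf lmu; rewrite /E' lmu.
have zw : z ** w - mu *: w = \sum_(l <- t | l == mu) E l.
  have -> : z ** w - mu *: w = (z ** y - mu *: y) -
    \sum_(l <- t | l != mu) (z ** ((l - mu)^-1 *: E l) - mu *: ((l - mu)^-1 *: E l)).
    rewrite /w amulBr scalerBr amul_sumr scaler_sumr sumrB.
    by rewrite opprD addrACA -opprD.
  rewrite sE (bigID (fun l => l == mu))/= -addrA -sumrB [X in _ + X]big1_seq ?addr0// => l.
  move=> /andP[lmu lt]; rewrite amulZr zE// scalerA [mu *: _]scalerA -scalerBl.
  rewrite [mu * _]mulrC -mulrBr mulVf ?scale1r ?subrr//.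
  by rewrite subr_eq0.
have zw0 : z ** w - mu *: w = 0.
  apply: (@selfadj_reduced z mu w) => //; rewrite zw amul_sumr scaler_sumr.
  rewrite big_seq_cond [RHS]big_seq_cond; apply: eq_bigr => l /andP[lt /eqP <-].
  exact: zE.
exists (mu :: [seq l <- t | l != mu]), E'; split=> /=.
- by rewrite mem_filter eqxx/= filter_uniq.
- move=> l; rewrite inE => /orP[/eqP->|]; rewrite /E'.
    by rewrite eqxx; apply/eqP; rewrite -subr_eq0 zw0.
  rewrite mem_filter => /andP[/negPf-> lt].
  by rewrite amulZr zE// !scalerA mulrC.
- by rewrite big_cons -hsum {1}/E' eqxx /w subrK.
- move=> c cz cy; have cE' l : c ** E l = E l ** c.
    apply: cE => //; rewrite amulBr amulBl amulZr amulZl cy !amulA cz -!amulA.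
    by rewrite cy.
  move=> l; rewrite /E'; case: ifP => _; last by rewrite amulZr amulZl cE'.
  rewrite /w amulBr amulBl cy amul_sumr amul_suml; congr (_ - _).
  by apply: eq_bigr => j _; rewrite amulZr amulZl cE'.
Qed.

(** Cayley-Hamilton for left multiplication by z, over the algebraically closed R[i]. *)
Lemma shifts_annihilates z : exists s, shifts z s (aone D) = 0.
Proof.
case: n rv vr rv_lin rvK vrK => [|m] rv' vr' rl rk vk.
  by exists [::]; apply: (can_inj rk); apply/matrixP => ? [].
have [s] := closed_field_poly_normal (char_poly (endo_mx rv' vr' (amul z))).
rewrite (monicP (char_poly_monic _)) scale1r => cp.
exists s; apply: (can_inj rk); rewrite (fun0 rl).
have -> y : rv' (shifts z s y)
    = rv' y *m horner_mx (endo_mx rv' vr' (amul z)) (\prod_(mu <- s) ('X - mu%:P)).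
  elim: s {cp} y => [|mu s IH] y; first by rewrite big_nil rmorph1 mulmx1.
  rewrite big_cons /= IH rmorphM/= -[(_ * _)%R]/(_ *m _) mulmxA; congr (_ *m _).
  rewrite rmorphB/= horner_mx_X horner_mx_C mulmxBr mul_mx_scalar.
  by rewrite (mul_endo_mx rl rk vk)// (funB rl) (funZ rl).
by rewrite -cp Cayley_Hamilton mulmx0.
Qed.

(** By [eigen_decomp], 1 is a sum of eigenvectors of z that commute with whatever commutes
    with z; that they are orthogonal self-adjoint projections follows from z^* = z. *)
Lemma spectral_resolution z : adj z = z ->
  exists (t : seq K) (E : K -> D),
    [/\ uniq t, forall l, l \in t -> z ** E l = l *: E l /\ E l <> 0,
        aone D = \sum_(l <- t) E l,
        forall c, c ** z = z ** c -> forall l, c ** E l = E l ** c &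
        forall l, l \in t -> adj (E l) = E l /\
          forall m, m \in t -> E l ** E m = if l == m then E l else 0].
Proof.
move=> hz; have [s /(eigen_decomp hz)[t' [E [ut' zE' s1' cE']]]] := shifts_annihilates z.
pose t := [seq l <- t' | E l != 0].
have ut : uniq t by apply: filter_uniq.
have zE l : l \in t -> z ** E l = l *: E l.
  by rewrite mem_filter => /andP[_ /zE'].
have E0 l : l \in t -> E l <> 0 by rewrite mem_filter => /andP[/eqP].
have s1 : aone D = \sum_(l <- t) E l.
  rewrite s1' big_filter [LHS](bigID (fun l => E l == 0))/= big1 ?add0r//.
  by move=> l /eqP.
have cE c : c ** z = z ** c -> forall l, c ** E l = E l ** c.
  by move=> cz l; apply: cE' => //; rewrite amul1l amul1r.
have orth l m : l \in t -> m \in t -> l != m -> E l ** E m = 0.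
  move=> lt mt lm; apply/eqP.
  have : z ** E l ** E m = E l ** (z ** E m) by rewrite amulA (cE z).
  rewrite !zE// amulZl amulZr => /eqP; rewrite -subr_eq0 -scalerBl scaler_eq0.
  by rewrite subr_eq0 (negPf lm).
have idem l : l \in t -> E l ** E l = E l.
  move=> lt; rewrite -[RHS]amul1r s1 amul_sumr (bigD1_seq l)//= big_seq_cond.
  by rewrite big1 ?addr0// => m /andP[mt ml]; rewrite orth// eq_sym.
have lreal l : l \in t -> l^* = l.
  move=> lt; apply/eqP; rewrite -subr_eq0.
  have : adj (E l) ** z ** E l = adj (E l) ** (z ** E l) by rewrite amulA.
  rewrite -{1}hz -adjM zE// adjZ amulZl amulZr => /eqP.
  rewrite -subr_eq0 -scalerBl scaler_eq0 => /orP[//|/eqP/adj_amul_eq0].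
  by move/E0: lt.
have sa l : l \in t -> adj (E l) = E l.
  move=> lt; have adjE : adj (E l) ** E l = adj (E l).
    rewrite -[RHS]amul1r s1 amul_sumr (bigD1_seq l)//= big_seq_cond.
    rewrite big1 ?addr0// => m /andP[mt ml]; apply/eqP.
    have : adj (E l) ** z ** E m = adj (E l) ** (z ** E m) by rewrite amulA.
    rewrite -{1}hz -adjM !zE// adjZ lreal// amulZl amulZr => /eqP.
    rewrite -subr_eq0 -scalerBl scaler_eq0 subr_eq0 => /orP[/eqP lm|/eqP//].
    by rewrite lm eqxx in ml.
  by rewrite -[RHS]adjK -{2}adjE adjM adjK adjE.
exists t, E; split=> // [l lt|l lt]; first by split; [apply: zE | apply: E0].
split; first exact: sa.
by move=> m mt; case: eqVneq => [<-|lm]; [apply: idem | apply: orth].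
Qed.

End LeftRegular.

(** * Traces of index one and densities *)

Section DualBases.
Variables (K : fieldType) (V W : lmodType K) (f : V -> W -> K^o).
Hypotheses (hf : is_bilinear f).
Hypotheses (fdV : finite_dimensional V) (fdW : finite_dimensional W).
Hypotheses (ndl : forall v, (forall w, f v w = 0) -> v = 0).
Hypotheses (ndr : forall w, (forall v, f v w = 0) -> w = 0).

(** A left inverse of the Gram matrix turns any basis into a dual pair. *)
Lemma dual_bases : exists (n : nat) (x : 'I_n -> V) (y : 'I_n -> W),
  (forall v, v = \sum_i f v (y i) *: x i) /\
  (forall w, w = \sum_i f (x i) w *: y i).
Proof.
have [n [rv [rl [vr rK vK]]]] := fdV.
have [m [rw [wl [wr wK wvK]]]] := fdW.
have vl := vr_linear rl rK vK; have wrl := vr_linear wl wK wvK.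
pose G : 'M[K]_(n, m) := \matrix_(i, j) f (vr (delta_mx 0 i)) (wr (delta_mx 0 j)).
have GE v (u : 'cV_m) : (v *m G *m u) 0 0 = f (vr v) (wr u^T).
  rewrite {2}[v]row_sum_delta [u^T]row_sum_delta !(fun_sum vl) !(fun_sum wrl).
  rewrite (bil_suml hf) mxE; under [RHS]eq_bigr do rewrite (bil_sumr hf).
  rewrite exchange_big/=; apply: eq_bigr => j _; rewrite mxE mulr_suml.
  apply: eq_bigr => i _; rewrite !mxE (funZ vl) (funZ wrl) (bilZl hf) (bilZr hf).
  by rewrite -[_ *: (_ *: _)]/(_ * (_ * _)) -mulrA [_ * u _ _]mulrC.
have /row_freeP[Y GY] : row_free G.
  apply/inj_row_free => v vG; rewrite -[v]vK (ndl (v := vr v)) ?(fun0 rl)// => w.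
  by rewrite -[w]wK -[rw w]trmxK -GE vG mul0mx mxE.
exists n, (fun i => vr (delta_mx 0 i)), (fun i => wr (col i Y)^T).
have vE v : v = \sum_i f v (wr (col i Y)^T) *: vr (delta_mx 0 i).
  apply: (can_inj rK); rewrite (fun_sum rl) {1}[rv v]row_sum_delta.
  apply: eq_bigr => i _; rewrite (funZ rl) vK; congr (_ *: _).
  by rewrite -[v in f v]rK -GE colE !mulmxA -(mulmxA _ G) GY mulmx1 -colE mxE.
split=> // w; apply/eqP; rewrite -subr_eq0; apply/eqP/ndr => v.
rewrite (bilBr hf) (bil_sumr hf) {1}[v]vE (bil_suml hf); apply/eqP; rewrite subr_eq0.
apply/eqP/eq_bigr => i _; rewrite (bilZl hf) (bilZr hf).
by rewrite -[LHS]/(_ * _) -[RHS]/(_ * _) mulrC.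
Qed.
End DualBases.

(** A trace may be computed in a spanning family with chosen coefficients, linearly
    independent or not. *)
Lemma mxtrace_endo_dual (K : fieldType) (V : lmodType K) (n : nat)
    (rv : V -> 'rV[K]_n) (vr : 'rV[K]_n -> V) :
  linear rv -> cancel rv vr -> cancel vr rv ->
  forall (g : V -> V) (m : nat) (x : 'I_m -> V) (c : 'I_m -> V -> K),
  linear g -> (forall p, linear (c p : V -> K^o)) ->
  (forall v, v = \sum_p c p v *: x p) ->
  \tr (endo_mx rv vr g) = \sum_p c p (g (x p)).
Proof.
move=> rl rK vK g m x c gl cl vE.
have vl := vr_linear rl rK vK.
pose X : 'M[K]_(m, n) := \matrix_p rv (x p).
pose C : 'M[K]_(n, m) := \matrix_(i, p) c p (vr (delta_mx 0 i)).
have CE v p : (rv v *m C) 0 p = c p v.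
  rewrite mxE -{2}[v]rK {2}[rv v]row_sum_delta (fun_sum vl) (fun_sum (cl p)).
  by apply: eq_bigr => i _; rewrite (funZ vl) (funZ (cl p)) !mxE.
have CX : C *m X = 1%:M.
  apply/row_matrixP => i; rewrite !rowE mulmx1 -[delta_mx 0 i]vK mulmxA.
  move: (vr _) => v; rewrite mulmx_sum_row [in RHS](vE v) (fun_sum rl).
  by apply: eq_bigr => p _; rewrite (funZ rl) rowK CE.
rewrite -[endo_mx _ _ _]mul1mx -CX -mulmxA mxtrace_mulC /mxtrace.
apply: eq_bigr => p _; rewrite -CE -(mul_endo_mx rl rK vK)//.
transitivity (row p (X *m endo_mx rv vr g *m C) 0 p); first by rewrite rowE -mulmxA -rowE [RHS]mxE.
by rewrite !row_mul rowK.
Qed.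

Section StandardTrace.
Variables (R : realType) (D : cstarAlgType R).
Notation K := R[i].
Hypothesis fdD : finite_dimensional D.
Implicit Types x y z h c : D.

Definition pos_def (f : D -> K) := forall y, y <> 0 -> 0 < f (adj y ** y).

(** z is the sum of the l E_l, for l in t. Commutation with the E_l is part of it: it is
    how centrality passes from an element to its roots. *)
Definition spec_res z (t : seq K) (E : K -> D) :=
  [/\ uniq t, forall l, l \in t -> z ** E l = l *: E l /\ E l <> 0,
        aone D = \sum_(l <- t) E l,
        forall c, c ** z = z ** c -> forall l, c ** E l = E l ** c &
        forall l, l \in t -> adj (E l) = E l /\
          forall m, m \in t -> E l ** E m = if l == m then E l else 0].

Definition fcalc (t : seq K) (E : K -> D) (g : K -> K) : D :=
  \sum_(l <- t) g l *: E l.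

Section FunctionalCalculus.
Variables (z : D) (t : seq K) (E : K -> D).
Hypothesis sr : spec_res z t E.
Local Notation fc := (fcalc t E).

Lemma fcalc_id : fc id = z.
Proof.
case: sr => ut zE s1 _ _; rewrite -[RHS]amul1r s1 amul_sumr /fcalc big_seq [RHS]big_seq.
by apply: eq_bigr => l /zE[].
Qed.

Lemma fcalc1 : fc (fun=> 1) = aone D.
Proof.
by case: sr => _ _ -> _ _; apply: eq_bigr => l _; rewrite scale1r.
Qed.

Lemma fcalcM g g' : fc g ** fc g' = fc (fun l => g l * g' l).
Proof.
case: sr => ut _ _ _ ort; rewrite amul_suml /fcalc big_seq [RHS]big_seq.
apply: eq_bigr => l lt; rewrite amul_sumr (bigD1_seq l)//= big_seq_cond big1.
  by rewrite addr0 amulZl amulZr scalerA (ort l lt).2// eqxx.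
move=> m /andP[mt ml]; rewrite amulZl amulZr (ort l lt).2// eq_sym (negPf ml).
by rewrite !scaler0.
Qed.

Lemma eq_fcalc g g' : {in t, g =1 g'} -> fc g = fc g'.
Proof.
by move=> h; rewrite /fcalc big_seq [RHS]big_seq; apply: eq_bigr => l /h->.
Qed.

Lemma fcalc_adj g : {in t, forall l, (g l)^* = g l} -> adj (fc g) = fc g.
Proof.
case: sr => _ _ _ _ ort h; rewrite adj_sum big_seq [RHS]big_seq.
by apply: eq_bigr => l lt; rewrite adjZ h// (ort l lt).1.
Qed.

Lemma fcalc_comm g c : c ** z = z ** c -> c ** fc g = fc g ** c.
Proof.
case: sr => _ _ _ cE _ /cE h; rewrite amul_suml amul_sumr.
by apply: eq_bigr => l _; rewrite amulZl amulZr h.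
Qed.

Lemma eigen_real : adj z = z -> {in t, forall l, l^* = l}.
Proof.
case: sr => _ zE _ cE ort hz l lt; have [zl El0] := zE l lt.
have [sl ol] := ort l lt; apply/eqP; rewrite -subr_eq0.
have := zl; rewrite -{1}hz -{1}sl -adjM -cE// zl adjZ sl => /eqP.
by rewrite -subr_eq0 -scalerBl scaler_eq0 => /orP[//|/eqP].
Qed.

(** If E is an eigenprojection of y^* y for l then (y E)^* (y E) = l E, so that l is a
    quotient of values of a positive functional. *)
Lemma eigen_ge0 (f : D -> K) y : linear (f : D -> K^o) -> pos_def f ->
  z = adj y ** y -> {in t, forall l, 0 <= l}.
Proof.
case: sr => _ zE _ _ ort fl fp hz l lt; have [zl El0] := zE l lt.
have [sl ol] := ort l lt.
have e : adj (y ** E l) ** (y ** E l) = l *: E l.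
  by rewrite adjM sl amulA -(amulA (E l)) -hz -amulA zl amulZr ol// eqxx.
have f0 : 0 < f (E l) by have := fp _ El0; rewrite sl ol// eqxx.
have : 0 <= f (l *: E l).
  rewrite -e; case: (pselect (y ** E l = 0)) => [->|/fp/ltW//].
  by rewrite adj0 amul0l (fun0 fl).
by rewrite (funZ fl) -[_ *: _]/(_ * _) pmulr_lge0.
Qed.
End FunctionalCalculus.

Lemma spec_res_exists z : adj z = z -> exists t E, spec_res z t E.
Proof.
case: fdD => n [rv [rl [vr rK vK]]] /(spectral_resolution rl rK vK) [t [E H]].
by exists t, E.
Qed.

(** A general x is a combination of the self-adjoint x + x^* and i (x - x^* ). *)
Lemma herm_of_selfadj_real (f : D -> K) : linear (f : D -> K^o) ->
  (forall c, adj c = c -> (f c)^* = f c) -> forall x, f (adj x) = (f x)^*.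
Proof.
move=> fl fr x; pose a := f x; pose b := f (adj x).
have h1 : a^* + b^* = a + b.
  have := fr (x + adj x); rewrite (funD fl) => e; rewrite -[LHS]rmorphD; apply: e.
  by rewrite adjD adjK addrC.
have h2 : a^* - b^* = - (a - b).
  have : ('i * (a - b))^* = 'i * (a - b).
    have := fr ('i *: (x - adj x)); rewrite (funZ fl) (funB fl); apply.
    by rewrite adjZ adjB adjK conjCi scaleNr -scalerN opprB.
  rewrite rmorphM/= conjCi mulNr -mulrN => /(mulfI (neq0Ci _)) <-.
  by rewrite opprK rmorphB.
apply: (mulfI (x := 2%:R)); first by rewrite pnatr_eq0.
rewrite -/a -/b !mulr_natl !mulr2n.
have -> : a^* + a^* = (a^* + b^*) + (a^* - b^*) by move: (a^*) (b^*) => u v; ring.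
by rewrite h1 h2; ring.
Qed.

(** The spectrum of y^* y is taken to be nonnegative here. It is so as soon as some
    faithful positive functional exists, and in commutative algebras; these are the
    two situations met below. *)
Section TraceFromPositiveSpectrum.
Hypothesis psp : forall y t E, spec_res (adj y ** y) t E -> {in t, forall l, 0 <= l}.

(** The regular trace. Its dual bases satisfy sum y x = 1 because the trace of left
    multiplication by a, computed in these bases, is tr (a (sum y x)). *)
Lemma positive_trace : exists tr : D -> K,
  [/\ linear (tr : D -> K^o), forall x y, tr (x ** y) = tr (y ** x),
      pos_def tr, forall x, tr (adj x) = (tr x)^* &
  [/\ forall e, e ** e = e -> e <> 0 -> 1 <= tr e &
      exists (m : nat) (x y : 'I_m -> D),
      (forall a, a = \sum_p tr (y p ** a) *: x p) /\
      \sum_p y p ** x p = aone D]].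
Proof.
case: (fdD) => n [rv [rl [vr rK vK]]].
pose tr := rtrace rv vr.
have trl : linear (tr : D -> K^o) by exact: rtrace_lin.
have trC x y : tr (x ** y) = tr (y ** x) by exact: rtraceC.
have tr1 e : e ** e = e -> e <> 0 -> 1 <= tr e.
  by move=> ee /eqP e0; apply: rtrace_idem_ge1.
have trE z t E : spec_res z t E -> tr z = \sum_(l <- t) l * tr (E l).
  move=> sr; rewrite -{1}(fcalc_id sr) (fun_sum trl); apply: eq_bigr => l _.
  by rewrite (funZ trl).
have trp : pos_def tr.
  move=> y y0; have zsa : adj (adj y ** y) = adj y ** y by rewrite adjM adjK.
  have [t [E sr]] := spec_res_exists zsa.
  have tge := psp sr; case: (sr) => ut zE s1 cE ort.
  rewrite (trE _ _ _ sr) lt_def; apply/andP; split; last first.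
    rewrite big_seq sumr_ge0// => l lt; apply: mulr_ge0; first exact: tge.
    apply: (le_trans ler01); apply: tr1; last exact: (zE l lt).2.
    by rewrite (ort l lt).2// eqxx.
  apply/eqP; rewrite big_seq => /eqP; rewrite psumr_eq0 => [/allP all0|l lt].
    apply: y0; apply: adj_amul_eq0; rewrite -(fcalc_id sr) /fcalc big_seq big1// => l lt.
    have /implyP/(_ lt) := all0 l lt; rewrite mulf_eq0 => /orP[/eqP->|/eqP t0].
      by rewrite scale0r.
    suff : 1 <= tr (E l) by rewrite t0 ler10.
    by apply: tr1; [rewrite (ort l lt).2// eqxx | exact: (zE l lt).2].
  apply: mulr_ge0; first exact: tge.
  apply: (le_trans ler01); apply: tr1; last exact: (zE l lt).2.
  by rewrite (ort l lt).2// eqxx.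
have trh : forall x, tr (adj x) = (tr x)^*.
  apply: herm_of_selfadj_real => // c sc.
  have [t [E sr]] := spec_res_exists sc.
  rewrite (trE _ _ _ sr) rmorph_sum big_seq [RHS]big_seq; apply: eq_bigr => l lt.
  rewrite rmorphM/= (eigen_real sr sc lt); congr (_ * _).
  case: sr => _ _ _ _ /(_ l lt)[_ /(_ l lt)]; rewrite eqxx => ee.
  by rewrite /tr rtrace_idem// conjC_nat.
have nd v : (forall w, tr (w ** v) = 0) -> v = 0.
  move=> h; apply: contrapT => /trp; rewrite h; by rewrite ltxx.
have bl : is_bilinear (fun v w => tr (v ** w) : K^o).
  by split=> ? k ? ?; rewrite /= ?amulDl ?amulZl ?amulDr ?amulZr trl.
have [m [x [y [xE yE]]]] : exists (n : nat) (x : 'I_n -> D) (y : 'I_n -> D),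
    (forall v, v = \sum_i tr (v ** y i) *: x i) /\
    (forall w, w = \sum_i tr (x i ** w) *: y i).
  apply: (dual_bases bl) => // v h; apply: nd => w.
  by rewrite trC; apply: h.
have xE' a : a = \sum_p tr (y p ** a) *: x p.
  by rewrite {1}[a]xE; apply: eq_bigr => p _; rewrite trC.
exists tr; split=> //; split=> //; exists m, y, x; split=> //.
apply/eqP; rewrite -subr_eq0; apply/eqP/nd => a.
rewrite amulBr (funB trl) amul1r {2}/tr /rtrace /lreg.
rewrite (mxtrace_endo_dual rl rK vK (x := x) (c := fun p v => tr (y p ** v)))//.
- apply/eqP; rewrite subr_eq0 amul_sumr (fun_sum trl); apply/eqP/eq_bigr => p _.
  by rewrite amulA trC amulA.
- exact: (@amul_bilinear K D).2.
- by move=> p k u v; rewrite /= amulDr amulZr trl.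
Qed.
End TraceFromPositiveSpectrum.

(** In a commutative algebra the spectrum of y^* y is nonnegative because y^* y
    is a sum of two squares of commuting self-adjoint elements. *)
Lemma comm_pos_spectrum : (forall x y, x ** y = y ** x) ->
  forall y t E, spec_res (adj y ** y) t E -> {in t, forall l, 0 <= l}.
Proof.
move=> C y t E [ut zE s1 cE ort] l lt; have [zl El0] := zE l lt.
have [sl ol] := ort l lt; have ee : E l ** E l = E l by rewrite ol// eqxx.
pose x := y ** E l; pose c := x + adj x; pose d := 'i *: (x - adj x).
have cs : adj c = c by rewrite adjD adjK addrC.
have ds : adj d = d.
  by rewrite adjZ adjB adjK conjCi scaleNr -scalerN opprB.
have cd : c ** c + d ** d = (4%:R * l) *: E l.
  rewrite /d amulZl amulZr scalerA -expr2 sqrCi scaleN1r /c.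
  rewrite !(amulDl, amulDr, amulNl, amulNr) (C x (adj x)) !opprK.
  set p := x ** x; set q := adj x ** x; set r := adj x ** adj x.
  have -> : q = l *: E l.
    by rewrite /q /x adjM sl amulA -(amulA (E l)) (C (E l)) -amulA ee zl.
  rewrite -scalerA; move: (l *: E l) => q'.
  have -> : 4%:R *: q' = q' + q' + (q' + q').
    by rewrite -!mulr2n -mulrnA scaler_nat.
  rewrite !opprD !opprK addrACA.
  rewrite [p + q' + _]addrACA [q' + r + _]addrACA !subrr add0r addr0.
  by [].
have resolve e (v : D) : adj e = e -> v <> 0 -> exists F m,
    [/\ e ** (F ** v) = m *: (F ** v), F ** v <> 0 & m^* = m].
  move=> es v0; have [t' [E' sr']] := spec_res_exists es.
  case: (sr') => ut' zE' s1' _ _.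
  have [m mt Em] : exists2 m, m \in t' & E' m ** v <> 0.
    apply: contrapT => h; apply: v0; rewrite -[v]amul1l s1' amul_suml big_seq big1// => m mt.
    by apply: contrapT => h'; apply: h; exists m.
  exists (E' m), m; split=> //; first by rewrite amulA (zE' m mt).1 amulZl.
  exact: (eigen_real sr' es).
have [F [m [cF F0 mr]]] := resolve _ _ cs El0.
have [G [m' [dG G0 mr']]] := resolve _ _ ds F0.
have : (c ** c + d ** d) ** (G ** (F ** E l))
     = (m ^+ 2 + m' ^+ 2) *: (G ** (F ** E l)).
  have cG v : c ** (G ** v) = G ** (c ** v) by rewrite !amulA (C c).
  rewrite amulDl -!amulA !cG cF !dG !amulZr cF dG amulZr.
  by rewrite !scalerA -!expr2 -scalerDl.
rewrite cd amulZl (C _ (G ** _)) -!amulA ee => /eqP.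
rewrite -subr_eq0 -scalerBl scaler_eq0 => /orP[|/eqP//]; rewrite subr_eq0 => /eqP h.
have : 0 <= 4%:R * l.
  by rewrite h addr_ge0// -realEsqr CrealE ?mr ?mr'.
by rewrite pmulr_rge0// ltr0n.
Qed.

Section Densities.
Variables (tr : D -> K) (f : D -> K).
Hypotheses (trl : linear (tr : D -> K^o)) (trC : forall x y, tr (x ** y) = tr (y ** x)).
Hypotheses (trp : pos_def tr) (trh : forall x, tr (adj x) = (tr x)^*).
Hypotheses (fl : linear (f : D -> K^o)) (fh : forall x, f (adj x) = (f x)^*).
Hypothesis fp : pos_def f.

(** The density h of f with respect to tr is self-adjoint, and its eigenvalues are
    quotients of values of f and tr, hence positive; the roots are taken in its spectral
    resolution. Two successive twists by square roots will need a fourth root. *)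
Lemma density_root : exists h p p' : D,
  [/\ forall x, f x = tr (h ** x), adj p = p, adj p' = p',
      p ** p' = aone D /\ p' ** p = aone D &
      h = p ** p ** (p ** p) /\
      forall c, c ** h = h ** c -> c ** p = p ** c].
Proof.
have nd v : (forall w, tr (w ** v) = 0) -> v = 0.
  by move=> h; apply: contrapT => /trp; rewrite h ltxx.
have bl : is_bilinear (fun v w => tr (v ** w) : K^o).
  by split=> ? k ? ?; rewrite /= ?amulDl ?amulZl ?amulDr ?amulZr trl.
have [m [x [y [xE yE]]]] : exists (n : nat) (x : 'I_n -> D) (y : 'I_n -> D),
    (forall v, v = \sum_i tr (v ** y i) *: x i) /\
    (forall w, w = \sum_i tr (x i ** w) *: y i).
  apply: (dual_bases bl) => // v h; apply: nd => w.
  by rewrite trC; apply: h.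
pose h := \sum_i f (y i) *: x i.
have hE v : f v = tr (h ** v).
  rewrite amul_suml (fun_sum trl) {1}[v]yE (fun_sum fl); apply: eq_bigr => i _.
  rewrite (funZ fl) amulZl (funZ trl).
  by rewrite -[LHS]/(_ * _) -[RHS]/(_ * _) mulrC.
have hs : adj h = h.
  apply/eqP; rewrite -subr_eq0; apply/eqP/nd => w.
  rewrite amulBr (funB trl) [in X in _ - X]trC -hE; apply/eqP; rewrite subr_eq0; apply/eqP.
  by rewrite -[w in LHS]adjK -adjM trh -hE fh conjCK.
have [t [E sr]] := spec_res_exists hs; case: (sr) => ut zE s1 cE ort.
have tp l : l \in t -> 0 < l.
  move=> lt; have [zl E0] := zE l lt; have [sl ol] := ort l lt.
  have ee : E l ** E l = E l by rewrite ol// eqxx.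
  have t0 : 0 < tr (E l) by have := trp E0; rewrite sl ee.
  have : 0 < f (E l) by have := fp E0; rewrite sl ee.
  by rewrite hE zl (funZ trl) -[_ *: _]/(_ * _) pmulr_lgt0.
pose g (l : K) := sqrtC (sqrtC l).
have g0 l : l \in t -> 0 < g l by move=> /tp l0; rewrite /g !sqrtC_gt0.
have gr l : l \in t -> (g l)^* = g l.
  by move=> /g0 /ltW gl; apply: conj_Creal; apply: ger0_real.
exists h, (fcalc t E g), (fcalc t E (fun l => (g l)^-1)); split=> //.
- exact: (fcalc_adj sr).
- by apply: (fcalc_adj sr) => l lt; rewrite fmorphV/= gr.
- rewrite !(fcalcM sr) -(fcalc1 sr).
  by split; apply: eq_fcalc => l /g0 l0; rewrite ?mulVf ?mulfV// gt_eqF.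
- split; last by move=> c; apply: (fcalc_comm sr).
  rewrite !(fcalcM sr) -[LHS](fcalc_id sr); apply: eq_fcalc => l lt.
  by rewrite -!expr2 !sqrtCK.
Qed.
End Densities.

(** An eigenprojection has trace at least 1, so that the eigenvalues of y^* y are at most
    tr (y^* y). *)
Lemma comm_trace : (forall x y, x ** y = y ** x) -> exists f : D -> K,
  [/\ linear (f : D -> K^o), pos_def f, forall x, f (adj x) = (f x)^* &
   forall y, exists s, f (adj y ** y) *: aone D - adj y ** y = adj s ** s].
Proof.
move=> C; have psp := comm_pos_spectrum C.
have [tr [trl _ trp trh [tr1 _]]] := positive_trace psp.
exists tr; split=> // y; set z := adj y ** y.
have zsa : adj z = z by rewrite adjM adjK.
have [t [E sr]] := spec_res_exists zsa; have tge := psp _ _ _ sr.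
case: (sr) => ut zE s1 cE ort.
have trE l : l \in t -> 1 <= tr (E l).
  move=> lt; apply: tr1; last exact: (zE l lt).2.
  by rewrite (ort l lt).2// eqxx.
have dom l : l \in t -> 0 <= tr z - l.
  move=> lt; rewrite -(fcalc_id sr) (fun_sum trl) (bigD1_seq l)//= (funZ trl).
  rewrite subr_ge0; apply: (@le_trans _ _ (l * tr (E l))).
    by rewrite ler_peMr ?trE ?tge.
  rewrite lerDl big_seq_cond sumr_ge0// => k /andP[kt _]; rewrite (funZ trl).
  by apply: mulr_ge0; [exact: tge | exact: (le_trans ler01 (trE k kt))].
exists (fcalc t E (fun l => sqrtC (tr z - l))).
rewrite (fcalc_adj sr) ?(fcalcM sr); last first.
  by move=> l /dom l0; apply: conj_Creal; apply: ger0_real; rewrite sqrtC_ge0.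
rewrite -{2}(fcalc_id sr) s1 scaler_sumr -sumrB; apply: eq_bigr => l _.
by rewrite -scalerBl -expr2 sqrtCK.
Qed.
End StandardTrace.

(** * Finite dimensional vector spaces *)

Section FiniteSpan.
Variables (K : fieldType) (V : lmodType K).

(** A linear dependence allows one to drop a generator; without one, the generators
    are a basis. *)
Lemma fd_span_ord n : forall e : 'I_n -> V,
  (forall v, exists c : 'I_n -> K, v = \sum_i c i *: e i) -> finite_dimensional V.
Proof.
elim: n => [|n IH] e sp.
  exists 0%N, (fun=> 0); split; first by move=> k x y; rewrite scaler0 addr0.
  have z (v : V) : v = 0 by have [c ->] := sp v; rewrite big_ord0.
  by exists (fun=> 0) => v; [rewrite [v]z | apply/matrixP => ? []].
case: (pselect (exists c : 'I_n.+1 -> K, \sum_i c i *: e i = 0 /\ exists i, c i != 0)).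
  move=> [c [c0 [i ci]]]; apply: (IH (fun j => e (lift i j))) => v.
  have [d ->] := sp v; exists (fun j => d (lift i j) - d i / c i * c (lift i j)).
  have ei : e i = - \sum_(j < n) (c i)^-1 * c (lift i j) *: e (lift i j).
    apply: (scalerI ci); rewrite scalerN scaler_sumr; apply/eqP.
    rewrite -addr_eq0 -[X in _ == X]c0 (bigD1_ord i)//=; apply/eqP; congr (_ + _).
    by apply: eq_bigr => j _; rewrite scalerA mulrA mulfV// mul1r.
  rewrite (bigD1_ord i)//= {1}ei scalerN scaler_sumr addrC -sumrB.
  by apply: eq_bigr => j _; rewrite scalerA -scalerBl mulrA.
move=> ind.
have un (c d : 'I_n.+1 -> K) : \sum_i c i *: e i = \sum_i d i *: e i -> c =1 d.
  move=> cd i; apply: contrapT => ne; apply: ind; exists (fun i => c i - d i).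
  split; last by exists i; rewrite subr_eq0; apply/eqP.
  under eq_bigr do rewrite scalerBl.
  by rewrite sumrB cd subrr.
pose f v : 'rV[K]_n.+1 := \row_i projT1 (cid (sp v)) i.
have fE v : v = \sum_i f v 0 i *: e i.
  by rewrite {1}(projT2 (cid (sp v))); apply: eq_bigr => i _; rewrite mxE.
have fP v (x : 'rV[K]_n.+1) : v = \sum_i x 0 i *: e i -> f v = x.
  by move=> h; apply/rowP => i; apply: (un (fun i => f v 0 i) (fun i => x 0 i)); rewrite -fE.
exists n.+1, f; split.
  move=> k x y; apply: fP; rewrite {1}[x]fE {1}[y]fE scaler_sumr -big_split.
  by apply: eq_bigr => i _; rewrite !mxE scalerDl scalerA.
by exists (fun x : 'rV[K]_n.+1 => \sum_i x 0 i *: e i) => x; [rewrite -fE | apply: fP].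
Qed.

Lemma fd_span (I : finType) (e : I -> V) :
  (forall v, exists c : I -> K, v = \sum_i c i *: e i) -> finite_dimensional V.
Proof.
move=> sp; apply: (@fd_span_ord #|I| (fun j => e (enum_val j))) => v.
have [c ->] := sp v; exists (fun j => c (enum_val j)).
by rewrite (reindex_onto (@enum_val I I) enum_rank)/= => [|i _];
  [apply: eq_bigl => j; rewrite enum_valK eqxx | rewrite enum_rankK].
Qed.

Lemma fd_basis : finite_dimensional V -> exists n (e : 'I_n -> V),
  forall v, exists c : 'I_n -> K, v = \sum_i c i *: e i.
Proof.
case=> n [rv [rl [vr rK vK]]]; exists n, (fun i => vr (delta_mx 0 i)) => v.
exists (fun i => rv v 0 i); apply: (can_inj rK); rewrite (fun_sum rl) {1}[rv v]row_sum_delta.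
by apply: eq_bigr => i _; rewrite (funZ rl) vK.
Qed.
End FiniteSpan.

Lemma fd_iso (K : fieldType) (V W : lmodType K) (g : V -> W) :
  linear g -> bijective g -> finite_dimensional V -> finite_dimensional W.
Proof.
move=> gl [g' gK g'K] [n [f [fl [f' fK f'K]]]].
exists n, (fun w => f (g' w)); split; last first.
  by exists (fun x => g (f' x)) => x; rewrite ?fK ?gK ?g'K.
move=> k x y; rewrite -fl; congr f; apply: (can_inj gK).
by rewrite g'K gl !g'K.
Qed.

Section OrthogonalProjection.
Variables (R : realType) (V : lmodType R[i]) (f : V -> V -> R[i]).
Hypotheses (fr : forall x, linear (f x : V -> R[i]^o)).
Hypotheses (fc : forall x y, f x y = (f y x)^*) (fp : forall x, f x x = 0 -> x = 0).

(** Gram-Schmidt, one vector at a time; an e_i in the span of the others leaves a null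
    vector, which changes nothing. *)
Lemma orth_proj (I : finType) (e : I -> V) h : exists c : I -> R[i],
  forall i, f (e i) (h - \sum_j c j *: e j) = 0.
Proof.
suff [c hc] : exists c : I -> R[i], forall i, i \in index_enum I ->
    f (e i) (h - \sum_(j <- index_enum I) c j *: e j) = 0.
  by exists c => i; apply: hc; rewrite mem_index_enum.
elim: (index_enum I) (index_enum_uniq I) h => [|a s IH] /= us h; first by exists (fun=> 0).
case/andP: us => as' /[dup] us {}/IH IH.
have [c hc] := IH h; have [d hd] := IH (e a).
set h1 := h - _ in hc; set v := e a - _ in hd.
pose k := f v h1 / f v v; pose h2 := h1 - k *: v.
have h2v : f v h2 = 0.
  rewrite (funB (fr v)) (funZ (fr v)) /k.
  have [v0|v0] := eqVneq (f v v) 0; last by rewrite -[_ *: _]/(_ * _) divfK// subrr.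
  by rewrite v0 scaler0 subr0 fc (fp v0) (fun0 (fr h1)) rmorph0.
exists (fun j => if j == a then k else c j - k * d j) => i.
have -> : h - \sum_(j <- a :: s) (if j == a then k else c j - k * d j) *: e j = h2.
  have sE : \sum_(j <- s) (if j == a then k else c j - k * d j) *: e j
      = \sum_(j <- s) c j *: e j - k *: \sum_(j <- s) d j *: e j.
    rewrite scaler_sumr -sumrB big_seq [RHS]big_seq; apply: eq_bigr => j js.
    have /negPf-> : j != a by apply: contraNneq as' => <-.
    by rewrite scalerBl scalerA.
  by rewrite big_cons eqxx sE /h2 /v /h1 scalerBr addrCA opprD addrA.
have low j : j \in s -> f (e j) h2 = 0.
  by move=> js; rewrite (funB (fr _)) (funZ (fr _)) hc// hd// scaler0 subr0.
rewrite inE => /predU1P[->|/low//].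
rewrite fc; have -> : e a = v + \sum_(j <- s) d j *: e j by rewrite subrK.
rewrite (funD (fr _)) (fun_sum (fr _)) fc h2v rmorph0 add0r big_seq.
rewrite big1 ?rmorph0// => j js.
by rewrite (funZ (fr _)) fc low// rmorph0 scaler0.
Qed.
End OrthogonalProjection.

(** * Weak Hopf algebras from a pairing *)

Section TensorLemmas.
Variables (K : fieldType) (A B : lmodType K).

Lemma tens_lift_sum (V : lmodType K) (g : A -> B -> V) I (s : seq I) (P : pred I)
    (E : I -> tens A B) : is_bilinear g ->
  tens_lift g (\sum_(k <- s | P k) E k) = \sum_(k <- s | P k) tens_lift g (E k).
Proof. by move=> gb; apply: fun_sum; apply: tens_lift_linear. Qed.

Lemma tens_lift_sum2 (V : lmodType K) (g : A -> B -> V) n (c : 'I_n -> 'I_n -> K)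
    (x : 'I_n -> A) (y : 'I_n -> B) : is_bilinear g ->
  tens_lift g (\sum_p \sum_q c p q *: (x p \ox y q)) =
  \sum_p \sum_q c p q *: g (x p) (y q).
Proof.
move=> gb; rewrite tens_lift_sum//; apply: eq_bigr => p _.
rewrite tens_lift_sum//; apply: eq_bigr => q _.
by rewrite tens_liftZ// tens_liftE.
Qed.
End TensorLemmas.

Section TensorMapsLinear.
Variable K : fieldType.

Lemma tens_pair_bilinear (A B A' B' : lmodType K) (g : A -> A') (h : B -> B') :
  linear g -> linear h -> is_bilinear (fun a b => g a \ox h b).
Proof.
move=> gl hl; split=> [b k a a'|a k b b'].
  by rewrite gl (pure_tens_bilinear _ _).1.
by rewrite hl (pure_tens_bilinear _ _).2.
Qed.

Lemma tens_assoc_linear (A B C : lmodType K) : linear (@tens_assoc K A B C).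
Proof.
have b1 a : is_bilinear (fun (b : B) (c : C) => ((a : A) \ox b) \ox c).
  by split=> [c k u v|b k u v]; rewrite ?(pure_tens_bilinear _ _).2 ?(pure_tens_bilinear _ _).1.
apply: tens_lift_linear; split=> [t k a a'|a]; last exact: tens_lift_linear (b1 a).
elim/tens_ind: t => [|t u ht hu|b c].
- by rewrite !(tens_lift0 (b1 _)) scaler0 addr0.
- by rewrite !(tens_liftD _ _ (b1 _)) ht hu scalerDr addrACA.
- by rewrite !(tens_liftE _ _ (b1 _)) !(pure_tens_bilinear _ _).1.
Qed.
End TensorMapsLinear.

Section HopfPairing.
Variables (R : realType).
Notation K := R[i].

(** Conditions on a pairing for its transposed products to be weak Hopf coproducts. In
    Sweedler notation a_(1) (x) a_(2) is the sum of the f a (y_p y_q) x_p (x) x_q, and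
    TA, TB are the inverse antipodes. [hp_mul] is multiplicativity of the coproduct.
    [hp_epsA] says that the functional f (. c) 1 is given by an element d of B whose
    left and right multiplications are transposed to right multiplications of A; it
    contains the axioms of the counit of A, and [hp_epsB], its transpose, those of
    Delta(1). [hp_l], [hp_r] and [hp_lr] are the images under TA of the three
    antipode axioms. *)
Record hopf_pairing (A B : cstarAlgType R) (f : A -> B -> K) (n : nat)
    (x : 'I_n -> A) (y : 'I_n -> B) (TA : A -> A) (TB : B -> B) : Prop := HopfPairing {
  hp_bil : is_bilinear (f : A -> B -> K^o);
  hp_x : forall a, a = \sum_k f a (y k) *: x k;
  hp_y : forall b, b = \sum_k f (x k) b *: y k;
  hp_mul : forall a a' b b', f (a ** a') (b ** b') =
    \sum_p \sum_q \sum_r \sum_s f a (y p ** y q) * f a' (y r ** y s) *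
       (f (x p ** x r) b * f (x q ** x s) b');
  hp_epsA : forall c, exists d c1 c2,
    [/\ forall a, f (a ** c) (aone B) = f a d,
        forall a b, f (a ** c1) b = f a (b ** d) &
        forall a b, f (a ** c2) b = f a (d ** b)];
  hp_epsB : forall d, exists c d1 d2,
    [/\ forall b, f (aone A) (b ** d) = f c b,
        forall a b, f a (b ** d1) = f (a ** c) b &
        forall a b, f a (b ** d2) = f (c ** a) b];
  hp_T : forall a b, f (TA a) b = f a (TB b);
  hp_TA : forall a a', TA (a ** a') = TA a' ** TA a;
  hp_TB : forall b b', TB (b ** b') = TB b' ** TB b;
  hp_star : forall a b, (f a b)^* = f (adj a) (TB (adj b));
  hp_TB_adj : forall b, TB (adj (TB b)) = adj b;
  hp_l : forall a b, \sum_p \sum_q f a (y p ** y q) * f (TA (x q) ** x p) b =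
    \sum_p f (aone A) (TB b ** y p) * f (a ** x p) (aone B);
  hp_r : forall a b, \sum_p \sum_q f a (y p ** y q) * f (x q ** TA (x p)) b =
    \sum_p f (aone A) (y p ** TB b) * f (x p ** a) (aone B);
  hp_lr : forall a b, \sum_p \sum_q \sum_r f a (y p ** y q ** y r) *
    f (x r ** TA (x q) ** x p) b = f a b
}.

Section Structure.
Variables (A B : cstarAlgType R) (f : A -> B -> K) (n : nat).
Variables (x : 'I_n -> A) (y : 'I_n -> B) (TA : A -> A) (TB : B -> B).
Hypothesis hp : hopf_pairing f x y TA TB.
Let fb := hp_bil hp.
Let fs (I : Type) (s : seq I) (P : pred I) (E : I -> A) b :
  f (\sum_(k <- s | P k) E k) b = \sum_(k <- s | P k) f (E k) b.
Proof. exact: (bil_suml fb). Qed.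
Let fZ k a b : f (k *: a) b = k * f a b.
Proof. exact: (bilZl fb). Qed.
Let fZr k a b : f a (k *: b) = k * f a b.
Proof. exact: (bilZr fb). Qed.

Lemma hp_sumx (g : A -> K) a : linear (g : A -> K^o) ->
  \sum_k f a (y k) * g (x k) = g a.
Proof.
move=> gl; rewrite [in RHS](hp_x hp a) (fun_sum gl); apply: eq_bigr => k _.
by rewrite (funZ gl).
Qed.

Lemma hp_sumy (g : B -> K) b : linear (g : B -> K^o) ->
  \sum_k f (x k) b * g (y k) = g b.
Proof.
move=> gl; rewrite [in RHS](hp_y hp b) (fun_sum gl); apply: eq_bigr => k _.
by rewrite (funZ gl).
Qed.

Lemma hp_inj a a' : (forall b, f a b = f a' b) -> a = a'.
Proof.
by move=> h; rewrite (hp_x hp a) (hp_x hp a'); apply: eq_bigr => k _; rewrite h.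
Qed.

(** The functionals f(. b) f(. b') and f(. b) f(. b') f(. b'') separate tensors, so that
    identities between tensors can be tested in the pairing. *)
Definition f2 (b b' : B) (t : tens A A) : K :=
  tens_lift (fun a a' => f a b * f a' b' : K^o) t.

Definition f3 (b b' b'' : B) (t : tens (tens A A) A) : K :=
  tens_lift (fun s a => f2 b b' s * f a b'' : K^o) t.

Lemma mul_bil (V W : lmodType K) (g : V -> K) (h : W -> K) :
  linear (g : V -> K^o) -> linear (h : W -> K^o) ->
  is_bilinear (fun a a' => g a * h a' : K^o).
Proof.
move=> gl hl; split=> [a' k a1 a2|a k a1 a2] /=.
  by rewrite gl -[RHS]/(_ * _ + _) mulrDl -mulrA.
by rewrite hl -[RHS]/(_ * _ + _) mulrDr mulrCA.
Qed.

Lemma fl_l b : linear (f^~ b : A -> K^o). Proof. exact: fb.1. Qed.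
Lemma f2_bil b b' : is_bilinear (fun a a' => f a b * f a' b' : K^o).
Proof. exact: (mul_bil (fl_l b) (fl_l b')). Qed.

Lemma f2_lin b b' : linear (f2 b b' : tens A A -> K^o).
Proof. exact: (tens_lift_linear (f2_bil b b')). Qed.

Lemma f3_bil b b' b'' : is_bilinear (fun s a => f2 b b' s * f a b'' : K^o).
Proof. exact: (mul_bil (f2_lin b b') (fl_l b'')). Qed.

Lemma f3_lin b b' b'' : linear (f3 b b' b'' : tens (tens A A) A -> K^o).
Proof. exact: (tens_lift_linear (f3_bil b b' b'')). Qed.

Lemma f2E b b' a a' : f2 b b' (a \ox a') = f a b * f a' b'.
Proof. exact: (tens_liftE _ _ (f2_bil b b')). Qed.

Lemma f3E b b' b'' s a : f3 b b' b'' (s \ox a) = f2 b b' s * f a b''.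
Proof. exact: (tens_liftE _ _ (f3_bil b b' b'')). Qed.

Lemma f2_expand t : t = \sum_p \sum_q f2 (y p) (y q) t *: (x p \ox x q).
Proof.
have pt := pure_tens_bilinear A A.
elim/tens_ind: t => [|s t hs ht|a a'].
- by rewrite big1// => p _; rewrite big1// => q _; rewrite (fun0 (f2_lin _ _)) scale0r.
- rewrite {1}hs {1}ht -big_split; apply: eq_bigr => p _; rewrite -big_split.
  by apply: eq_bigr => q _; rewrite (funD (f2_lin _ _)) scalerDl.
rewrite {1}(hp_x hp a) (bil_suml pt); apply: eq_bigr => p _.
rewrite {1}(hp_x hp a') (bil_sumr pt); apply: eq_bigr => q _.
by rewrite (bilZl pt) (bilZr pt) scalerA f2E.
Qed.

Lemma f2_inj s t : (forall b b', f2 b b' s = f2 b b' t) -> s = t.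
Proof.
move=> h; rewrite (f2_expand s) (f2_expand t).
by apply: eq_bigr => p _; apply: eq_bigr => q _; rewrite h.
Qed.

Lemma f3_expand t : t = \sum_r (\sum_p \sum_q f3 (y p) (y q) (y r) t *: (x p \ox x q)) \ox x r.
Proof.
have pt := pure_tens_bilinear (tens A A) A.
elim/tens_ind: t => [|s t hs ht|s a].
- rewrite big1// => r _; rewrite big1 ?(bil0l pt)// => p _; rewrite big1// => q _.
  by rewrite (fun0 (f3_lin _ _ _)) scale0r.
- rewrite {1}hs {1}ht -big_split; apply: eq_bigr => r _ /=; rewrite -(bilDl pt) -big_split.
  congr (_ \ox _); apply: eq_bigr => p _; rewrite -big_split; apply: eq_bigr => q _.
  by rewrite (funD (f3_lin _ _ _)) scalerDl.
rewrite {1}(hp_x hp a) (bil_sumr pt); apply: eq_bigr => r _.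
rewrite (bilZr pt) -(bilZl pt); congr (_ \ox _).
rewrite {1}(f2_expand s) scaler_sumr; apply: eq_bigr => p _; rewrite scaler_sumr.
by apply: eq_bigr => q _; rewrite f3E scalerA mulrC.
Qed.

Lemma f3_inj s t : (forall b b' b'', f3 b b' b'' s = f3 b b' b'' t) -> s = t.
Proof.
move=> h; rewrite (f3_expand s) (f3_expand t); apply: eq_bigr => r _.
by congr (_ \ox _); apply: eq_bigr => p _; apply: eq_bigr => q _; rewrite h.
Qed.

Definition coproduct (a : A) : tens A A := \sum_p \sum_q f a (y p ** y q) *: (x p \ox x q).

Lemma coproduct_lin : linear coproduct.
Proof.
move=> k a a'; rewrite /coproduct scaler_sumr -big_split; apply: eq_bigr => p _.
rewrite scaler_sumr -big_split; apply: eq_bigr => q _.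
by rewrite fb.1 scalerDl scalerA.
Qed.

Lemma lift_coproduct (V : lmodType K) (g : A -> A -> V) a : is_bilinear g ->
  tens_lift g (coproduct a) = \sum_p \sum_q f a (y p ** y q) *: g (x p) (x q).
Proof. exact: tens_lift_sum2. Qed.

Lemma f2_coproduct a b b' : f2 b b' (coproduct a) = f a (b ** b').
Proof.
rewrite /f2 (lift_coproduct _ (f2_bil b b')).
transitivity (\sum_p f (x p) b * f a (y p ** b')).
  apply: eq_bigr => p _.
  rewrite -(@hp_sumy (fun c => f a (y p ** c)) b').
    by rewrite mulr_sumr; apply: eq_bigr => q _; rewrite -[_ *: _]/(_ * _) mulrC mulrA.
  by move=> k c c'; rewrite amulDr amulZr fb.2.
rewrite (@hp_sumy (fun c => f a (c ** b')))//.
by move=> k c c'; rewrite amulDl amulZl fb.2.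
Qed.

Lemma eps_lin : linear (fun a => f a (aone B) : K^o).
Proof. exact: fb.1. Qed.

Let pt3 := pure_tens_bilinear (tens A A) A.

Lemma f3_sum b b' b'' (I : Type) (s : seq I) (P : pred I) (E : I -> tens (tens A A) A) :
  f3 b b' b'' (\sum_(k <- s | P k) E k) = \sum_(k <- s | P k) f3 b b' b'' (E k).
Proof. exact: (fun_sum (f3_lin b b' b'')). Qed.

Lemma f2_sum b b' (I : Type) (s : seq I) (P : pred I) (E : I -> tens A A) :
  f2 b b' (\sum_(k <- s | P k) E k) = \sum_(k <- s | P k) f2 b b' (E k).
Proof. exact: (fun_sum (f2_lin b b')). Qed.

Lemma f2Z b b' k t : f2 b b' (k *: t) = k * f2 b b' t.
Proof. exact: (funZ (f2_lin b b')). Qed.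

Lemma f3Z b b' b'' k t : f3 b b' b'' (k *: t) = k * f3 b b' b'' t.
Proof. exact: (funZ (f3_lin b b' b'')). Qed.

Lemma f3_assoc b b' b'' a t :
  f3 b b' b'' (tens_assoc (a \ox t)) = f a b * f2 b' b'' t.
Proof.
rewrite {1}(f2_expand t) {2}(f2_expand t) (bil_sumr (pure_tens_bilinear _ _)).
rewrite (fun_sum (@tens_assoc_linear _ _ _ _)) f3_sum f2_sum mulr_sumr; apply: eq_bigr => p _.
rewrite (bil_sumr (pure_tens_bilinear _ _)).
rewrite (fun_sum (@tens_assoc_linear _ _ _ _)) f3_sum f2_sum mulr_sumr; apply: eq_bigr => q _.
rewrite (bilZr (pure_tens_bilinear _ _)) (funZ (@tens_assoc_linear _ _ _ _)) tens_assocE f3Z f2Z.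
by rewrite f3E !f2E; ring.
Qed.

Lemma coproduct2 b b' a : \sum_p \sum_q f a (y p ** y q) * (f (x p) b * f (x q) b')
  = f a (b ** b').
Proof. by rewrite -f2_coproduct /f2 (lift_coproduct _ (f2_bil b b')). Qed.

Lemma f3_coproduct_l a b b' b'' :
  f3 b b' b'' (tens_map coproduct idfun (coproduct a)) = f a (b ** b' ** b'').
Proof.
rewrite /tens_map lift_coproduct; last exact: (tens_pair_bilinear coproduct_lin).
rewrite f3_sum -coproduct2; apply: eq_bigr => p _.
rewrite f3_sum; apply: eq_bigr => q _.
by rewrite f3Z f3E f2_coproduct.
Qed.

Lemma f3_coproduct_r a b b' b'' :
  f3 b b' b'' (tens_assoc (tens_map idfun coproduct (coproduct a))) = f a (b ** b' ** b'').
Proof.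
rewrite /tens_map lift_coproduct; last exact: (tens_pair_bilinear _ coproduct_lin).
rewrite (fun_sum (@tens_assoc_linear _ _ _ _)) f3_sum -amulA -coproduct2; apply: eq_bigr => p _.
rewrite (fun_sum (@tens_assoc_linear _ _ _ _)) f3_sum; apply: eq_bigr => q _.
by rewrite (funZ (@tens_assoc_linear _ _ _ _)) f3Z f3_assoc f2_coproduct.
Qed.

Lemma coproductM a a' : coproduct (a ** a') = coproduct a ** coproduct a'.
Proof.
apply: f2_inj => b b'; rewrite f2_coproduct (hp_mul hp) amul_suml f2_sum.
apply: eq_bigr => p _; rewrite amul_suml f2_sum; apply: eq_bigr => q _.
rewrite amul_sumr f2_sum; apply: eq_bigr => r _.
rewrite amul_sumr f2_sum; apply: eq_bigr => s _.
rewrite amulZl amulZr !f2Z -[(x p \ox _) ** _]/(tens_mul _ _) tens_mulE f2E.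
by rewrite !mulrA.
Qed.

Local Notation eps a := (f a (aone B)).
Local Notation oneA := (aone A).

Lemma eps_mul_bil a c : is_bilinear (fun u v => eps (a ** u) * eps (v ** c) : K^o).
Proof.
apply: mul_bil => k u v; first by rewrite amulDr amulZr fb.1.
by rewrite amulDl amulZl fb.1.
Qed.

Lemma counit_l a : tens_lift (fun u v => eps u *: v) (coproduct a) = a.
Proof.
rewrite lift_coproduct; last first.
  by split=> [v k u u'|u k v v']; rewrite ?fb.1 ?scalerDl ?scalerDr ?scalerA// mulrC.
apply: hp_inj => b; rewrite fs -[b in RHS]amul1l -coproduct2; apply: eq_bigr => p _.
by rewrite fs; apply: eq_bigr => q _; rewrite !fZ.
Qed.

Lemma counit_r a : tens_lift (fun u v => eps v *: u) (coproduct a) = a.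
Proof.
rewrite lift_coproduct; last first.
  by split=> [v k u u'|u k v v']; rewrite ?fb.1 ?scalerDl ?scalerDr ?scalerA// mulrC.
apply: hp_inj => b; rewrite fs -[b in RHS]amul1r -coproduct2; apply: eq_bigr => p _.
by rewrite fs; apply: eq_bigr => q _; rewrite !fZ [eps _ * _]mulrC.
Qed.

Lemma eps_mul12 a b c :
  tens_lift (fun u v => eps (a ** u) * eps (v ** c) : K^o) (coproduct b) = eps (a ** b ** c).
Proof.
rewrite lift_coproduct; last exact: eps_mul_bil.
have [d [c1 [_ [hd h1 _]]]] := hp_epsA hp c.
rewrite hd -[d in RHS]amul1l -h1 -[X in _ = f X _]amulA.
rewrite -(@hp_sumx (fun u => f (a ** u) (aone B))); last first.
  by move=> k u v; rewrite amulDr amulZr fb.1.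
apply: eq_bigr => p _; rewrite h1 -(@hp_sumy (fun u => f b (y p ** u)) d); last first.
  by move=> k u v; rewrite amulDr amulZr fb.2.
rewrite mulr_suml; apply: eq_bigr => q _; rewrite hd -[_ *: _]/(_ * _); ring.
Qed.

Lemma eps_mul21 a b c :
  tens_lift (fun u v => eps (a ** v) * eps (u ** c) : K^o) (coproduct b) = eps (a ** b ** c).
Proof.
rewrite lift_coproduct; last first.
  have [h1 h2] := eps_mul_bil a c.
  by split=> [v k u u'|v k u u'] /=; [rewrite h2 | rewrite h1].
have [d [_ [c2 [hd _ h2]]]] := hp_epsA hp c.
rewrite hd -[d in RHS]amul1r -h2 -[X in _ = f X _]amulA.
rewrite -(@hp_sumx (fun u => f (a ** u) (aone B))); last first.
  by move=> k u v; rewrite amulDr amulZr fb.1.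
rewrite exchange_big; apply: eq_bigr => q _ /=.
rewrite h2 -(@hp_sumy (fun u => f b (u ** y q)) d); last first.
  by move=> k u v; rewrite amulDl amulZl fb.2.
rewrite mulr_suml; apply: eq_bigr => p _; rewrite hd -[_ *: _]/(_ * _); ring.
Qed.

(** The two outer legs of Delta(1) (x) 1 and 1 (x) Delta(1) are contracted with b and b''. *)
Lemma contract_outer (g : 'I_n -> 'I_n -> K) b b'' :
  \sum_p \sum_q \sum_r \sum_s f oneA (y p ** y q) * f oneA (y r ** y s) *
    (f (x p) b * g q r * f (x s) b'')
  = \sum_q \sum_r f oneA (b ** y q) * (f oneA (y r ** b'') * g q r).
Proof.
rewrite exchange_big; apply: eq_bigr => q _ /=.
rewrite -(@hp_sumy (fun c => f oneA (c ** y q)) b); last first.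
  by move=> k u v; rewrite amulDl amulZl fb.2.
rewrite -mulr_sumr mulr_suml; apply: eq_bigr => p _; rewrite mulr_sumr; apply: eq_bigr => r _.
rewrite -(@hp_sumy (fun c => f oneA (y r ** c)) b''); last first.
  by move=> k u v; rewrite amulDr amulZr fb.2.
rewrite mulr_suml mulr_sumr; apply: eq_bigr => s _; ring.
Qed.

(** The two orders of the product of Delta(1) (x) 1 and 1 (x) Delta(1) differ only in the
    product of the middle legs. *)
Lemma coproduct1_sum (op : bool) b b' b'' :
  let s := coproduct oneA \ox oneA in
  let t := tens_assoc (oneA \ox coproduct oneA) in
  f3 b b' b'' (if op then t ** s else s ** t) =
  \sum_q \sum_r f oneA (b ** y q) * (f oneA (y r ** b'') *
    f (if op then x r ** x q else x q ** x r) b').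
Proof.
rewrite /= -contract_outer.
have al := @tens_assoc_linear K A A A.
have ptA := pure_tens_bilinear A (tens A A).
have mE u v w z : (if op then ((oneA \ox w) \ox z) ** ((u \ox v) \ox oneA)
    else ((u \ox v) \ox oneA) ** ((oneA \ox w) \ox z))
    = (u \ox (if op then w ** v else v ** w)) \ox z.
  case: op; rewrite -[LHS]/(tens_mul _ _) tens_mulE -[X in X \ox _]/(tens_mul _ _);
    by rewrite tens_mulE ?amul1r ?amul1l.
pose mul (s t : tens (tens A A) A) := if op then t ** s else s ** t.
have ml (E : 'I_n -> tens (tens A A) A) t : mul (\sum_k E k) t = \sum_k mul (E k) t.
  by rewrite /mul; case: (op); rewrite ?amul_suml ?amul_sumr.
have mr (E : 'I_n -> tens (tens A A) A) t : mul t (\sum_k E k) = \sum_k mul t (E k).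
  by rewrite /mul; case: (op); rewrite ?amul_suml ?amul_sumr.
have mlZ k s t : mul (k *: s) t = k *: mul s t.
  by rewrite /mul; case: (op); rewrite ?amulZl ?amulZr.
have mrZ k s t : mul t (k *: s) = k *: mul t s.
  by rewrite /mul; case: (op); rewrite ?amulZl ?amulZr.
rewrite -/(mul _ _) (bil_suml pt3) ml f3_sum; apply: eq_bigr => p _.
rewrite (bil_suml pt3) ml f3_sum; apply: eq_bigr => q _.
rewrite (bil_sumr ptA) (fun_sum al) mr f3_sum; apply: eq_bigr => r _.
rewrite (bil_sumr ptA) (fun_sum al) mr f3_sum; apply: eq_bigr => s _.
rewrite (bilZl pt3) (bilZr ptA) (funZ al) mlZ mrZ tens_assocE /mul mE.
by rewrite !f3Z f3E f2E !mulrA.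
Qed.

Lemma coproduct1_l :
  (coproduct oneA \ox oneA) ** tens_assoc (oneA \ox coproduct oneA)
  = tens_map coproduct idfun (coproduct oneA).
Proof.
apply: f3_inj => b b' b''; rewrite f3_coproduct_l (coproduct1_sum false).
have [c [d1 [_ [hc h1 _]]]] := hp_epsB hp b''.
rewrite hc -[c]amul1l -h1 -amulA.
rewrite -(@hp_sumy (fun z => f oneA (b ** z))); last first.
  by move=> k u v; rewrite amulDr amulZr fb.2.
apply: eq_bigr => q _; rewrite h1 -mulr_sumr mulrC; congr (_ * _).
rewrite -(@hp_sumx (fun z => f (x q ** z) b') c); last first.
  by move=> k u v; rewrite amulDr amulZr fb.1.
by apply: eq_bigr => r _; rewrite hc.
Qed.

Lemma coproduct1_r :
  tens_assoc (oneA \ox coproduct oneA) ** (coproduct oneA \ox oneA)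
  = tens_map coproduct idfun (coproduct oneA).
Proof.
apply: f3_inj => b b' b''; rewrite f3_coproduct_l (coproduct1_sum true).
have [c [_ [d2 [hc _ h2]]]] := hp_epsB hp b''.
rewrite hc -[c]amul1r -h2 -amulA.
rewrite -(@hp_sumy (fun z => f oneA (b ** z))); last first.
  by move=> k u v; rewrite amulDr amulZr fb.2.
apply: eq_bigr => q _; rewrite h2 -mulr_sumr mulrC; congr (_ * _).
rewrite -(@hp_sumx (fun z => f (z ** x q) b') c); last first.
  by move=> k u v; rewrite amulDl amulZl fb.1.
by apply: eq_bigr => r _; rewrite hc.
Qed.

(** The inverse of the antihomomorphism TA: the involution conjugates it to its inverse. *)
Definition antipode_of (a : A) : A := adj (TA (adj a)).

Lemma TA_lin : linear TA.
Proof.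
move=> k a a'; apply: hp_inj => b.
by rewrite fb.1 !(hp_T hp) fb.1.
Qed.

Lemma f_star a b : f (adj a) b = (f a (TB (adj b)))^*.
Proof. by rewrite (hp_star hp) (hp_TB_adj hp) adjK. Qed.

Lemma TA_adj a : TA (adj (TA a)) = adj a.
Proof.
apply: hp_inj => b; rewrite (hp_T hp) f_star (hp_T hp) -{1}[b]adjK.
by rewrite (hp_TB_adj hp) adjK f_star.
Qed.

Lemma antipode_ofK a : TA (antipode_of a) = a.
Proof. by rewrite /antipode_of TA_adj adjK. Qed.

Lemma antipode_of_TA : cancel TA antipode_of.
Proof. by move=> a; rewrite /antipode_of TA_adj adjK. Qed.

Lemma TA_inj : injective TA.
Proof. exact: can_inj antipode_of_TA. Qed.

Lemma antipode_of_lin : linear antipode_of.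
Proof. by move=> k a a'; apply: TA_inj; rewrite TA_lin !antipode_ofK. Qed.

(** Applying TA turns the antipode axioms into the clauses [hp_r], [hp_l], [hp_lr]. *)
Lemma antipode_axiom_r a : tens_lift (fun u v => u ** antipode_of v) (coproduct a)
  = tens_lift (fun u v => eps (u ** a) *: v) (coproduct oneA).
Proof.
have bm := @amul_bilinear K A.
rewrite !lift_coproduct; first last.
- by split=> [v k u u'|u k v v']; rewrite ?antipode_of_lin ?bm.1 ?bm.2.
- split=> [v k u u'|u k v v']; last by rewrite scalerDr !scalerA mulrC.
  by rewrite amulDl amulZl fb.1 scalerDl -scalerA.
apply: TA_inj; apply: hp_inj => b; rewrite !(fun_sum TA_lin) !fs.
transitivity (\sum_p \sum_q f a (y p ** y q) * f (x q ** TA (x p)) b).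
  apply: eq_bigr => p _; rewrite (fun_sum TA_lin) fs; apply: eq_bigr => q _.
  by rewrite (funZ TA_lin) fZ (hp_TA hp) antipode_ofK.
rewrite (hp_r hp); apply: eq_bigr => p _; rewrite (fun_sum TA_lin) fs.
rewrite -(@hp_sumy (fun z => f oneA (y p ** z)) (TB b)); last first.
  by move=> k u v; rewrite amulDr amulZr fb.2.
rewrite mulr_suml; apply: eq_bigr => q _.
by rewrite !(funZ TA_lin) !fZ (hp_T hp); ring.
Qed.

Lemma antipode_axiom_l a : tens_lift (fun u v => antipode_of u ** v) (coproduct a)
  = tens_lift (fun u v => eps (a ** v) *: u) (coproduct oneA).
Proof.
have bm := @amul_bilinear K A.
rewrite !lift_coproduct; first last.
- by split=> [v k u u'|u k v v']; rewrite ?antipode_of_lin ?bm.1 ?bm.2.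
- split=> [v k u u'|u k v v']; first by rewrite scalerDr !scalerA mulrC.
  by rewrite amulDr amulZr fb.1 scalerDl -scalerA.
apply: TA_inj; apply: hp_inj => b; rewrite !(fun_sum TA_lin) !fs.
transitivity (\sum_p \sum_q f a (y p ** y q) * f (TA (x q) ** x p) b).
  apply: eq_bigr => p _; rewrite (fun_sum TA_lin) fs; apply: eq_bigr => q _.
  by rewrite (funZ TA_lin) fZ (hp_TA hp) antipode_ofK.
rewrite (hp_l hp) [RHS](eq_bigr (fun p => \sum_q f oneA (y p ** y q) *
    (f (a ** x q) (aone B) * f (x p) (TB b)))); last first.
  move=> p _; rewrite (fun_sum TA_lin) fs; apply: eq_bigr => q _.
  by rewrite !(funZ TA_lin) !fZ (hp_T hp).
rewrite exchange_big; apply: eq_bigr => q _ /=.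
rewrite -(@hp_sumy (fun z => f oneA (z ** y q)) (TB b)); last first.
  by move=> k u v; rewrite amulDl amulZl fb.2.
rewrite mulr_suml; apply: eq_bigr => p _; ring.
Qed.

Lemma antipode_axiom_lr a :
  tens_lift (fun t z => tens_lift (fun u v => antipode_of u ** v ** antipode_of z) t)
    (tens_map coproduct idfun (coproduct a)) = antipode_of a.
Proof.
have bm := @amul_bilinear K A.
have b1 z : is_bilinear (fun u v => antipode_of u ** v ** antipode_of z).
  by split=> [v k u u'|u k v v']; rewrite ?antipode_of_lin ?bm.1 ?bm.2 ?bm.1.
have b2 : is_bilinear (fun t z => tens_lift (fun u v => antipode_of u ** v ** antipode_of z) t).
  split=> [z|t k z z']; first exact: tens_lift_linear (b1 z).
  elim/tens_ind: t => [|t t' ht ht'|u v].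
  - by rewrite !(tens_lift0 (b1 _)) scaler0 addr0.
  - by rewrite !(tens_liftD _ _ (b1 _)) ht ht' scalerDr addrACA.
  - by rewrite !(tens_liftE _ _ (b1 _)) antipode_of_lin bm.2.
rewrite /tens_map lift_coproduct; last exact: (tens_pair_bilinear coproduct_lin).
apply: TA_inj; apply: hp_inj => b; rewrite antipode_ofK -[RHS](hp_lr hp).
rewrite (tens_lift_sum _ _ _ b2) (fun_sum TA_lin) fs.
transitivity (\sum_s \sum_r \sum_p \sum_q f a (y s ** y r) * f (x s) (y p ** y q) *
    f (x r ** TA (x q) ** x p) b).
  apply: eq_bigr => s _; rewrite (tens_lift_sum _ _ _ b2) (fun_sum TA_lin) fs.
  apply: eq_bigr => r _; rewrite (tens_liftZ _ _ b2) (tens_liftE _ _ b2).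
  rewrite (lift_coproduct _ (b1 _)) (funZ TA_lin) fZ (fun_sum TA_lin) fs mulr_sumr.
  apply: eq_bigr => p _; rewrite (fun_sum TA_lin) fs mulr_sumr; apply: eq_bigr => q _.
  by rewrite (funZ TA_lin) fZ !(hp_TA hp) !antipode_ofK amulA !mulrA.
under [RHS]eq_bigr => p _ do rewrite exchange_big.
rewrite exchange_big [RHS]exchange_big; apply: eq_bigr => r _ /=.
rewrite exchange_big; apply: eq_bigr => p _ /=; rewrite exchange_big; apply: eq_bigr => q _ /=.
rewrite -mulr_suml; congr (_ * _).
rewrite -(@hp_sumy (fun z => f a (z ** y r)) (y p ** y q)); last first.
  by move=> k u v; rewrite amulDl amulZl fb.2.
by apply: eq_bigr => s _; rewrite mulrC.
Qed.

Lemma coproduct_adj a : coproduct (adj a) = tens_adj (coproduct a).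
Proof.
apply: f2_inj => b b'; rewrite f2_coproduct f_star (adjM b b') (hp_TB hp) -coproduct2.
have tl k s t : tens_adj (k *: s + t) = k^* *: tens_adj s + tens_adj t :> tens A A.
  exact: tens_adj_antilinear.
have tD (s t : tens A A) : tens_adj (s + t) = tens_adj s + tens_adj t.
  by have := tl 1 s t; rewrite !scale1r rmorph1 scale1r.
have t0 : tens_adj (0 : tens A A) = 0 by apply: (addrI (tens_adj 0)); rewrite -tD !addr0.
have ts (E : 'I_n -> tens A A) : tens_adj (\sum_k E k) = \sum_k tens_adj (E k).
  by elim/big_rec2: _ => [|k u v _ <-].
rewrite rmorph_sum /coproduct ts f2_sum; apply: eq_bigr => p _.
rewrite rmorph_sum ts f2_sum; apply: eq_bigr => q _.
rewrite -[_ *: _]addr0 tl t0 addr0 tens_adjE f2Z f2E !rmorphM /=.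
by rewrite -!f_star.
Qed.

Lemma hopf_pairing_fin : finite_dimensional A.
Proof. by apply: (@fd_span_ord _ _ _ x) => a; exists (fun k => f a (y k)); exact: (hp_x hp). Qed.

Let Dl : {linear A -> tens A A} :=
  HB.pack_for {linear A -> tens A A} coproduct
    (GRing.isLinear.Build K A (tens A A) *:%R coproduct coproduct_lin).
Let El : {scalar A} :=
  HB.pack_for {scalar A} (fun a => eps a)
    (GRing.isLinear.Build K A K^o *:%R (fun a => eps a) eps_lin).
Let Sl : {linear A -> A} :=
  HB.pack_for {linear A -> A} antipode_of
    (GRing.isLinear.Build K A A *:%R antipode_of antipode_of_lin).

Lemma coproductA a :
  tens_map coproduct idfun (coproduct a) = tens_assoc (tens_map idfun coproduct (coproduct a)).
Proof. by apply: f3_inj => b b' b''; rewrite f3_coproduct_l f3_coproduct_r. Qed.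

Definition hopf_of_pairing : cstar_weak_hopf A :=
  @CstarWeakHopf R A (@WeakHopf K A (@WeakBialgebra K A Dl El coproductA counit_l counit_r
    coproductM eps_mul12 eps_mul21 coproduct1_l coproduct1_r)
    Sl antipode_axiom_r antipode_axiom_l antipode_axiom_lr)
  hopf_pairing_fin coproduct_adj.

End Structure.
End HopfPairing.

(** * Transposing the pairing *)

Section Duality.
Variables (R : realType).
Notation K := R[i].
Variables (A B : cstarAlgType R) (f : A -> B -> K) (n : nat).
Variables (x : 'I_n -> A) (y : 'I_n -> B) (TA : A -> A) (TB : B -> B).
Hypothesis hp : hopf_pairing f x y TA TB.
Let fb := hp_bil hp.

Lemma antipode_adjoint a b : f (antipode_of TA a) b = f a (antipode_of TB b).
Proof.
have e : TB (antipode_of TB b) = b by rewrite /antipode_of (hp_TB_adj hp) adjK.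
by rewrite -{1}e -(hp_T hp) (antipode_ofK hp).
Qed.

Lemma TB_one : TB (aone B) = aone B.
Proof.
have e b : TB (antipode_of TB b) = b by rewrite /antipode_of (hp_TB_adj hp) adjK.
rewrite -[LHS]amul1l -{1}[aone B]e -(hp_TB hp) amul1l e.
by [].
Qed.

Lemma TA_one : TA (aone A) = aone A.
Proof.
by rewrite -[LHS]amul1l -{1}[aone A](antipode_ofK hp) -(hp_TA hp) amul1l (antipode_ofK hp).
Qed.

Lemma pair_mul_l a a' b : f (a ** a') b =
  \sum_p \sum_q f a (y p) * f a' (y q) * f (x p ** x q) b.
Proof.
rewrite -(hp_sumx hp (g := fun z => f (z ** a') b)); last first.
  by move=> k u v; rewrite amulDl amulZl fb.1.
apply: eq_bigr => p _; rewrite -(hp_sumx hp (g := fun z => f (x p ** z) b) a'); last first.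
  by move=> k u v; rewrite amulDr amulZr fb.1.
by rewrite mulr_sumr; apply: eq_bigr => q _; rewrite mulrA.
Qed.

(** The tensor x_p (x) y_p is invariant under the antipodes of the two sides. *)
Lemma hp_transfer (g : A -> K) (h : B -> K) : linear (g : A -> K^o) -> linear (h : B -> K^o) ->
  \sum_p g (antipode_of TA (x p)) * h (y p) = \sum_p g (x p) * h (antipode_of TB (y p)).
Proof.
move=> gl hl.
transitivity (\sum_p \sum_q f (x p) (antipode_of TB (y q)) * g (x q) * h (y p)).
  apply: eq_bigr => p _; rewrite -(hp_sumx hp _ gl) mulr_suml; apply: eq_bigr => q _.
  by rewrite antipode_adjoint.
rewrite exchange_big; apply: eq_bigr => q _ /=.
rewrite -(hp_sumy hp _ hl) mulr_sumr; apply: eq_bigr => p _; ring.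
Qed.

Lemma swap4 (E : 'I_n -> 'I_n -> 'I_n -> 'I_n -> K) :
  \sum_p \sum_q \sum_r \sum_s E p q r s = \sum_r \sum_s \sum_p \sum_q E p q r s.
Proof.
transitivity (\sum_p \sum_r \sum_s \sum_q E p q r s).
  apply: eq_bigr => p _; rewrite exchange_big; apply: eq_bigr => r _ /=.
  by rewrite exchange_big.
by rewrite exchange_big; apply: eq_bigr => r _ /=; rewrite exchange_big.
Qed.

(** The left hand side pairs a with the product of the legs of the coproduct of b, the
    right hand side pairs b with that of a; both are expanded over four indices. *)
Lemma transpose_sum (g : A -> A) (h : B -> B) a b : (forall a b, f a (h b) = f (g a) b) ->
  \sum_p \sum_q f (x p ** x q) b * f a (h (y q) ** y p) =
  \sum_p \sum_q f a (y p ** y q) * f (x q ** g (x p)) b.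
Proof.
move=> gh.
transitivity (\sum_p \sum_q \sum_r \sum_s
    f a (y r ** y s) * (f (g (x r)) (y q) * f (x s) (y p) * f (x p ** x q) b)).
  apply: eq_bigr => p _; apply: eq_bigr => q _; rewrite -(coproduct2 hp) mulr_sumr.
  apply: eq_bigr => r _; rewrite mulr_sumr; apply: eq_bigr => s _; rewrite gh; ring.
rewrite swap4; apply: eq_bigr => r _; apply: eq_bigr => s _; rewrite pair_mul_l mulr_sumr.
apply: eq_bigr => p _; rewrite mulr_sumr; apply: eq_bigr => q _; ring.
Qed.

Lemma transpose_sum' (g : A -> A) (h : B -> B) a b : (forall a b, f a (h b) = f (g a) b) ->
  \sum_p \sum_q f (x p ** x q) b * f a (y q ** h (y p)) =
  \sum_p \sum_q f a (y p ** y q) * f (g (x q) ** x p) b.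
Proof.
move=> gh.
transitivity (\sum_p \sum_q \sum_r \sum_s
    f a (y r ** y s) * (f (g (x s)) (y p) * f (x r) (y q) * f (x p ** x q) b)).
  apply: eq_bigr => p _; apply: eq_bigr => q _; rewrite -(coproduct2 hp) mulr_sumr.
  apply: eq_bigr => r _; rewrite mulr_sumr; apply: eq_bigr => s _; rewrite gh; ring.
rewrite swap4; apply: eq_bigr => r _; apply: eq_bigr => s _; rewrite pair_mul_l mulr_sumr.
apply: eq_bigr => p _; rewrite mulr_sumr; apply: eq_bigr => q _; ring.
Qed.

Lemma eps_TA a : f (TA a) (aone B) = f a (aone B).
Proof. by rewrite (hp_T hp) TB_one. Qed.

Lemma eps_TB b : f (aone A) (TB b) = f (aone A) b.
Proof. by rewrite -(hp_T hp) TA_one. Qed.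

Lemma TB_antipode b : TB (antipode_of TB b) = b.
Proof. by rewrite /antipode_of (hp_TB_adj hp) adjK. Qed.

Lemma pair_mul3_l a a' a'' b : f (a ** a' ** a'') b =
  \sum_p \sum_q \sum_r f a (y p) * f a' (y q) * f a'' (y r) * f (x p ** x q ** x r) b.
Proof.
rewrite -(hp_sumx hp (g := fun z => f (z ** a' ** a'') b)); last first.
  by move=> k u v; rewrite !amulDl !amulZl fb.1.
apply: eq_bigr => p _; rewrite -(hp_sumx hp (g := fun z => f (x p ** z ** a'') b) a'); last first.
  by move=> k u v; rewrite amulDr amulZr amulDl amulZl fb.1.
rewrite mulr_sumr; apply: eq_bigr => q _.
rewrite -(hp_sumx hp (g := fun z => f (x p ** x q ** z) b) a''); last first.
  by move=> k u v; rewrite amulDr amulZr fb.1.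
by rewrite !mulr_sumr; apply: eq_bigr => r _; rewrite !mulrA.
Qed.

Lemma pair_mul3_r a b b' b'' : f a (b ** b' ** b'') =
  \sum_p \sum_q \sum_r f a (y p ** y q ** y r) * (f (x p) b * f (x q) b' * f (x r) b'').
Proof.
rewrite -(hp_sumy hp (g := fun z => f a (z ** b' ** b''))); last first.
  by move=> k u v; rewrite !amulDl !amulZl fb.2.
apply: eq_bigr => p _; rewrite -(hp_sumy hp (g := fun z => f a (y p ** z ** b'')) b'); last first.
  by move=> k u v; rewrite amulDr amulZr amulDl amulZl fb.2.
rewrite mulr_sumr; apply: eq_bigr => q _.
rewrite -(hp_sumy hp (g := fun z => f a (y p ** y q ** z)) b''); last first.
  by move=> k u v; rewrite amulDr amulZr fb.2.
by rewrite !mulr_sumr; apply: eq_bigr => r _; rewrite !mulrA mulrC !mulrA.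
Qed.

Lemma move_out (E : 'I_n -> 'I_n -> 'I_n -> 'I_n -> K) :
  \sum_p \sum_q \sum_r \sum_s E p q r s = \sum_s \sum_p \sum_q \sum_r E p q r s.
Proof.
rewrite [RHS]exchange_big; apply: eq_bigr => p _; rewrite [RHS]exchange_big.
by apply: eq_bigr => q _; rewrite [RHS]exchange_big.
Qed.

(** Every clause of [hopf_pairing] is, up to the others, its own transpose. *)
Lemma hopf_pairing_sym : hopf_pairing (fun b a => f a b) y x TB TA.
Proof.
have gT a b : f a (TB b) = f (TA a) b by rewrite (hp_T hp).
split.
- by split; [exact: fb.2 | exact: fb.1].
- exact: (hp_y hp).
- exact: (hp_x hp).
- move=> b b' a a'; rewrite (hp_mul hp); apply: eq_bigr => p _; rewrite exchange_big.
  apply: eq_bigr => q _; apply: eq_bigr => r _; apply: eq_bigr => s _; ring.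
- move=> d; have [c [d1 [d2 [h h1 h2]]]] := hp_epsB hp d.
  by exists c, d1, d2.
- move=> c; have [d [c1 [c2 [h h1 h2]]]] := hp_epsA hp c.
  by exists d, c1, c2.
- by move=> b a; rewrite gT.
- exact: (hp_TB hp).
- exact: (hp_TA hp).
- by move=> b a; rewrite (hp_star hp) gT.
- exact: (TA_adj hp).
- move=> b a; rewrite (transpose_sum _ _ gT) (hp_r hp).
  transitivity (\sum_p f (antipode_of TA (x p) ** a) (aone B) * f (aone A) (b ** y p)).
    rewrite (hp_transfer (g := fun z => f (z ** a) (aone B)) (h := fun z => f (aone A) (b ** z))).
    + by apply: eq_bigr => p _; rewrite -[f _ (b ** _)]eps_TB (hp_TB hp) TB_antipode mulrC.
    + by move=> k u v; rewrite amulDl amulZl fb.1.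
    + by move=> k u v; rewrite amulDr amulZr fb.2.
  by apply: eq_bigr => p _; rewrite -[f (_ ** a) _]eps_TA (hp_TA hp) (antipode_ofK hp).
- move=> b a; rewrite (transpose_sum' _ _ gT) (hp_l hp).
  transitivity (\sum_p f (a ** antipode_of TA (x p)) (aone B) * f (aone A) (y p ** b)).
    rewrite (hp_transfer (g := fun z => f (a ** z) (aone B)) (h := fun z => f (aone A) (z ** b))).
    + by apply: eq_bigr => p _; rewrite -[f _ (_ ** b)]eps_TB (hp_TB hp) TB_antipode mulrC.
    + by move=> k u v; rewrite amulDr amulZr fb.1.
    + by move=> k u v; rewrite amulDl amulZl fb.2.
  by apply: eq_bigr => p _; rewrite -[f (a ** _) _]eps_TA (hp_TA hp) (antipode_ofK hp).
- move=> b a; rewrite -[RHS](hp_lr hp).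
  transitivity (\sum_p \sum_q \sum_r \sum_s \sum_t \sum_u
      f a (y s ** y t ** y u) *
      (f (x u) (y p) * f (TA (x t)) (y q) * f (x s) (y r) * f (x p ** x q ** x r) b)).
    apply: eq_bigr => p _; apply: eq_bigr => q _; apply: eq_bigr => r _.
    rewrite pair_mul3_r mulr_sumr; apply: eq_bigr => s _; rewrite mulr_sumr.
    apply: eq_bigr => t _; rewrite mulr_sumr; apply: eq_bigr => u _; rewrite gT; ring.
  rewrite move_out; apply: eq_bigr => s _; rewrite move_out; apply: eq_bigr => t _.
  rewrite move_out; apply: eq_bigr => u _; rewrite pair_mul3_l mulr_sumr.
  apply: eq_bigr => p _; rewrite mulr_sumr; apply: eq_bigr => q _; rewrite mulr_sumr.
  by [].
Qed.

Lemma hopf_pairing_duality :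
  in_duality (hopf_of_pairing hp) (hopf_of_pairing hopf_pairing_sym) f.
Proof.
split=> /=.
- by move=> a b b'; exact: (f2_coproduct hp).
- by [].
- by move=> a a' b; exact: (f2_coproduct hopf_pairing_sym).
- by [].
- exact: antipode_adjoint.
- move=> a b; rewrite (f_star hp) conjCK.
  by rewrite -(hp_T hp) (antipode_ofK hp).
Qed.
End Duality.

(** * Two algebras exchanged by quarter turns *)

Section PairedAlgebras.
Variables (R : realType) (A B L : cstarAlgType R).
Notation K := R[i].

(** What the depth two inclusion leaves behind once 2-cells are forgotten. F is the
    quarter turn A -> B with inverse G, and rot the half turn of B, so that G rot F is
    the half turn of A. L acts on one leg of A and B by iA and i, and by their half
    turns on the other leg; F (1) and G (1) are a cap followed by a cup, and psi
    is the closure of B. [pa_act] closes on the right the composite of a and b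
    shifted by one strand, and [pa_mate] closes it further, to an element of L.
    The elements b_k, a_k of [pa_quasi] form the basis provided by depth two: they
    expand B over its turned leg and compute F on products. By [pa_tau_index]
    the functional psi (i (dl dl l) F(1)) on L has dual bases of index one. *)
Record paired_algebras := PairedAlgebras {
  pa_psi : B -> K;
  pa_rot : B -> B;
  pa_F : A -> B;
  pa_G : B -> A;
  pa_i : L -> B;
  pa_iA : L -> A;
  pa_act : A -> B -> B;
  pa_mate : A -> B -> L;
  pa_dl : L;
  pa_dl' : L;
  pa_psi_lin : linear (pa_psi : B -> K^o);
  pa_psiC : forall b b', pa_psi (b ** b') = pa_psi (b' ** b);
  pa_psi_adj : forall b, pa_psi (adj b) = (pa_psi b)^*;
  pa_psi_nondeg : forall b, (forall b', pa_psi (b ** b') = 0) -> b = 0;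
  pa_rot_lin : linear pa_rot;
  pa_rotM : forall b b', pa_rot (b ** b') = pa_rot b' ** pa_rot b;
  pa_rotK : involutive pa_rot;
  pa_rot_adj : forall b, pa_rot (adj b) = adj (pa_rot b);
  pa_psi_rot : forall b, pa_psi (pa_rot b) = pa_psi b;
  pa_F_lin : linear pa_F;
  pa_FK : cancel pa_F pa_G;
  pa_GK : cancel pa_G pa_F;
  pa_F_iAl : forall l a, pa_F (pa_iA l ** a) = pa_i l ** pa_F a;
  pa_F_iAr : forall a l, pa_F (a ** pa_iA l) = pa_rot (pa_i l) ** pa_F a;
  pa_F_adj : forall a, pa_F (adj a) = pa_rot (adj (pa_F a));
  pa_rotAM : forall a a', pa_G (pa_rot (pa_F (a ** a'))) =
    pa_G (pa_rot (pa_F a')) ** pa_G (pa_rot (pa_F a));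
  pa_i_lin : linear pa_i;
  pa_iM : forall l l', pa_i (l ** l') = pa_i l ** pa_i l';
  pa_i1 : pa_i (aone L) = aone B;
  pa_i_adj : forall l, pa_i (adj l) = adj (pa_i l);
  pa_iA_lin : linear pa_iA;
  pa_iAM : forall l l', pa_iA (l ** l') = pa_iA l ** pa_iA l';
  pa_iA1 : pa_iA (aone L) = aone A;
  pa_cap : forall b, exists l, b ** pa_F (aone A) = pa_i l ** pa_F (aone A);
  pa_cup : forall a, exists l, a ** pa_G (aone B) = pa_iA l ** pa_G (aone B);
  pa_psi_act : forall a a' b,
    pa_psi (pa_F a' ** pa_rot (pa_act a b)) = pa_psi (pa_F (a' ** a) ** pa_rot b);
  pa_act_cap : forall a, pa_act a (pa_F (aone A)) = pa_F a;
  pa_tau_mate : forall l a b,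
    pa_psi (pa_i (l ** pa_mate a b) ** pa_F (aone A)) = pa_psi (pa_F a ** pa_i l ** pa_rot b);
  pa_quasi : exists (n : nat) (ak : 'I_n -> A) (bk : 'I_n -> B),
    (forall b, b = \sum_k bk k ** pa_rot (pa_i (pa_mate (ak k) b))) /\
    (forall a a' b, pa_F (a' ** a) ** b =
       \sum_k pa_F (pa_G (pa_F a' ** bk k) ** pa_G (pa_F a ** pa_act (ak k) b)));
  pa_dl_central : forall l, pa_dl ** l = l ** pa_dl;
  pa_dl_adj : adj pa_dl = pa_dl;
  pa_dlV : pa_dl ** pa_dl' = aone L;
  pa_tau_index : exists (m : nat) (nx ny : 'I_m -> L),
    (forall l, l = \sum_q pa_psi (pa_i (pa_dl ** pa_dl ** ny q ** l) ** pa_F (aone A)) *: nx q) /\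
    \sum_q ny q ** nx q = aone L
}.
End PairedAlgebras.

Section Pairing.
Variables (R : realType) (A B L : cstarAlgType R) (D : paired_algebras A B L).
Notation K := R[i].
Local Notation psi := (pa_psi D).
Local Notation rot := (pa_rot D).
Local Notation F := (pa_F D).
Local Notation G := (pa_G D).
Local Notation i := (pa_i D).
Local Notation iA := (pa_iA D).
Local Notation act := (pa_act D).
Local Notation mate := (pa_mate D).
Local Notation dl := (pa_dl D).
Local Notation dl' := (pa_dl' D).
Local Notation j l := (rot (i l)).
Local Notation rotA a := (G (rot (F a))).
Local Notation jA l := (rotA (iA l)).
Local Notation e := (F (aone A)).
Local Notation E := (G (aone B)).

Lemma pa_rot1 : rot (aone B) = aone B.
Proof.
have := pa_rotM D (rot (aone B)) (aone B).
by rewrite amul1r !pa_rotK amul1r.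
Qed.

Lemma pa_rotAK a : rotA (rotA a) = a.
Proof. by rewrite pa_GK pa_rotK pa_FK. Qed.

Lemma pa_rotA1 : rotA (aone A) = aone A.
Proof.
have := pa_rotAM D (rotA (aone A)) (aone A).
by rewrite amul1r pa_rotAK amul1r.
Qed.

Lemma rot_cap : rot e = e.
Proof. by rewrite -{2}pa_rotA1 pa_GK. Qed.

Lemma pa_F_jAl l a : F (jA l ** a) = F a ** i l.
Proof. by rewrite -{1}[a]pa_rotAK -pa_rotAM pa_GK pa_F_iAr pa_rotM pa_GK !pa_rotK. Qed.

Lemma pa_F_jAr l a : F (a ** jA l) = F a ** j l.
Proof. by rewrite -{1}[a]pa_rotAK -pa_rotAM pa_GK pa_F_iAl pa_rotM pa_GK !pa_rotK. Qed.

Lemma pa_G_lin : linear G.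
Proof. by move=> k b b'; apply: (can_inj (pa_FK D)); rewrite pa_GK pa_F_lin !pa_GK. Qed.

Lemma turned_legM l l' : j (l ** l') = j l' ** j l.
Proof. by rewrite pa_iM pa_rotM. Qed.

Lemma turned_leg1 : j (aone L) = aone B.
Proof. by rewrite pa_i1 pa_rot1. Qed.

Lemma turned_leg_adj l : j (adj l) = adj (j l).
Proof. by rewrite pa_i_adj pa_rot_adj. Qed.

Lemma turned_legA1 : jA (aone L) = aone A.
Proof. by rewrite pa_iA1 pa_rotA1. Qed.

Lemma turned_legAM l l' : jA (l ** l') = jA l' ** jA l.
Proof. by rewrite pa_iAM pa_rotAM. Qed.

(** Both products are F (iA(l) G(1) iA(l')). *)
Lemma legsC l l' : i l ** j l' = j l' ** i l.
Proof.
have := pa_F_iAl D l (E ** iA l'); rewrite amulA pa_F_iAr pa_F_iAl pa_F_iAr pa_GK !amul1r.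
by [].
Qed.

(** A leg moves across the cap, because F (1 iA(l)) and F (iA(l) 1) are the same. *)
Lemma legs_cap l : j l ** e = i l ** e.
Proof. by rewrite -pa_F_iAr amul1l -{1}[iA l]amul1r pa_F_iAl. Qed.

Lemma dl'V : dl' ** dl = aone L.
Proof. by rewrite -(pa_dl_central D) pa_dlV. Qed.

Lemma dl'_central l : dl' ** l = l ** dl'.
Proof.
by rewrite -[l in LHS]amul1r -(pa_dlV D) [_ ** (_ ** dl')]amulA -(pa_dl_central D) !amulA
  dl'V amul1l.
Qed.

Lemma i_dlV x : i dl ** (i dl' ** x) = x.
Proof. by rewrite amulA -pa_iM pa_dlV pa_i1 amul1l. Qed.

Lemma i_dl'V x : i dl' ** (i dl ** x) = x.
Proof. by rewrite amulA -pa_iM dl'V pa_i1 amul1l. Qed.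

Lemma j_dlV x : j dl ** (j dl' ** x) = x.
Proof. by rewrite amulA -turned_legM dl'V turned_leg1 amul1l. Qed.

Lemma j_dl'V x : j dl' ** (j dl ** x) = x.
Proof. by rewrite amulA -turned_legM pa_dlV turned_leg1 amul1l. Qed.

Lemma i_dlV1 : i dl ** i dl' = aone B.
Proof. by rewrite -pa_iM pa_dlV pa_i1. Qed.

Lemma i_dl'V1 : i dl' ** i dl = aone B.
Proof. by rewrite -pa_iM dl'V pa_i1. Qed.

Lemma j_dlV1 : j dl ** j dl' = aone B.
Proof. by rewrite -turned_legM dl'V turned_leg1. Qed.

Lemma j_dl'V1 : j dl' ** j dl = aone B.
Proof. by rewrite -turned_legM pa_dlV turned_leg1. Qed.

Lemma legsCA l l' x : i l ** (j l' ** x) = j l' ** (i l ** x).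
Proof. by rewrite amulA legsC amulA. Qed.

Lemma dl'_adj : adj dl' = dl'.
Proof.
rewrite -[LHS]amul1r -(pa_dlV D) amulA -{1}(pa_dl_adj D) -adjM.
by rewrite pa_dlV adj1 amul1l.
Qed.

(** Words bracketed to the right: letters from the turned leg go first, and delta
    cancels against its inverse. *)
Definition legs := (legsCA, legsC, (i_dlV, i_dl'V, j_dlV, j_dl'V),
  (i_dlV1, i_dl'V1, j_dlV1, j_dl'V1),
  (@amul1l K B), (@amul1r K B)).

Lemma i_dl'_comm l : i dl' ** i l = i l ** i dl'.
Proof. by rewrite -!pa_iM dl'_central. Qed.

Lemma j_dl_comm l : j dl ** j l = j l ** j dl.
Proof. by rewrite -!turned_legM pa_dl_central. Qed.

Lemma j_dl'_comm l : j dl' ** j l = j l ** j dl'.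
Proof. by rewrite -!turned_legM dl'_central. Qed.

(** [pa_psi_act] after a half turn of everything. *)
Lemma psi_act_pure a z b : psi (F z ** act a b) = psi (F (rotA a ** z) ** b).
Proof.
have := pa_psi_act D a (rotA z) b; rewrite pa_GK -pa_rotM pa_psi_rot pa_psiC => ->.
have -> : F (rotA z ** a) = rot (F (rotA a ** z)).
  by rewrite -{2}[z]pa_rotAK -pa_rotAM pa_GK pa_rotK.
by rewrite -pa_rotM pa_psi_rot pa_psiC.
Qed.

(** The factors delta compensate for psi not being the trace of index one on L: they
    make [half_turn_mates], hence the multiplicativity of the coproduct, true. *)
Definition pairing (a : A) (b : B) : K := psi (F a ** i dl ** b ** j dl).

Lemma pairing_bilinear : is_bilinear (pairing : A -> B -> K^o).
Proof.
split=> [b k a a'|a k b b']; rewrite /pairing.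
  by rewrite pa_F_lin !amulDl !amulZl (pa_psi_lin D).
by rewrite amulDr amulZr !amulDl !amulZl (pa_psi_lin D).
Qed.

Lemma psi_eq (x y : B) : (forall a, psi (F a ** x) = psi (F a ** y)) -> x = y.
Proof.
move=> h; apply/eqP; rewrite -subr_eq0; apply/eqP; apply: (@pa_psi_nondeg _ _ _ _ D) => b.
have := h (G b); rewrite pa_GK => hb.
by rewrite pa_psiC amulBr (funB (pa_psi_lin D)) hb subrr.
Qed.

Lemma pairing_inj_r b b' : (forall a, pairing a b = pairing a b') -> b = b'.
Proof.
move=> h; suff : i dl ** b ** j dl = i dl ** b' ** j dl.
  move=> /(congr1 (fun x => i dl' ** x ** j dl')).
  by rewrite -!amulA j_dlV1 !amul1r !i_dl'V.
by apply: psi_eq => a; have := h a; rewrite /pairing -!amulA.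
Qed.

Lemma pairing_inj_l a a' : (forall b, pairing a b = pairing a' b) -> a = a'.
Proof.
move=> h; suff : F a ** i dl = F a' ** i dl.
  move=> /(congr1 (fun x => G (x ** i dl'))).
  by rewrite -!amulA i_dlV1 !amul1r !pa_FK.
apply/eqP; rewrite -subr_eq0; apply/eqP; apply: (@pa_psi_nondeg _ _ _ _ D) => b.
have := h (b ** j dl'); rewrite /pairing -!amulA j_dl'V1 amul1r => hb.
by rewrite amulBl (funB (pa_psi_lin D)) -!amulA hb subrr.
Qed.

(** The half turn, followed by conjugation with an element of the legs whose square
    implements the square of the inverse antipode. *)
Definition inv_antipodeB (b : B) : B := j dl ** i dl' ** rot b ** j dl' ** i dl.
Definition inv_antipodeA (a : A) : A := iA dl ** jA dl' ** rotA a ** iA dl' ** jA dl.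
Local Notation TA := inv_antipodeA.
Local Notation TB := inv_antipodeB.

Lemma F_TA a : F (TA a) = i dl ** j dl' ** rot (F a) ** j dl ** i dl'.
Proof.
rewrite /inv_antipodeA pa_F_jAr pa_F_iAr -!amulA pa_F_iAl pa_F_jAl pa_GK.
by rewrite !legs -!amulA !legs.
Qed.

Lemma turned_legK l : rot (j l) = i l.
Proof. exact: pa_rotK. Qed.

Lemma pairing_TB a b : pairing a (TB b) = psi (F a ** j dl ** rot b ** i dl).
Proof.
by rewrite /pairing /inv_antipodeB -!amulA !legs.
Qed.

Lemma pairing_TA a b : pairing (TA a) b = psi (F a ** j dl ** rot b ** i dl).
Proof.
transitivity (psi (rot (F a) ** (j dl ** (b ** i dl)))).
  rewrite /pairing F_TA -!amulA !legs pa_psiC -!amulA !legs.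
  by rewrite pa_psiC -!amulA.
by rewrite -[RHS](pa_psi_rot D) !pa_rotM pa_rotK turned_legK !amulA [RHS]pa_psiC !amulA.
Qed.

Lemma pairing_T a b : pairing (TA a) b = pairing a (TB b).
Proof. by rewrite pairing_TA pairing_TB. Qed.

Lemma TB_M b b' : TB (b ** b') = TB b' ** TB b.
Proof. by rewrite /inv_antipodeB pa_rotM -!amulA !legs. Qed.

Lemma TA_M a a' : TA (a ** a') = TA a' ** TA a.
Proof.
have iA_dlV x : iA dl ** (iA dl' ** x) = x by rewrite amulA -pa_iAM pa_dlV pa_iA1 amul1l.
have iA_dl'V x : iA dl' ** (iA dl ** x) = x by rewrite amulA -pa_iAM dl'V pa_iA1 amul1l.
have jA_dlV x : jA dl ** (jA dl' ** x) = x by rewrite amulA -turned_legAM dl'V turned_legA1 amul1l.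
have ijA l l' x : jA l ** (iA l' ** x) = iA l' ** (jA l ** x).
  by apply: (can_inj (pa_FK D)); rewrite pa_F_jAl !pa_F_iAl pa_F_jAl amulA.
by rewrite /inv_antipodeA pa_rotAM -!amulA ijA iA_dl'V jA_dlV.
Qed.

(** The conjugate of the inverse antipode by the involution is the antipode. *)
Lemma TB_adj b : TB (adj (TB b)) = adj b.
Proof.
rewrite /inv_antipodeB !adjM -pa_rot_adj -!turned_leg_adj -!pa_i_adj pa_dl_adj dl'_adj.
rewrite !pa_rotM !turned_legK.
by rewrite -pa_rot_adj pa_rotK -!amulA !legs.
Qed.

Lemma pairing_conj a b : (pairing a b)^* = pairing (adj a) (TB (adj b)).
Proof.
rewrite pairing_TB /pairing -pa_psi_adj !adjM -turned_leg_adj -pa_i_adj pa_dl_adj.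
rewrite -(pa_psi_rot D) !pa_rotM pa_F_adj turned_legK.
by rewrite -!amulA.
Qed.

Lemma pa_G_ir b l : G (b ** i l) = jA l ** G b.
Proof. by apply: (can_inj (pa_FK D)); rewrite pa_F_jAl !pa_GK. Qed.

Lemma pa_G_jr b l : G (b ** j l) = G b ** jA l.
Proof. by apply: (can_inj (pa_FK D)); rewrite pa_F_jAr !pa_GK. Qed.

Lemma pairing_iAl l a b : pairing (iA l ** a) b = pairing a (b ** i l).
Proof.
by rewrite /pairing pa_F_iAl -!amulA pa_psiC -!amulA -(legsC l).
Qed.

Lemma pairing_iAr l a b : pairing (a ** iA l) b = pairing a (b ** j l).
Proof.
by rewrite /pairing pa_F_iAr -!amulA pa_psiC -!amulA j_dl_comm.
Qed.

Lemma pairing_jAr l a b : pairing (a ** jA l) b = pairing a (j l ** b).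
Proof. by rewrite /pairing pa_F_jAr -!amulA (amulA (j l)) -legsC -!amulA. Qed.

Section DualBases.
Variables (n : nat) (x : 'I_n -> A) (y : 'I_n -> B).
Hypothesis xE : forall a, a = \sum_k pairing a (y k) *: x k.
Hypothesis yE : forall b, b = \sum_k pairing (x k) b *: y k.
Let pb := pairing_bilinear.

Lemma dual_sum_l (V : lmodType K) (g : A -> V) a : linear g ->
  \sum_k pairing a (y k) *: g (x k) = g a.
Proof.
by move=> gl; rewrite [in RHS](xE a) (fun_sum gl); apply: eq_bigr => k _; rewrite (funZ gl).
Qed.

Lemma dual_sum_r (V : lmodType K) (g : B -> V) b : linear g ->
  \sum_k pairing (x k) b *: g (y k) = g b.
Proof.
by move=> gl; rewrite [in RHS](yE b) (fun_sum gl); apply: eq_bigr => k _; rewrite (funZ gl).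
Qed.

(** The mate is determined by its trace against L, which is psi of a product with the
    half turn of a; summing over the dual bases of the pairing, then over those of L,
    leaves the sum of the n^q n_q, which is 1. *)
Lemma half_turn_mates a :
  \sum_p x p ** iA (dl' ** mate a (i dl ** y p)) = rotA a.
Proof.
have [m [nx [ny [nE n1]]]] := pa_tau_index D.
pose g q := G (j dl' ** j (dl ** dl ** ny q) ** rot (F a)).
have gE q b : psi (F a ** i (dl ** dl ** ny q) ** rot (i dl ** b)) = pairing (g q) b.
  rewrite -(pa_psi_rot D) !pa_rotM !pa_rotK /pairing /g pa_GK -(amulA (j dl')).
  move: (j (_ ** _) ** rot (F a)) => X.
  by rewrite [RHS]pa_psiC -!amulA !legs pa_psiC -!amulA pa_psiC -!amulA.
have mE p : mate a (i dl ** y p) = \sum_q pairing (g q) (y p) *: nx q.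
  rewrite {1}[mate _ _]nE; apply: eq_bigr => q _; congr (_ *: _).
  by rewrite pa_tau_mate gE.
apply: (can_inj (pa_FK D)); rewrite pa_GK (fun_sum (pa_F_lin D)).
transitivity (\sum_q j (dl' ** nx q) ** F (g q)).
  transitivity (\sum_p \sum_q pairing (g q) (y p) *: (j (dl' ** nx q) ** F (x p))).
    apply: eq_bigr => p _; rewrite pa_F_iAr mE amul_sumr (fun_sum (pa_i_lin D)).
    rewrite (fun_sum (pa_rot_lin D)) amul_suml; apply: eq_bigr => q _.
    by rewrite amulZr (funZ (pa_i_lin D)) (funZ (pa_rot_lin D)) amulZl.
  rewrite exchange_big /=; apply: eq_bigr => q _.
  apply: (dual_sum_l (g := fun a' => j (dl' ** nx q) ** F a')) => k c c'.
  by rewrite pa_F_lin amulDr amulZr.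
transitivity (\sum_q j (ny q ** nx q) ** rot (F a)).
  apply: eq_bigr => q _; rewrite pa_GK -!amulA amulA -turned_legM amulA -turned_legM.
  congr (rot (i _) ** _); rewrite -!amulA.
  have dK z : dl ** (dl' ** z) = z by rewrite amulA pa_dlV amul1l.
  have dC z : ny q ** (dl' ** z) = dl' ** (ny q ** z) by rewrite !amulA dl'_central.
  by rewrite !dC !dK.
rewrite -amul_suml -(fun_sum (pa_rot_lin D)) -(fun_sum (pa_i_lin D)) n1.
by rewrite turned_leg1 amul1l.
Qed.

(** The coefficients are those of the coproduct of b. Paired with F z, both sides reduce
    to psi (F (rotA a z) i(delta) b), the right one by [half_turn_mates]. *)
Lemma act_expand a b : act a (i dl ** b) =
  \sum_p \sum_q pairing (x p ** x q) b *:
    (i dl ** y q ** i dl' ** i (mate a (i dl ** y p))).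
Proof.
apply: psi_eq => z; rewrite psi_act_pure -half_turn_mates.
rewrite amul_suml (fun_sum (pa_F_lin D)) amul_suml (fun_sum (pa_psi_lin D)).
rewrite amul_sumr (fun_sum (pa_psi_lin D)); apply: eq_bigr => p _.
set m := mate _ _; rewrite amul_sumr (fun_sum (pa_psi_lin D)).
pose zp := iA (dl' ** m) ** (z ** iA dl').
have zpE b' : psi (F z ** (i dl ** b' ** i dl' ** i m)) = pairing zp b'.
  rewrite /pairing /zp pa_F_iAl pa_F_iAr -(amulA _ (i dl')) -pa_iM [RHS]pa_psiC -!amulA.
  by rewrite -legsCA j_dlV [RHS]pa_psiC -!amulA.
transitivity (pairing (x p ** zp) b); last first.
  rewrite -(dual_sum_l (g := fun a' => pairing (x p ** a') b : K^o)); last first.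
    by move=> k c c'; rewrite amulDr amulZr pb.1.
  apply: eq_bigr => q _; rewrite amulZr (funZ (pa_psi_lin D)) zpE.
  by rewrite -[LHS]/(_ * _) -[RHS]/(_ * _) mulrC.
rewrite /pairing /zp !amulA -[F _ ** i dl ** b]amulA !pa_F_iAr -!amulA [RHS]pa_psiC.
by rewrite -!amulA j_dlV1 amul1r.
Qed.

(** The second formula of [pa_quasi] has b_k in one factor and a_k, through act, in the
    other. Expanding the latter by [act_expand] and moving the mates into the first
    factor, where they reassemble i(delta) y_p over the basis b_k, leaves the
    coproduct of b: right multiplication by b, through F, is multiplicative. *)
Lemma exchange a0 a b : F (a0 ** a) ** i dl ** b =
  \sum_p \sum_q pairing (x p ** x q) b *:
    (F (G (F a0 ** i dl ** y p ** i dl') ** G (F a ** i dl ** y q ** i dl')) ** i dl).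
Proof.
have [m [ak [bk [bE qE]]]] := pa_quasi D.
rewrite -amulA qE.
pose W q := F a ** i dl ** y q ** i dl'.
transitivity (\sum_k \sum_p \sum_q pairing (x p ** x q) b *:
    F (G (F a0 ** (bk k ** j (mate (ak k) (i dl ** y p)))) ** G (W q))).
  apply: eq_bigr => k _; rewrite act_expand.
  rewrite amul_sumr (fun_sum pa_G_lin) amul_sumr (fun_sum (pa_F_lin D)); apply: eq_bigr => p _.
  rewrite amul_sumr (fun_sum pa_G_lin) amul_sumr (fun_sum (pa_F_lin D)); apply: eq_bigr => q _.
  rewrite amulZr (funZ pa_G_lin) amulZr (funZ (pa_F_lin D)); congr (_ *: F _).
  by rewrite !amulA pa_G_ir pa_G_jr -/(W q) amulA.
rewrite exchange_big; apply: eq_bigr => p _; rewrite exchange_big; apply: eq_bigr => q _ /=.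
rewrite -scaler_sumr; congr (_ *: _); rewrite -/(W q) -pa_F_jAl amulA -pa_G_ir.
rewrite -!amulA i_dl'V1 amul1r [in RHS](bE (i dl ** y p)).
by rewrite amul_sumr (fun_sum pa_G_lin) amul_suml (fun_sum (pa_F_lin D)).
Qed.

(** The cap turns a product under F into a product of the factors. *)
Lemma psi_cap c a : psi (F (c ** a) ** e) = psi (F c ** rot (F a)).
Proof. by rewrite -(pa_act_cap D a) pa_psi_act rot_cap. Qed.

(** The exchange identity for a = G (1), with the cap closing the right hand side. *)
Lemma sum_half_turn b l : b ** i dl' ** e = i l ** e ->
  \sum_p \sum_q pairing (x p ** x q) b *: (y p ** i dl' ** j dl' ** rot (y q))
  = i l ** j dl'.
Proof.
move=> bl; set Z := LHS.
suff : i dl ** Z ** j dl = i (dl ** l).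
  move=> /(congr1 (fun z => i dl' ** z ** j dl')).
  by rewrite -!amulA j_dlV1 !amul1r i_dl'V => ->; rewrite !amulA -pa_iM amulA dl'V amul1l.
apply: psi_eq => a0; have := exchange a0 E b.
move=> /(congr1 (fun z => psi (z ** (i dl' ** e)))).
have -> : F (a0 ** E) ** i dl ** b ** (i dl' ** e) = F (jA (dl ** l) ** (a0 ** E)) ** e.
  by rewrite pa_F_jAl pa_iM -!amulA [b ** _]amulA bl.
rewrite amulA psi_cap pa_GK pa_rot1 amul1r pa_F_jAl => ->.
rewrite /Z amul_suml (fun_sum (pa_psi_lin D)) amul_sumr amul_suml amul_sumr.
rewrite (fun_sum (pa_psi_lin D)).
apply: eq_bigr => p _.
rewrite amul_suml (fun_sum (pa_psi_lin D)) amul_sumr amul_suml amul_sumr (fun_sum (pa_psi_lin D)).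
apply: eq_bigr => q _; rewrite amulZl amulZr amulZl amulZr !(funZ (pa_psi_lin D)).
congr (_ *: _); rewrite -(amulA _ (i dl) (i dl' ** _)) i_dlV psi_cap !pa_GK amul1l !pa_rotM.
by rewrite -!amulA.
Qed.

Lemma dual_transfer (V : lmodType K) (g : A -> B -> V) (al : A -> A) (be : B -> B) :
  is_bilinear g -> (forall a b, pairing (al a) b = pairing a (be b)) ->
  \sum_q g (al (x q)) (y q) = \sum_q g (x q) (be (y q)).
Proof.
move=> gb ab.
transitivity (\sum_q \sum_r pairing (x q) (be (y r)) *: g (x r) (y q)).
  apply: eq_bigr => q _; rewrite [in LHS](xE (al (x q))) (bil_suml gb).
  by apply: eq_bigr => r _; rewrite (bilZl gb) ab.
rewrite exchange_big; apply: eq_bigr => r _ /=.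
exact: (dual_sum_r _ (gb.2 (x r))).
Qed.

(** The element b_(2) S^-1(b_(1)) lies in the turned leg. The sum in [sum_half_turn],
    half turned, has delta^-1 where T wants delta, between the two legs of the
    coproduct; replacing b by b i(delta^2) puts delta^2 on the first leg, which the
    half turn brings to this place. *)
Lemma sum_antipode b l : b ** i dl ** e = i l ** e ->
  \sum_p \sum_q pairing (x q ** x p) b *: (y p ** TB (y q)) = j (l ** dl').
Proof.
move=> bl; pose b2 := b ** i (dl ** dl).
have := @sum_half_turn b2 l.
rewrite {1}/b2 pa_iM -!amulA i_dlV amulA => /(_ bl) /(congr1 rot).
rewrite pa_rotM turned_legK => h.
have {h} : \sum_p \sum_q pairing (x q ** x p) b *: (y p ** j dl ** i dl' ** rot (y q))
    = i dl' ** j l.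
  rewrite -h (fun_sum (pa_rot_lin D)); apply/esym.
  transitivity (\sum_q \sum_p pairing (iA (dl ** dl) ** x q ** x p) b *:
      (y p ** i dl' ** j dl' ** rot (y q))).
    apply: eq_bigr => q _; rewrite (fun_sum (pa_rot_lin D)); apply: eq_bigr => p _.
    rewrite (funZ (pa_rot_lin D)) /b2 -pairing_iAl amulA; congr (_ *: _).
    by rewrite !pa_rotM pa_rotK turned_legK -!amulA !legs.
  rewrite exchange_big; apply: eq_bigr => p _ /=.
  pose g a b' : B := pairing (a ** x p) b *: (y p ** i dl' ** j dl' ** rot b').
  transitivity (\sum_q g (x q) (y q ** i (dl ** dl))).
    have bg : is_bilinear g.
      split=> [b' k a a'|a k b' b'']; rewrite /g.
        by rewrite amulDl amulZl pb.1 scalerDl -scalerA.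
      by rewrite pa_rot_lin amulDr amulZr scalerDr !scalerA mulrC.
    exact: (@dual_transfer _ g (amul (iA (dl ** dl))) (fun b' => b' ** i (dl ** dl)) bg
      (pairing_iAl (dl ** dl))).
  apply: eq_bigr => q _; rewrite /g pa_rotM turned_legM -!amulA; congr (_ *: (_ ** _)).
  by rewrite -legsCA !j_dl'V legsCA.
move=> /(congr1 (fun z => z ** (j dl' ** i dl))); rewrite -!amulA => h.
transitivity (i dl' ** (j l ** (j dl' ** i dl))); last first.
  by rewrite -(legsC dl) -[j l ** _]legsCA !legs pa_iM pa_rotM j_dl'_comm.
rewrite -h amul_suml; apply: eq_bigr => p _; rewrite amul_suml; apply: eq_bigr => q _.
by rewrite amulZl /inv_antipodeB -!amulA.
Qed.
End DualBases.
End Pairing.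

(** * The pairing and the weak Hopf axioms *)

Section PairingIsHopf.
Variables (R : realType) (A B L : cstarAlgType R) (D : paired_algebras A B L).
Notation K := R[i].
Local Notation psi := (pa_psi D).
Local Notation rot := (pa_rot D).
Local Notation F := (pa_F D).
Local Notation G := (pa_G D).
Local Notation i := (pa_i D).
Local Notation iA := (pa_iA D).
Local Notation dl := (pa_dl D).
Local Notation dl' := (pa_dl' D).
Local Notation j l := (rot (i l)).
Local Notation rotA a := (G (rot (F a))).
Local Notation jA l := (rotA (iA l)).
Local Notation e := (F (aone A)).
Local Notation E := (G (aone B)).
Local Notation f := (pairing D).
Local Notation TA := (inv_antipodeA D).
Local Notation TB := (inv_antipodeB D).
Let fb := pairing_bilinear D.

Lemma cap_adj : adj e = e.
Proof. by have := pa_F_adj D (aone A); rewrite adj1 => /(congr1 rot); rewrite pa_rotK rot_cap. Qed.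

Lemma TA_adj_pairing a : TA (adj (TA a)) = adj a.
Proof.
have st c b : f (adj c) b = (f c (TB (adj b)))^* by rewrite pairing_conj TB_adj adjK.
apply: (pairing_inj_l (D := D)) => b; rewrite pairing_T st pairing_T -{1}[b]adjK.
by rewrite TB_adj adjK st.
Qed.

(** psi (F c) = psi (F (c G(1)) F(1)), and c G(1) only involves a leg. *)
Lemma pairing_eps_l c l : c ** iA dl ** E = iA l ** E ->
  forall a, f (a ** c) (aone B) = f a (j (l ** dl')).
Proof.
move=> cl a.
have psiF z : psi (F z) = psi (F (z ** E) ** e) by rewrite psi_cap pa_GK pa_rot1 amul1r.
transitivity (psi (F (jA dl ** (a ** c ** iA dl)))).
  by rewrite pa_F_jAl pa_F_iAr /pairing amul1r pa_psiC amulA.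
rewrite psiF -!amulA (amulA c) cl !amulA -psiF pa_F_iAr pa_F_jAl pa_psiC.
by rewrite /pairing turned_legM -!amulA -j_dl_comm j_dl'V.
Qed.

Lemma cap_leg l : j dl ** (i (l ** dl') ** e) = i l ** e.
Proof. by rewrite -legsCA legs_cap amulA -pa_iM -amulA dl'V amul1r. Qed.

Lemma pairing_eps_r d l : d ** i dl ** e = i l ** e ->
  forall b, f (aone A) (b ** d) = f (iA (l ** dl')) b.
Proof.
move=> dE b; transitivity (psi (i l ** e ** (i dl ** b))).
  have <- : d ** j dl ** e = i l ** e by rewrite -amulA legs_cap amulA dE.
  by rewrite -(amulA (d ** _)) [RHS]pa_psiC /pairing -!amulA.
rewrite /pairing -[iA _]amul1r pa_F_iAl [RHS]pa_psiC -!amulA.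
by rewrite [i (l ** dl') ** (e ** _)]amulA [j dl ** _]amulA cap_leg -!amulA.
Qed.

Lemma TB_cap b l : b ** i dl ** e = i l ** e ->
  forall c, f (aone A) (TB b ** c) = f (aone A) (j (l ** dl') ** c).
Proof.
move=> bE c.
have h : e ** (j dl ** rot b) = e ** j l.
  by rewrite -{1}(rot_cap D) -!pa_rotM bE pa_rotM rot_cap.
suff key : e ** i dl ** TB b = e ** i dl ** j (l ** dl').
  by rewrite /pairing (amulA _ (TB b)) (amulA _ (j _) c) key.
rewrite turned_legM j_dl'_comm /inv_antipodeB -!amulA !legs.
by rewrite (amulA (j dl)) amulA h -!amulA.
Qed.

Lemma TB_cap_adj b l : adj b ** i dl ** e = i l ** e ->
  forall c, f (aone A) (c ** TB b) = f (aone A) (c ** i (adj (l ** dl'))).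
Proof.
move=> bE c.
have h : rot b ** (j dl ** e) = j (adj l) ** e.
  have : e ** i dl ** b = e ** i (adj l).
    apply: (can_inj (@adjK _ _)); rewrite !adjM cap_adj -!pa_i_adj pa_dl_adj adjK amulA.
    exact: bE.
  by move=> /(congr1 rot); rewrite !pa_rotM rot_cap.
suff key : TB b ** j dl ** e = i (adj (l ** dl')) ** j dl ** e.
  have cyc z : f (aone A) (c ** z) = psi (z ** j dl ** e ** (i dl ** c)).
    by rewrite /pairing -(amulA (z ** _)) [RHS]pa_psiC -!amulA.
  by rewrite !cyc key.
rewrite adjM dl'_adj pa_iM /inv_antipodeB -!amulA !legs -(legs_cap D dl) h legs_cap.
by [].
Qed.

Let fs (I : Type) (s : seq I) (P : pred I) (X : I -> A) b :
  f (\sum_(k <- s | P k) X k) b = \sum_(k <- s | P k) f (X k) b.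
Proof. exact: (bil_suml fb). Qed.
Let fsr (I : Type) (s : seq I) (P : pred I) (X : I -> B) a :
  f a (\sum_(k <- s | P k) X k) = \sum_(k <- s | P k) f a (X k).
Proof. exact: (bil_sumr fb). Qed.
Let fZ k a b : f (k *: a) b = k * f a b.
Proof. exact: (bilZl fb). Qed.
Let fZr k a b : f a (k *: b) = k * f a b.
Proof. exact: (bilZr fb). Qed.

(** The pairing of T(a_(2)) a_(1) with b is that of a with b_(2) T(b_(1)). *)
Lemma TA_closed b l : b ** i dl ** e = i l ** e ->
  forall n (x : 'I_n -> A) (y : 'I_n -> B),
  (forall a, a = \sum_k f a (y k) *: x k) -> (forall b, b = \sum_k f (x k) b *: y k) ->
  forall a, \sum_p \sum_q f a (y p ** y q) * f (TA (x q) ** x p) b = f a (j (l ** dl')).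
Proof.
move=> bl n x y xE yE a; rewrite -(sum_antipode xE yE bl) fsr; apply: eq_bigr => p _.
pose g a' b' : K^o := f a (y p ** b') * f (a' ** x p) b.
have bg : is_bilinear g.
  split=> [b' k a1 a2|a' k b1 b2]; rewrite /g.
    by rewrite amulDl amulZl fb.1 -[RHS]/(_ * _ + _) -[_ *: _]/(_ * _); ring.
  by rewrite amulDr amulZr fb.2 -[RHS]/(_ * _ + _) -[_ *: _]/(_ * _); ring.
rewrite -/(\sum_q g (TA (x q)) (y q)) (dual_transfer xE yE bg (@pairing_T _ _ _ _ D)).
by rewrite fsr; apply: eq_bigr => q _; rewrite /g fZr mulrC.
Qed.

Section DualBases.
Variables (n : nat) (x : 'I_n -> A) (y : 'I_n -> B).
Hypothesis xE : forall a, a = \sum_k f a (y k) *: x k.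
Hypothesis yE : forall b, b = \sum_k f (x k) b *: y k.

Lemma sumx (g : A -> K) a : linear (g : A -> K^o) -> \sum_k f a (y k) * g (x k) = g a.
Proof. by move=> gl; rewrite -[RHS](dual_sum_l xE a gl). Qed.

Lemma sumy (g : B -> K) b : linear (g : B -> K^o) -> \sum_k f (x k) b * g (y k) = g b.
Proof. by move=> gl; rewrite -[RHS](dual_sum_r yE b gl). Qed.

Lemma lin_l (a1 a2 : A) b : linear (fun z => f (a1 ** z ** a2) b : K^o).
Proof. by move=> k u v; rewrite amulDr amulZr amulDl amulZl fb.1. Qed.

(** The adjoint of [TA_closed]: the bases TB (y^* ), x^* are again dual, and their
    adjoints give back the given ones. *)
Lemma closed_TA b l : adj b ** i dl ** e = i l ** e ->
  forall a, \sum_p \sum_q f a (y p ** y q) * f (x q ** TA (x p)) b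
  = f a (i (adj (l ** dl'))).
Proof.
move=> bl a.
have st c d : f (adj c) d = (f c (TB (adj d)))^* by rewrite pairing_conj TB_adj adjK.
have zE c : c = \sum_k f c (TB (adj (y k))) *: adj (x k).
  apply: (can_inj (@adjK _ _)); rewrite {1}[adj c]xE adj_sum; apply: eq_bigr => k _.
  by rewrite adjZ adjK st.
have wE d : d = \sum_k f (adj (x k)) d *: TB (adj (y k)).
  have TBl : linear TB.
    by move=> k u v; apply: (pairing_inj_r (D := D)) => c; rewrite fb.2 -!pairing_T fb.2.
  have := yE (TB (adj d)) => /(congr1 (fun c => TB (adj c))).
  rewrite TB_adj adjK adj_sum (fun_sum TBl) => {1}->; apply: eq_bigr => k _.
  by rewrite adjZ (funZ TBl) -st.
have cj c d : (f (adj c) d)^* = f c (TB (adj d)) by rewrite pairing_conj adjK.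
have /(congr1 (fun z : K => z^*)) := TA_closed bl zE wE (adj a).
rewrite cj -turned_leg_adj => h; transitivity (f a (TB (j (adj (l ** dl'))))); last first.
  by rewrite /inv_antipodeB turned_legK -!amulA !legs amulA i_dl'_comm -amulA i_dl'V1 amul1r.
rewrite -h rmorph_sum; apply: eq_bigr => p _; rewrite rmorph_sum; apply: eq_bigr => q _.
rewrite rmorphM /= cj adjM TB_M !TB_adj !adjK; congr (_ * _).
by rewrite pairing_conj (adjM (TA _)) !adjK -pairing_T TA_M TA_adj_pairing adjK.
Qed.

Lemma pairing_mul_l a a' b : f (a ** a') b =
  \sum_p \sum_q f a (y p) * f a' (y q) * f (x p ** x q) b.
Proof.
rewrite -{1}[a]amul1l -(sumx a (lin_l (aone A) a' b)); apply: eq_bigr => p _.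
rewrite amul1l -[x p ** a']amul1r -(sumx a' (lin_l (x p) (aone A) b)) mulr_sumr.
by apply: eq_bigr => q _; rewrite !amul1r mulrA.
Qed.

Lemma pairing_mul a a' b b' : f (a ** a') (b ** b') =
  \sum_p \sum_q \sum_r \sum_s f a (y p ** y q) * f a' (y r ** y s) *
     (f (x p ** x r) b * f (x q ** x s) b').
Proof.
have shift c d d' : f (G (F c ** i dl ** d ** i dl')) d' = f c (d ** d').
  by rewrite /pairing pa_GK -!amulA i_dl'V.
rewrite {1}/pairing amulA (exchange xE) amul_suml amul_suml (fun_sum (pa_psi_lin D)).
apply: eq_bigr => p _; rewrite exchange_big /= amul_suml amul_suml (fun_sum (pa_psi_lin D)).
apply: eq_bigr => r _.
rewrite !amulZl (funZ (pa_psi_lin D)) -/(pairing D _ b') (pairing_mul_l (G _)) scaler_sumr.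
apply: eq_bigr => q _; rewrite scaler_sumr; apply: eq_bigr => s _.
by rewrite !shift -[LHS]/(_ * _); ring.
Qed.

(** [TA_closed] once more: T(a_(2)) a_(1) is a sum over the dual bases of L, whose index
    one will give back a when multiplied by a_(3). *)
Lemma TA_closed_legs : exists (m : nat) (nx ny : 'I_m -> L),
  (forall a, \sum_p \sum_q f a (y p ** y q) *: (TA (x q) ** x p) =
     \sum_k f a (j (nx k)) *: jA (ny k)) /\ \sum_k ny k ** nx k = aone L.
Proof.
have [m [nx [ny [nE n1]]]] := pa_tau_index D; exists m, nx, ny; split=> // a.
apply: (pairing_inj_l (D := D)) => b; have [l bl] := pa_cap D (b ** i dl).
rewrite !fs; transitivity (f a (j (l ** dl'))).
  rewrite -(TA_closed bl xE yE); apply: eq_bigr => p _; rewrite fs.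
  by apply: eq_bigr => q _; rewrite fZ.
rewrite [l ** dl']nE (fun_sum (pa_i_lin D)) (fun_sum (pa_rot_lin D)) fsr.
apply: eq_bigr => k _; rewrite (funZ (pa_i_lin D)) (funZ (pa_rot_lin D)) fZr fZ mulrC.
congr (_ * _).
have -> : dl ** dl ** ny k ** (l ** dl') = ny k ** dl ** l.
  rewrite -dl'_central -!amulA (amulA (ny k)) -dl'_central -amulA.
  by rewrite (amulA dl dl') pa_dlV amul1l amulA pa_dl_central -amulA.
rewrite /pairing -[jA _]amul1r pa_F_jAl !pa_iM -(amulA _ (i l)) -bl -(amulA b) -legs_cap -!amulA.
by rewrite [RHS]pa_psiC -!amulA.
Qed.

Lemma pairing_hopf : hopf_pairing f x y TA TB.
Proof.
have l1 b2 a : linear (fun z => f a (z ** b2) : K^o).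
  by move=> k u v; rewrite amulDl amulZl fb.2.
have l2 b1 a : linear (fun z => f a (b1 ** z) : K^o).
  by move=> k u v; rewrite amulDr amulZr fb.2.
have l3 a2 b : linear (fun z => f (z ** a2) b : K^o).
  by move=> k u v; rewrite amulDl amulZl fb.1.
have l4 a1 b : linear (fun z => f (a1 ** z) b : K^o).
  by move=> k u v; rewrite amulDr amulZr fb.1.
split=> //.
- exact: pairing_mul.
- move=> c; have [l cl] := pa_cup D (c ** iA dl).
  exists (j (l ** dl')), (iA (l ** dl')), (jA (l ** dl')); split.
  + exact: pairing_eps_l.
  + by move=> a b; rewrite pairing_iAr.
  + by move=> a b; rewrite pairing_jAr.
- move=> d; have [l dE] := pa_cap D (d ** i dl).
  exists (iA (l ** dl')), (j (l ** dl')), (i (l ** dl')); split.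
  + exact: pairing_eps_r.
  + by move=> a b; rewrite pairing_iAr.
  + by move=> a b; rewrite pairing_iAl.
- exact: pairing_T.
- exact: TA_M.
- exact: TB_M.
- exact: pairing_conj.
- exact: TB_adj.
- move=> a b; have [l bl] := pa_cap D (b ** i dl).
  rewrite (TA_closed bl xE yE); transitivity (f (a ** jA (l ** dl')) (aone B)).
    by rewrite pairing_jAr amul1r.
  rewrite -(sumx _ (l4 a (aone B))); apply: eq_bigr => p _.
  by rewrite (TB_cap bl) -pairing_jAr amul1l.
- move=> a b; have [l bl] := pa_cap D (adj b ** i dl).
  rewrite (closed_TA bl); transitivity (f (iA (adj (l ** dl')) ** a) (aone B)).
    by rewrite pairing_iAl amul1l.
  rewrite -(sumx _ (l3 a (aone B))); apply: eq_bigr => p _.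
  by rewrite (TB_cap_adj bl) -pairing_iAl amul1r.
- move=> a b; have [m [nx [ny [cl n1]]]] := TA_closed_legs.
  transitivity (\sum_s \sum_r f a (y s ** y r) *
      \sum_p \sum_q f (x s) (y p ** y q) * f (x r ** (TA (x q) ** x p)) b).
    under [RHS]eq_bigr => s _.
      under eq_bigr => r _.
        rewrite mulr_sumr.
        under eq_bigr => p _ do rewrite mulr_sumr.
        over.
      over.
    under [RHS]eq_bigr => s _ do rewrite exchange_big.
    rewrite [RHS]exchange_big; apply: eq_bigr => p _ /=.
    under [RHS]eq_bigr => s _ do rewrite exchange_big.
    rewrite [RHS]exchange_big; apply: eq_bigr => q _ /=.
    rewrite [RHS]exchange_big; apply: eq_bigr => r _ /=.
    rewrite -(sumy (y p ** y q) (l1 (y r) a)) mulr_suml; apply: eq_bigr => s _.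
    by rewrite (amulA (x r)); ring.
  transitivity (\sum_s \sum_r \sum_k f a (y s ** y r) *
      (f (x s) (j (nx k)) * f (x r ** jA (ny k)) b)).
    apply: eq_bigr => s _; apply: eq_bigr => r _; rewrite -mulr_sumr; congr (_ * _).
    transitivity (f (x r ** (\sum_p \sum_q f (x s) (y p ** y q) *: (TA (x q) ** x p))) b).
      rewrite amul_sumr fs; apply: eq_bigr => p _; rewrite amul_sumr fs.
      by apply: eq_bigr => q _; rewrite amulZr fZ.
    by rewrite cl amul_sumr fs; apply: eq_bigr => k _; rewrite amulZr fZ.
  transitivity (\sum_k f (a ** jA (nx k) ** jA (ny k)) b).
    rewrite exchange_big /=; under eq_bigr => r _ do rewrite exchange_big.
    rewrite exchange_big; apply: eq_bigr => k _ /=.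
    rewrite -(sumx _ (l3 (jA (ny k)) b)); apply: eq_bigr => r _.
    rewrite [f (a ** _) _]pairing_jAr -(sumy (j (nx k)) (l1 (y r) a)) mulr_suml.
    by apply: eq_bigr => s _; ring.
  rewrite -[a in RHS]amul1r -(turned_legA1 D) -n1 (fun_sum (pa_iA_lin D)) (fun_sum (pa_F_lin D)).
  rewrite (fun_sum (pa_rot_lin D)) (fun_sum (pa_G_lin D)) amul_sumr fs.
  by apply: eq_bigr => k _; rewrite turned_legAM amulA.
Qed.
End DualBases.

Lemma pairing_duality : finite_dimensional A -> finite_dimensional B ->
  nondegenerate_form f /\
  exists (hA : cstar_weak_hopf A) (hB : cstar_weak_hopf B), in_duality hA hB f.
Proof.
move=> fdA fdB.
have nl a : (forall b, f a b = 0) -> a = 0.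
  by move=> h; apply: (pairing_inj_l (D := D)) => b; rewrite h (bil0l fb).
have nr b : (forall a, f a b = 0) -> b = 0.
  by move=> h; apply: (pairing_inj_r (D := D)) => a; rewrite h (bil0r fb).
split=> //.
have [n [x [y [xE yE]]]] : exists (n : nat) (x : 'I_n -> A) (y : 'I_n -> B),
    (forall a, a = \sum_k f a (y k) *: x k) /\ (forall b, b = \sum_k f (x k) b *: y k).
  exact: (dual_bases fb).
have hp := pairing_hopf xE yE.
by exists (hopf_of_pairing hp), (hopf_of_pairing (hopf_pairing_sym hp));
  exact: hopf_pairing_duality.
Qed.
End PairingIsHopf.

(** * 2-cells as natural families *)

Local Open Scope cell_scope.

Section HetEq.
Variables (R : realType) (C : cstar_two_cat R).

(** Equality of 2-cells up to the identification of their end 1-cells. *)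
Definition hq (N M : C) (a b a' b' : cell1 N M) (s : cell2 a b) (t : cell2 a' b') :=
  exists (e : a = a') (e' : b = b'), eq2 e' \o s = t \o eq2 e.

Section Fixed.
Variables N M : C.
Implicit Types a b c : cell1 N M.

Lemma hq_eq a b (s t : cell2 a b) : hq s t -> s = t.
Proof.
case=> e [e']; rewrite (Prop_irrelevance e erefl) (Prop_irrelevance e' erefl) /=.
by rewrite vcomp1l vcomp1r.
Qed.

Lemma hq_refl a b (s : cell2 a b) : hq s s.
Proof. by exists erefl, erefl; rewrite /= vcomp1l vcomp1r. Qed.

Lemma hq_sym a b a' b' (s : cell2 a b) (t : cell2 a' b') : hq s t -> hq t s.
Proof.
case=> e [e']; case: _ / e' in t *; case: _ / e in t * => /=.
by rewrite vcomp1l vcomp1r => ->; apply: hq_refl.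
Qed.

Lemma hq_trans a b a' b' a'' b'' (s : cell2 a b) (t : cell2 a' b') (u : cell2 a'' b'') :
  hq s t -> hq t u -> hq s u.
Proof.
case=> e [e']; case: _ / e' in t *; case: _ / e in t * => /=.
by rewrite vcomp1l vcomp1r => ->.
Qed.

Lemma hq_vcomp a b c a' b' c' (s : cell2 b c) (t : cell2 a b)
    (s' : cell2 b' c') (t' : cell2 a' b') :
  hq s s' -> hq t t' -> hq (s \o t) (s' \o t').
Proof.
case=> e [e']; case: _ / e' in s' *; case: _ / e in s' t' * => /=.
rewrite vcomp1l vcomp1r => ->.
case=> e [e']; rewrite (Prop_irrelevance e' erefl) /=.
case: _ / e in t' *; rewrite /= vcomp1l vcomp1r => ->; exact: hq_refl.
Qed.

Lemma hq_star a b a' b' (s : cell2 a b) (t : cell2 a' b') : hq s t -> hq (s^*) (t^*).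
Proof.
case=> e [e']; case: _ / e' in t *; case: _ / e in t * => /=.
by rewrite vcomp1l vcomp1r => ->; apply: hq_refl.
Qed.

Lemma hq_eq2l a b c (e : b = c) (s : cell2 a b) : hq (eq2 e \o s) s.
Proof. by case: _ / e; rewrite /= vcomp1l; apply: hq_refl. Qed.

Lemma hq_eq2r a b c (e : a = b) (s : cell2 b c) : hq (s \o eq2 e) s.
Proof. by case: _ / e in s *; rewrite /= vcomp1r; apply: hq_refl. Qed.

End Fixed.

Lemma hq_fam (X S T : C) (F G : cell1 X S -> cell1 X T)
    (g : forall x, cell2 (F x) (G x)) a b : a = b -> hq (g a) (g b).
Proof. by move=> <-; apply: hq_refl. Qed.

Lemma hq_hcomp (N M L : C) (a b a' b' : cell1 M L) (c d c' d' : cell1 N M)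
    (s : cell2 a b) (s' : cell2 a' b') (t : cell2 c d) (t' : cell2 c' d') :
  hq s s' -> hq t t' -> hq (s \xx t) (s' \xx t').
Proof.
case=> e [e']; case: _ / e' in s' *; case: _ / e in s' * => /=.
rewrite vcomp1l vcomp1r => -> [e [e']].
case: _ / e' in t' *; case: _ / e in t' * => /=.
by rewrite vcomp1l vcomp1r => ->; apply: hq_refl.
Qed.

Lemma hq_A (N M L P : C) (a a' : cell1 L P) (b b' : cell1 M L) (c c' : cell1 N M)
    (s : cell2 a a') (t : cell2 b b') (u : cell2 c c') :
  hq (s \xx (t \xx u)) (s \xx t \xx u).
Proof. by exists (comp1A a b c), (comp1A a' b' c'); apply: hcompA. Qed.

Lemma hq_1l (N M : C) (a b : cell1 N M) (t : cell2 a b) : hq (id2 (unit1 M) \xx t) t.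
Proof. by exists (comp1l a), (comp1l b); apply: hcomp1l. Qed.

Lemma hq_1r (N M : C) (a b : cell1 N M) (t : cell2 a b) : hq (t \xx id2 (unit1 N)) t.
Proof. by exists (comp1r a), (comp1r b); apply: hcomp1r. Qed.

(** Left whiskering by a 1-cell. As a functor on the 1-cells with a fixed target it
    composes strictly: words in 1-cells, applied to a variable 1-cell and
    bracketed to the right, need no associators. *)
Definition lw (N M X : C) (a : cell1 N M) (x y : cell1 X N) (s : cell2 x y) :
  cell2 (a \x x) (a \x y) := id2 a \xx s.

Lemma lw_comp (N M X : C) (a : cell1 N M) (x y z : cell1 X N)
    (s : cell2 y z) (t : cell2 x y) : lw a (s \o t) = lw a s \o lw a t.
Proof. by rewrite /lw -Defs.interchange vcomp1l. Qed.

Lemma lw_id (N M X : C) (a : cell1 N M) (x : cell1 X N) : lw a (id2 x) = id2 (a \x x).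
Proof. exact: hcomp_id2. Qed.

Lemma lw_lin (N M X : C) (a : cell1 N M) (x y : cell1 X N) : linear (@lw N M X a x y).
Proof. exact: (hcomp_bilinear _ _ _ _).2. Qed.

Lemma star_inj (N M : C) (a b : cell1 N M) : injective (@star R C N M a b).
Proof. exact: (can_inj (@starK _ _ _ _ _ _)). Qed.

Lemma star_id (N M : C) (a : cell1 N M) : (id2 a)^* = id2 a.
Proof. by rewrite -[LHS]vcomp1r -{2}[id2 a]starK -star_vcomp vcomp1r starK. Qed.

Lemma lw_star (N M X : C) (a : cell1 N M) (x y : cell1 X N) (s : cell2 x y) :
  (lw a s)^* = lw a (s^*).
Proof. by rewrite /lw star_hcomp star_id. Qed.

Lemma hq_lw (N M X : C) (a : cell1 N M) (x y x' y' : cell1 X N)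
    (s : cell2 x y) (t : cell2 x' y') : hq s t -> hq (lw a s) (lw a t).
Proof. exact: (hq_hcomp (hq_refl _)). Qed.

Lemma vcomp_bil (N M : C) (a b c : cell1 N M) : is_bilinear (@vcomp R C N M a b c).
Proof. exact: vcomp_bilinear. Qed.

(** A 1-cell [wc] together with the functor [wf], [wm] it induces on 1-cells,
    written in a convenient bracketing. *)
Record word (S T : C) := Word {
  wc : cell1 S T;
  wf : forall X : C, cell1 X S -> cell1 X T;
  we : forall (X : C) (x : cell1 X S), wc \x x = wf x;
  wm : forall (X : C) (x y : cell1 X S), cell2 x y -> cell2 (wf x) (wf y);
  wmE : forall (X : C) (x y : cell1 X S) (s : cell2 x y), hq (wm s) (id2 wc \xx s)
}.

Definition w0 (S : C) : word S S := {|
  wc := unit1 S; wf := fun _ x => x; we := fun _ x => comp1l x;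
  wm := fun _ _ _ s => s; wmE := fun _ _ _ s => hq_sym (hq_1l s) |}.

Definition w1 (S T : C) (a : cell1 S T) : word S T := {|
  wc := a; wf := fun _ x => a \x x; we := fun _ x => erefl;
  wm := fun _ _ _ s => lw a s; wmE := fun _ _ _ s => hq_refl _ |}.

Lemma w2E (S S' T X : C) (a : cell1 S' T) (b : cell1 S S') (x y : cell1 X S)
  (s : cell2 x y) : hq (lw a (lw b s)) (id2 (a \x b) \xx s).
Proof. by rewrite -hcomp_id2; apply: hq_A. Qed.

Definition w2 (S S' T : C) (a : cell1 S' T) (b : cell1 S S') : word S T := {|
  wc := a \x b; wf := fun _ x => a \x (b \x x); we := fun _ x => esym (comp1A a b x);
  wm := fun _ _ _ s => lw a (lw b s); wmE := fun _ _ _ s => w2E a b s |}.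

Lemma w3e (S S' S'' T X : C) (a : cell1 S' T) (b : cell1 S'' S') (c : cell1 S S'')
  (x : cell1 X S) : a \x b \x c \x x = a \x (b \x (c \x x)).
Proof. by rewrite !comp1A. Qed.

Lemma w3E (S S' S'' T X : C) (a : cell1 S' T) (b : cell1 S'' S') (c : cell1 S S'')
    (x y : cell1 X S) (s : cell2 x y) :
  hq (lw a (lw b (lw c s))) (id2 (a \x b \x c) \xx s).
Proof.
apply: hq_trans (w2E _ _ _); apply: hq_trans (hq_A _ _ _) _.
by rewrite hcomp_id2; apply: hq_refl.
Qed.

Definition w3 (S S' S'' T : C) (a : cell1 S' T) (b : cell1 S'' S') (c : cell1 S S'') :
    word S T := {|
  wc := a \x b \x c; wf := fun _ x => a \x (b \x (c \x x));
  we := fun _ x => w3e a b c x;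
  wm := fun _ _ _ s => lw a (lw b (lw c s)); wmE := fun _ _ _ s => w3E a b c s |}.

End HetEq.

Arguments star_inj {R C N M a b}.
Arguments lw_lin {R C N M X a x y}.
Arguments vcomp_bil {R C N M a b c}.

(** The natural transformation between induced functors given by a 2-cell. *)
HB.lock Definition fam (R : realType) (C : cstar_two_cat R) (S T : C) (w w' : word S T)
    (t : cell2 (wc w) (wc w')) (X : C) (x : cell1 X S) : cell2 (wf w x) (wf w' x) :=
  eq2 (we w' x) \o ((t \xx id2 x) \o eq2 (esym (we w x))).

Section Families.
Variables (R : realType) (C : cstar_two_cat R).
Variables (S T : C).

Lemma hq_famE (w w' : word S T) (t : cell2 (wc w) (wc w')) (X : C) (x : cell1 X S) :
  hq (fam t x) (t \xx id2 x).
Proof. by rewrite fam.unlock; exact: hq_trans (hq_eq2l _ _) (hq_eq2r _ _). Qed.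

Lemma fam_nat (w w' : word S T) (t : cell2 (wc w) (wc w')) (X : C) (x y : cell1 X S)
    (s : cell2 x y) : fam t y \o wm w s = wm w' s \o fam t x.
Proof.
apply: hq_eq; apply: hq_trans (hq_vcomp (hq_famE _ _) (wmE _ _)) _.
apply: hq_trans (hq_sym (hq_vcomp (wmE _ _) (hq_famE _ _))).
by rewrite -!Defs.interchange !vcomp1l !vcomp1r; apply: hq_refl.
Qed.

Lemma fam_comp (w w' w'' : word S T) (s : cell2 (wc w') (wc w''))
    (t : cell2 (wc w) (wc w')) (X : C) (x : cell1 X S) :
  @fam _ _ _ _ w w'' (s \o t) X x = fam s x \o fam t x.
Proof.
apply: hq_eq; apply: hq_trans (hq_famE _ _) _.
apply: hq_trans (hq_sym (hq_vcomp (hq_famE _ _) (hq_famE _ _))).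
by rewrite -Defs.interchange vcomp1l; apply: hq_refl.
Qed.

Lemma fam_id (w : word S T) (X : C) (x : cell1 X S) :
  @fam _ _ _ _ w w (id2 (wc w)) X x = id2 (wf w x).
Proof.
apply: hq_eq; apply: hq_trans (hq_famE _ _) _; rewrite hcomp_id2.
by rewrite (we w x); apply: hq_refl.
Qed.

Lemma fam_star (w w' : word S T) (t : cell2 (wc w) (wc w')) (X : C) (x : cell1 X S) :
  @fam _ _ _ _ w' w (t^*) X x = (fam t x)^*.
Proof.
apply: hq_eq; apply: hq_trans (hq_famE _ _) _; apply: hq_sym.
apply: hq_trans (hq_star (hq_famE _ _)) _.
by rewrite star_hcomp star_id; apply: hq_refl.
Qed.

Lemma fam_lin (w w' : word S T) (X : C) (x : cell1 X S) :
  linear (fun t : cell2 (wc w) (wc w') => fam t x).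
Proof.
move=> k s t; rewrite fam.unlock (hcomp_bilinear _ _ _ _).1.
by rewrite (vcomp_bilinear _ _ _).1 (vcomp_bilinear _ _ _).2.
Qed.

Lemma fam_unit_inj (w w' : word S T) (s t : cell2 (wc w) (wc w')) :
  fam s (unit1 S) = fam t (unit1 S) -> s = t.
Proof.
have h (r : cell2 (wc w) (wc w')) : hq r (fam r (unit1 S)).
  exact: hq_trans (hq_sym (hq_1r _)) (hq_sym (hq_famE _ _)).
move=> e; apply: hq_eq; apply: hq_trans (h s) _.
by rewrite e; apply/hq_sym/h.
Qed.

Lemma fam_inj (w w' : word S T) (s t : cell2 (wc w) (wc w')) :
  (forall (X : C) (x : cell1 X S), fam s x = fam t x) -> s = t.
Proof. by move=> h; apply: fam_unit_inj. Qed.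

(** The families that come from 2-cells are those compatible with composition on
    the right. *)
Definition tensorial (F G : forall X : C, cell1 X S -> cell1 X T)
    (g : forall (X : C) (x : cell1 X S), cell2 (F X x) (G X x)) : Prop :=
  forall (X Y : C) (x : cell1 X S) (z : cell1 Y X), hq (g Y (x \x z)) (g X x \xx id2 z).

Lemma tensorial_fam (w w' : word S T) (t : cell2 (wc w) (wc w')) :
  @tensorial (wf w) (wf w') (fun X x => fam t x).
Proof.
move=> X Y x z; apply: hq_trans (hq_famE _ _) _; rewrite -hcomp_id2.
apply: hq_trans (hq_A _ _ _) (hq_hcomp (hq_sym (hq_famE _ _)) (hq_refl _)).
Qed.

(** A family compatible with composition on the right is determined by its value at the
    unit 1-cell, which is a 2-cell between the given words. *)
Lemma tensorial_exists (w w' : word S T)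
    (g : forall (X : C) (x : cell1 X S), cell2 (wf w x) (wf w' x)) :
  tensorial g -> exists t : cell2 (wc w) (wc w'), forall X (x : cell1 X S), fam t x = g X x.
Proof.
move=> tg.
have e (v : word S T) : wf v (unit1 S) = wc v by rewrite -(we v) comp1r.
exists (eq2 (e w') \o (g _ (unit1 S) \o eq2 (esym (e w)))) => X x.
apply: hq_eq; apply: hq_trans (hq_famE _ _) _.
apply: hq_trans (hq_hcomp (hq_trans (hq_eq2l _ _) (hq_eq2r _ _)) (hq_refl _)) _.
apply: hq_trans (hq_sym (tg _ _ _ _)) _.
exact: (hq_fam (g X) (comp1l x)).
Qed.

Lemma unit_cell_exists (w w' : word S T)
    (z : cell2 (wf w (unit1 S)) (wf w' (unit1 S))) :
  exists t : cell2 (wc w) (wc w'), fam t (unit1 S) = z.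
Proof.
have e (v : word S T) : wf v (unit1 S) = wc v by rewrite -(we v) comp1r.
exists (eq2 (e w') \o (z \o eq2 (esym (e w)))).
apply: hq_eq; apply: hq_trans (hq_famE _ _) _; apply: hq_trans (hq_1r _) _.
exact: hq_trans (hq_eq2l _ _) (hq_eq2r _ _).
Qed.

Lemma tensorial_comp (F G H : forall X : C, cell1 X S -> cell1 X T) g h :
  @tensorial G H g -> @tensorial F G h -> tensorial (fun X x => g X x \o h X x).
Proof.
move=> tg th X Y x z; apply: hq_trans (hq_vcomp (tg _ _ _ _) (th _ _ _ _)) _.
by rewrite -Defs.interchange vcomp1l; apply: hq_refl.
Qed.

Lemma tensorial_star (F G : forall X : C, cell1 X S -> cell1 X T) g :
  @tensorial F G g -> tensorial (fun X x => (g X x)^*).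
Proof.
move=> tg X Y x z; apply: hq_trans (hq_star (tg _ _ _ _)) _.
by rewrite star_hcomp star_id; apply: hq_refl.
Qed.
End Families.

Section TensorialFamilies.
Variables (R : realType) (C : cstar_two_cat R).

Lemma tensorial_lw (S T U : C) (a : cell1 T U)
    (F G : forall X : C, cell1 X S -> cell1 X T) g :
  @tensorial R C S T F G g -> tensorial (fun X x => lw a (g X x)).
Proof.
move=> tg X Y x z; apply: hq_trans (hq_lw a (tg _ _ _ _)) _.
exact: hq_A.
Qed.

Lemma tensorial_pre (S S' T : C) (b : cell1 S' S)
    (F G : forall X : C, cell1 X S -> cell1 X T) g :
  @tensorial R C S T F G g -> tensorial (fun X (x : cell1 X S') => g X (b \x x)).
Proof.
move=> tg X Y x z; apply: hq_trans (tg _ _ _ _).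
exact: (hq_fam (g Y) (comp1A b x z)).
Qed.
End TensorialFamilies.

(** * Quarter turns and half turns *)

Section Adjunction.
Variables (R : realType) (C : cstar_two_cat R).

Section UnitCells.
Variables (N M : C) (iota : cell1 N M) (iotab : cell1 M N).
Variables (r0 : cell2 (unit1 N) (iotab \x iota)).

Definition ucell (X : C) (x : cell1 X N) : cell2 x (iotab \x (iota \x x)) :=
  @fam R C N N (w0 N) (w2 iotab iota) r0 X x.

Definition fam2 (a : cell2 (iota \x iotab) (iota \x iotab)) (X : C) (y : cell1 X M) :
    cell2 (iota \x (iotab \x y)) (iota \x (iotab \x y)) :=
  @fam R C M M (w2 iota iotab) (w2 iota iotab) a X y.

Definition fam1 (l : cell2 iota iota) (X : C) (x : cell1 X N) :
    cell2 (iota \x x) (iota \x x) :=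
  @fam R C N M (w1 iota) (w1 iota) l X x.

Lemma ucell_nat (X : C) (x y : cell1 X N) (s : cell2 x y) :
  ucell y \o s = lw iotab (lw iota s) \o ucell x.
Proof. exact: (@fam_nat R C N N (w0 N) (w2 iotab iota) r0). Qed.

Lemma ucells_nat (X : C) (x y : cell1 X N) (s : cell2 x y) :
  (ucell y)^* \o lw iotab (lw iota s) = s \o (ucell x)^*.
Proof.
apply: star_inj; rewrite !star_vcomp !lw_star !starK.
by rewrite ucell_nat.
Qed.

Lemma fam2_nat a (X : C) (x y : cell1 X M) (s : cell2 x y) :
  fam2 a y \o lw iota (lw iotab s) = lw iota (lw iotab s) \o fam2 a x.
Proof. exact: (@fam_nat R C M M (w2 iota iotab) (w2 iota iotab) a). Qed.

Lemma fam1_nat l (X : C) (x y : cell1 X N) (s : cell2 x y) :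
  fam1 l y \o lw iota s = lw iota s \o fam1 l x.
Proof. exact: (@fam_nat R C N M (w1 iota) (w1 iota) l). Qed.

Lemma fam2M a b (X : C) (y : cell1 X M) : fam2 (a \o b) y = fam2 a y \o fam2 b y.
Proof. exact: (@fam_comp R C M M (w2 iota iotab) (w2 iota iotab) (w2 iota iotab) a b X y). Qed.

Lemma fam1M a b (X : C) (y : cell1 X N) : fam1 (a \o b) y = fam1 a y \o fam1 b y.
Proof. exact: (@fam_comp R C N M (w1 iota) (w1 iota) (w1 iota) a b X y). Qed.

Lemma fam2_1 (X : C) (y : cell1 X M) : fam2 (id2 _) y = id2 _.
Proof. exact: (@fam_id R C M M (w2 iota iotab) X y). Qed.

Lemma fam1_1 (X : C) (y : cell1 X N) : fam1 (id2 _) y = id2 _.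
Proof. exact: (@fam_id R C N M (w1 iota) X y). Qed.

Lemma fam2_star a (X : C) (y : cell1 X M) : fam2 (a^*) y = (fam2 a y)^*.
Proof. exact: (@fam_star R C M M (w2 iota iotab) (w2 iota iotab) a X y). Qed.

Lemma fam1_star a (X : C) (y : cell1 X N) : fam1 (a^*) y = (fam1 a y)^*.
Proof. exact: (@fam_star R C N M (w1 iota) (w1 iota) a X y). Qed.

Lemma fam2_lin (X : C) (y : cell1 X M) : linear (fun a => fam2 a y).
Proof. exact: (@fam_lin R C M M (w2 iota iotab) (w2 iota iotab)). Qed.

Lemma fam1_lin (X : C) (y : cell1 X N) : linear (fun a => fam1 a y).
Proof. exact: (@fam_lin R C N M (w1 iota) (w1 iota)). Qed.

Lemma tensorial_ucell : tensorial ucell.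
Proof. exact: (@tensorial_fam R C N N (w0 N) (w2 iotab iota) r0). Qed.

Lemma tensorial_fam2 a : tensorial (fam2 a).
Proof. exact: (@tensorial_fam R C M M (w2 iota iotab) (w2 iota iotab) a). Qed.

Lemma fam2_inj a b : (forall X (y : cell1 X M), fam2 a y = fam2 b y) -> a = b.
Proof. exact: (@fam_inj R C M M (w2 iota iotab) (w2 iota iotab)). Qed.

Lemma fam2_unit_inj a b : fam2 a (unit1 M) = fam2 b (unit1 M) -> a = b.
Proof. exact: (@fam_unit_inj R C M M (w2 iota iotab) (w2 iota iotab)). Qed.

Lemma fam1_unit_inj a b : fam1 a (unit1 N) = fam1 b (unit1 N) -> a = b.
Proof. exact: (@fam_unit_inj R C N M (w1 iota) (w1 iota)). Qed.

Lemma fam2_exists (g : forall (X : C) (y : cell1 X M),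
    cell2 (iota \x (iotab \x y)) (iota \x (iotab \x y))) :
  tensorial g -> exists a, forall X (y : cell1 X M), fam2 a y = g X y.
Proof. exact: (@tensorial_exists R C M M (w2 iota iotab) (w2 iota iotab)). Qed.

Lemma fam1_exists (g : forall (X : C) (x : cell1 X N), cell2 (iota \x x) (iota \x x)) :
  tensorial g -> exists l, forall X (x : cell1 X N), fam1 l x = g X x.
Proof. exact: (@tensorial_exists R C N M (w1 iota) (w1 iota)). Qed.

Lemma fam2_unit_exists (z : cell2 (iota \x (iotab \x unit1 M)) (iota \x (iotab \x unit1 M))) :
  exists a, fam2 a (unit1 M) = z.
Proof. exact: (@unit_cell_exists R C M M (w2 iota iotab) (w2 iota iotab)). Qed.

Lemma fam1_unit_exists (z : cell2 (iota \x unit1 N) (iota \x unit1 N)) :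
  exists l, fam1 l (unit1 N) = z.
Proof. exact: (@unit_cell_exists R C N M (w1 iota) (w1 iota)). Qed.

Lemma fam2_l (l : cell2 iota iota) (X : C) (y : cell1 X M) :
  fam2 (l \xx id2 iotab) y = fam1 l (iotab \x y).
Proof.
apply: hq_eq.
apply: hq_trans (@hq_famE R C M M (w2 iota iotab) (w2 iota iotab) _ X y) _.
apply: hq_trans (hq_sym (hq_A _ _ _)) _; rewrite hcomp_id2.
exact: hq_sym (@hq_famE R C N M (w1 iota) (w1 iota) l X _).
Qed.

(** An endomorphism of iota x iotab becomes one of iotab x iota when the lower end of its
    left strand is bent up on the left and the upper end of its right strand down on the
    right. *)
Lemma turn_exists (a : cell2 (iota \x iotab) (iota \x iotab)) :
  exists b : cell2 (iotab \x iota) (iotab \x iota), forall X (x : cell1 X N),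
  @fam R C N N (w2 iotab iota) (w2 iotab iota) b X x =
  lw iotab (lw iota ((ucell x)^*) \o fam2 a (iota \x x)) \o ucell (iotab \x (iota \x x)).
Proof.
apply: (@tensorial_exists R C N N (w2 iotab iota) (w2 iotab iota)).
have tr := tensorial_ucell.
apply: (tensorial_comp (tensorial_lw _ (tensorial_comp (tensorial_lw _ (tensorial_star tr))
  (tensorial_pre _ (tensorial_fam2 a))))).
exact: (tensorial_pre iota (tensorial_pre iotab tr)).
Qed.

Definition turn a := projT1 (cid (turn_exists a)).
End UnitCells.

Lemma fam2_r (N M : C) (iota : cell1 N M) (iotab : cell1 M N) (l : cell2 iota iota)
    (X : C) (x : cell1 X N) : fam2 (id2 iotab \xx l) x = lw iotab (fam1 l x).
Proof.
apply: hq_eq.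
apply: hq_trans (@hq_famE R C N N (w2 iotab iota) (w2 iotab iota) _ X x) _.
apply: hq_trans (hq_sym (hq_A _ _ _)) (hq_lw _ (hq_sym _)).
exact: (@hq_famE R C N M (w1 iota) (w1 iota) l X _).
Qed.

Lemma turnE (N M : C) (iota : cell1 N M) (iotab : cell1 M N)
    (r0 : cell2 (unit1 N) (iotab \x iota)) (a : cell2 (iota \x iotab) (iota \x iotab))
    (X : C) (x : cell1 X N) :
  fam2 (turn r0 a) x =
  lw iotab (lw iota ((ucell r0 x)^*) \o fam2 a (iota \x x)) \o
    ucell r0 (iotab \x (iota \x x)).
Proof. exact: (projT2 (cid (turn_exists r0 a))). Qed.

Lemma turn_lin (N M : C) (iota : cell1 N M) (iotab : cell1 M N)
    (r0 : cell2 (unit1 N) (iotab \x iota)) : linear (@turn N M iota iotab r0).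
Proof.
move=> k a a'; apply: fam2_inj => X x; rewrite (fam2_lin x) !turnE (fam2_lin _).
by rewrite vcomp_bil.2 lw_lin vcomp_bil.1.
Qed.

(** The conjugacy equations, whiskered by all 1-cells. *)
Definition conj_pair (N M : C) (iota : cell1 N M) (iotab : cell1 M N)
    (r0 : cell2 (unit1 N) (iotab \x iota)) (rb0 : cell2 (unit1 M) (iota \x iotab)) :=
  (forall (X : C) (x : cell1 X N),
     (ucell rb0 (iota \x x))^* \o lw iota (ucell r0 x) = id2 (iota \x x)) /\
  (forall (X : C) (y : cell1 X M),
     lw iotab ((ucell rb0 y)^*) \o ucell r0 (iotab \x y) = id2 (iotab \x y)).

Lemma conj_pair_sym (N M : C) (iota : cell1 N M) (iotab : cell1 M N)
    (r0 : cell2 (unit1 N) (iotab \x iota)) (rb0 : cell2 (unit1 M) (iota \x iotab)) :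
  conj_pair r0 rb0 -> conj_pair rb0 r0.
Proof.
case=> z1 z2; split=> X x; apply: star_inj.
  by rewrite star_vcomp lw_star starK z2 star_id.
by rewrite star_vcomp lw_star starK z1 star_id.
Qed.

End Adjunction.

(** The solution of the conjugacy equations for rho = iotab x iota and itself. *)
HB.lock Definition wcell (R : realType) (C : cstar_two_cat R) (N M : C)
    (iota : cell1 N M) (iotab : cell1 M N)
    (r0 : cell2 (unit1 N) (iotab \x iota)) (rb0 : cell2 (unit1 M) (iota \x iotab))
    (X : C) (x : cell1 X N) :
    cell2 x (iotab \x (iota \x (iotab \x (iota \x x)))) :=
  lw iotab (ucell rb0 (iota \x x)) \o ucell r0 x.

Section Turns.
Variables (R : realType) (C : cstar_two_cat R).
Variables (N M : C) (iota : cell1 N M) (iotab : cell1 M N).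
Variables (r0 : cell2 (unit1 N) (iotab \x iota)) (rb0 : cell2 (unit1 M) (iota \x iotab)).
Hypothesis cp : conj_pair r0 rb0.

Local Notation P := (lw iota).
Local Notation Q := (lw iotab).
Local Notation r := (ucell r0).
Local Notation rb := (ucell rb0).
Local Notation rho x := (iotab \x (iota \x x)).

Let z1 := cp.1.
Let z2 := cp.2.
Let z1' := (conj_pair_sym cp).1.
Let z2' := (conj_pair_sym cp).2.

Implicit Types (a : cell2 (iota \x iotab) (iota \x iotab)).
Implicit Types (b : cell2 (iotab \x iota) (iotab \x iota)).

Local Notation w := (wcell r0 rb0).

Lemma wcell_nat (X : C) (x y : cell1 X N) (s : cell2 x y) :
  w y \o s = Q (P (Q (P s))) \o w x.
Proof.
rewrite wcell.unlock -vcompA ucell_nat !vcompA; congr (_ \o _).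
by rewrite -!lw_comp ucell_nat.
Qed.

Lemma wcells_nat (X : C) (x y : cell1 X N) (s : cell2 x y) :
  (w y)^* \o Q (P (Q (P s))) = s \o (w x)^*.
Proof.
apply: star_inj; rewrite !star_vcomp !lw_star !starK.
by rewrite wcell_nat.
Qed.

Lemma wcells (X : C) (x : cell1 X N) : (w x)^* = (r x)^* \o Q ((rb (iota \x x))^*).
Proof. by rewrite wcell.unlock star_vcomp lw_star. Qed.

Lemma wcell_z1 (X : C) (x : cell1 X N) : (w (rho x))^* \o Q (P (w x)) = id2 _.
Proof.
rewrite wcells wcell.unlock -vcompA -lw_comp.
rewrite (lw_comp iota) vcompA ucells_nat -vcompA z1 vcomp1r.
exact: z1'.
Qed.

Lemma wcell_z2 (X : C) (x : cell1 X N) : Q (P ((w x)^*)) \o w (rho x) = id2 _.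
Proof.
apply: star_inj.
by rewrite star_vcomp !lw_star starK star_id; exact: wcell_z1.
Qed.

Lemma wcell_inj (X : C) (x y : cell1 X N) (s t : cell2 (rho x) y) :
  Q (P s) \o w x = Q (P t) \o w x -> s = t.
Proof.
move=> h; have E (u : cell2 (rho x) y) : u = (w y)^* \o Q (P (Q (P u) \o w x)).
  by rewrite !lw_comp vcompA wcells_nat -vcompA wcell_z1 vcomp1r.
by rewrite (E s) (E t) h.
Qed.

Lemma wcells_inj (X : C) (x y : cell1 X N) (s t : cell2 y (rho x)) :
  (w x)^* \o Q (P s) = (w x)^* \o Q (P t) -> s = t.
Proof.
move=> h; apply: star_inj; apply: (@wcell_inj _ x y).
apply: star_inj.
by rewrite !star_vcomp !lw_star !starK.
Qed.

(** Sliding the turned endomorphism along the cup unbends it; this and its variants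
    below characterise the turns and replace computations with bent strands. *)
Lemma turn_char a (X : C) (x : cell1 X N) :
  (rb (iota \x x))^* \o P (fam2 (turn r0 a) x) = P ((r x)^*) \o fam2 a (iota \x x).
Proof.
rewrite turnE lw_comp vcompA ucells_nat -vcompA z1 vcomp1r.
by [].
Qed.

Lemma turn_char_star a (X : C) (x : cell1 X N) :
  P ((fam2 (turn r0 a) x)^*) \o rb (iota \x x) = (fam2 a (iota \x x))^* \o P (r x).
Proof.
apply: star_inj.
by rewrite !star_vcomp !lw_star !starK turn_char.
Qed.

Lemma turn_char_inner a (X : C) (y : cell1 X M) :
  fam2 (turn r0 a) (iotab \x y) \o Q (rb y) = Q (fam2 a y) \o r (iotab \x y).
Proof.
rewrite turnE -vcompA ucell_nat vcompA -lw_comp; congr (_ \o _); congr lw.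
rewrite -vcompA fam2_nat vcompA -lw_comp z1' lw_id vcomp1l.
by [].
Qed.

Lemma turn_inj a a' : turn r0 a = turn r0 a' -> a = a'.
Proof.
move=> h; apply: fam2_inj => X y.
have E (c : cell2 (iota \x iotab) (iota \x iotab)) : fam2 c y = P ((r (iotab \x y))^*) \o
    fam2 c (iota \x (iotab \x y)) \o P (Q (rb y)).
  by rewrite -vcompA fam2_nat vcompA -lw_comp z1' lw_id vcomp1l.
by rewrite E -turn_char h turn_char -E.
Qed.
End Turns.

Section HalfTurns.
Variables (R : realType) (C : cstar_two_cat R).
Variables (N M : C) (iota : cell1 N M) (iotab : cell1 M N).
Variables (r0 : cell2 (unit1 N) (iotab \x iota)) (rb0 : cell2 (unit1 M) (iota \x iotab)).
Hypothesis cp : conj_pair r0 rb0.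

Local Notation P := (lw iota).
Local Notation Q := (lw iotab).
Local Notation r := (ucell r0).
Local Notation rb := (ucell rb0).
Local Notation rho x := (iotab \x (iota \x x)).
Local Notation w := (wcell r0 rb0).

Let z1 := cp.1.
Let z2 := cp.2.
Let pc := conj_pair_sym cp.
Let z1' := pc.1.
Let z2' := pc.2.

Implicit Types (a : cell2 (iota \x iotab) (iota \x iotab)).
Implicit Types (b : cell2 (iotab \x iota) (iotab \x iota)).

Definition half_turn b := turn r0 (turn rb0 b).

(** The half turn of b on one strand pair of the cap w^* is b on the other pair. *)
Lemma rot_out b (X : C) (x : cell1 X N) :
  (w x)^* \o Q (P (fam2 (half_turn b) x)) = (w x)^* \o fam2 b (rho x).
Proof.
rewrite wcells -!vcompA -lw_comp /half_turn (turn_char cp) lw_comp vcompA ucells_nat.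
by rewrite -vcompA (turn_char pc).
Qed.

Lemma rot_in b (X : C) (x : cell1 X N) :
  fam2 (half_turn b) (rho x) \o w x = Q (P (fam2 b x)) \o w x.
Proof.
rewrite wcell.unlock vcompA (turn_char_inner cp) -vcompA ucell_nat vcompA -lw_comp.
by rewrite vcompA -lw_comp (turn_char_inner pc).
Qed.

(** Sliding b b' along w^* reverses the order of the factors. *)
Lemma rotM b b' : half_turn (b \o b') = half_turn b' \o half_turn b.
Proof.
apply: fam2_inj => X x; apply: (wcells_inj cp); rewrite rot_out !fam2M !lw_comp !vcompA.
by rewrite rot_out -[in RHS]vcompA fam2_nat [in RHS]vcompA rot_out.
Qed.

Lemma fam2_wcell_inj b b' :
  (forall (X : C) (x : cell1 X N), fam2 b (rho x) \o w x = fam2 b' (rho x) \o w x) -> b = b'.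
Proof.
move=> h; apply: fam2_inj => X x.
have E c : fam2 c x = Q (P ((w x)^*)) \o (fam2 c (rho (rho x)) \o w (rho x)).
  by rewrite vcompA -fam2_nat -vcompA (wcell_z2 cp) vcomp1r.
by rewrite E h -E.
Qed.

Lemma rot_star b : half_turn ((half_turn b)^*) = b^*.
Proof.
apply: fam2_wcell_inj => X x; rewrite rot_in !fam2_star.
apply: star_inj.
by rewrite !star_vcomp !lw_star !starK rot_out.
Qed.

Lemma turn_star a : turn r0 (a^*) = half_turn ((turn r0 a)^*).
Proof.
apply: fam2_wcell_inj => X x; rewrite rot_in wcell.unlock !vcompA (turn_char_inner cp).
rewrite -vcompA ucell_nat vcompA -!lw_comp fam2_star fam2_star.
by rewrite (turn_char_star cp).
Qed.

(** Multiplying by l on the left and on the right of a reaches the two strands of the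
    turned endomorphism. *)
Lemma turn_mull (l : cell2 iota iota) a :
  turn r0 ((l \xx id2 iotab) \o a) = (id2 iotab \xx l) \o turn r0 a.
Proof.
apply: fam2_inj => X x; rewrite fam2M fam2_r !turnE fam2M fam2_l [RHS]vcompA -lw_comp.
by rewrite !vcompA fam1_nat.
Qed.

Lemma fam2_rot_r (l : cell2 iota iota) (X : C) (x : cell1 X N) :
  fam2 (half_turn (id2 iotab \xx l)) x = Q ((rb (iota \x x))^* \o fam1 l (rho x)) \o r (rho x).
Proof.
rewrite turnE; congr (lw _ _ \o _); rewrite turnE fam2_r -lw_comp.
by rewrite -ucell_nat vcompA z2' vcomp1l.
Qed.

Lemma turn_mulr (l : cell2 iota iota) a :
  turn r0 (a \o (l \xx id2 iotab)) = half_turn (id2 iotab \xx l) \o turn r0 a.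
Proof.
apply: fam2_inj => X x; rewrite fam2M fam2_rot_r !turnE fam2M fam2_l vcompA.
set V := P _ \o fam2 a _.
rewrite [RHS]vcompA -[Q _ \o r _ \o Q _]vcompA ucell_nat vcompA -lw_comp.
rewrite -[_ \o fam1 l _ \o _]vcompA fam1_nat vcompA ucells_nat.
rewrite -[RHS]vcompA ucell_nat [RHS]vcompA -lw_comp; congr (lw _ _ \o _).
by rewrite -[RHS]vcompA fam1_nat !vcompA -[V \o _ \o _]vcompA z1 vcomp1r.
Qed.

Lemma turn_id (X : C) (x : cell1 X N) : fam2 (turn r0 (id2 _)) x = r x \o (r x)^*.
Proof. by rewrite turnE fam2_1 vcomp1r ucell_nat. Qed.

(** The vector b r bends to an endomorphism of iota, which gives it back by the conjugacy
    equations. *)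
Lemma fam2_ucell b : exists l : cell2 iota iota, forall (X : C) (x : cell1 X N),
  fam2 b x \o r x = Q (fam1 l x) \o r x.
Proof.
have [l lE] : exists l : cell2 iota iota, forall (X : C) (x : cell1 X N),
    fam1 l x = (rb (iota \x x))^* \o P (fam2 b x \o r x).
  apply: fam1_exists; apply: tensorial_comp.
    exact: (tensorial_pre iota (tensorial_star (tensorial_ucell rb0))).
  apply: tensorial_lw.
  exact: (tensorial_comp (tensorial_fam2 b) (tensorial_ucell r0)).
exists l => X x; rewrite lE lw_comp -vcompA -ucell_nat vcompA z2 vcomp1l.
by [].
Qed.

Lemma rot_ucell (l : cell2 iota iota) (X : C) (x : cell1 X N) :
  fam2 (half_turn (id2 iotab \xx l)) x \o r x = Q (fam1 l x) \o r x.
Proof.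
rewrite fam2_rot_r -vcompA ucell_nat vcompA -lw_comp -vcompA fam1_nat vcompA.
by rewrite z1 vcomp1l.
Qed.

Lemma fam2_ucellb a : exists l : cell2 iota iota, forall (X : C) (y : cell1 X M),
  fam2 a y \o rb y = fam1 l (iotab \x y) \o rb y.
Proof.
have [l lE] : exists l : cell2 iota iota, forall (X : C) (x : cell1 X N),
    fam1 l x = P ((r x)^*) \o (fam2 a (iota \x x) \o rb (iota \x x)).
  apply: fam1_exists; apply: tensorial_comp.
    exact: (tensorial_lw _ (tensorial_star (tensorial_ucell r0))).
  exact: (tensorial_comp (tensorial_pre iota (tensorial_fam2 a))
    (tensorial_pre iota (tensorial_ucell rb0))).
exists l => X y; rewrite lE -!vcompA ucell_nat [fam2 a (iota \x _) \o _]vcompA fam2_nat.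
by rewrite !vcompA -lw_comp z1' lw_id vcomp1l.
Qed.

(** The left action of End (iota x iotab) on End (iotab x iota) that closes the
    composite of the two, one strand apart, on the right by a cap. *)
Lemma act_exists a b : exists c : cell2 (iotab \x iota) (iotab \x iota),
  forall (X : C) (x : cell1 X N), fam2 c x =
  Q (P ((r x)^*)) \o (Q (fam2 a (iota \x x)) \o (fam2 b (rho x) \o Q (rb (iota \x x)))).
Proof.
apply: fam2_exists; apply: tensorial_comp.
  exact: (tensorial_lw _ (tensorial_lw _ (tensorial_star (tensorial_ucell r0)))).
apply: tensorial_comp.
  exact: (tensorial_lw _ (tensorial_pre _ (tensorial_fam2 a))).
apply: tensorial_comp.
  exact: (tensorial_pre iota (tensorial_pre iotab (tensorial_fam2 b))).
exact: (tensorial_lw _ (tensorial_pre _ (tensorial_ucell rb0))).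
Qed.

Definition act a b := projT1 (cid (act_exists a b)).

Lemma actE a b (X : C) (x : cell1 X N) : fam2 (act a b) x =
  Q (P ((r x)^*)) \o (Q (fam2 a (iota \x x)) \o (fam2 b (rho x) \o Q (rb (iota \x x)))).
Proof. exact: (projT2 (cid (act_exists a b))). Qed.

(** The action is defined so that (act a b), capped off, is a times b, capped off. *)
Lemma act_cap a b (X : C) (y : cell1 X M) :
  fam2 (act a b) (iotab \x y) \o Q (rb y) = Q (fam2 a y) \o (fam2 b (iotab \x y) \o Q (rb y)).
Proof.
rewrite actE -!vcompA -!lw_comp ucell_nat [in X in fam2 b _ \o X]lw_comp.
rewrite [fam2 b _ \o _]vcompA fam2_nat -!vcompA [Q (fam2 a _) \o _]vcompA -lw_comp.
rewrite fam2_nat lw_comp -!vcompA vcompA -!lw_comp z1' !lw_id vcomp1l.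
by [].
Qed.

(** Closing the composite of [a] and [b], one strand apart, on both sides leaves an
    endomorphism of iotab, whose mate in End iota this is. *)
Lemma mate_exists a b : exists m : cell2 iota iota, forall (X : C) (x : cell1 X N),
  fam1 m x = (rb (iota \x x))^* \o P ((r (rho x))^* \o (Q (fam2 a (iota \x x)) \o
     (fam2 b (rho x) \o Q (rb (iota \x x)))) \o r x).
Proof.
have tr := tensorial_ucell r0; have trb := tensorial_ucell rb0.
apply: fam1_exists; apply: tensorial_comp.
  exact: (tensorial_pre iota (tensorial_star trb)).
apply: tensorial_lw; apply: tensorial_comp; last exact: tr.
apply: tensorial_comp.
  exact: (tensorial_pre iota (tensorial_pre iotab (tensorial_star tr))).
apply: tensorial_comp.
  exact: (tensorial_lw _ (tensorial_pre _ (tensorial_fam2 a))).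
apply: tensorial_comp.
  exact: (tensorial_pre iota (tensorial_pre iotab (tensorial_fam2 b))).
exact: (tensorial_lw _ (tensorial_pre _ trb)).
Qed.

Definition mate a b := projT1 (cid (mate_exists a b)).

Lemma mateE a b (X : C) (x : cell1 X N) :
  fam1 (mate a b) x = (rb (iota \x x))^* \o P ((r (rho x))^* \o (Q (fam2 a (iota \x x)) \o
     (fam2 b (rho x) \o Q (rb (iota \x x)))) \o r x).
Proof. exact: (projT2 (cid (mate_exists a b))). Qed.

Lemma closure_nat a b (X : C) (y y' : cell1 X M) (s : cell2 y y') :
  (r (iotab \x y'))^* \o (Q (fam2 a y') \o (fam2 b (iotab \x y') \o Q (rb y'))) \o Q s =
  Q s \o ((r (iotab \x y))^* \o (Q (fam2 a y) \o (fam2 b (iotab \x y) \o Q (rb y)))).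
Proof.
rewrite -!vcompA -lw_comp ucell_nat lw_comp [fam2 b _ \o _]vcompA fam2_nat.
rewrite -!vcompA [Q (fam2 a _) \o _]vcompA -lw_comp fam2_nat lw_comp -!vcompA.
by rewrite vcompA ucells_nat -vcompA.
Qed.

Lemma rot_mate a b (X : C) (x : cell1 X N) :
  fam2 (half_turn (id2 iotab \xx mate a b)) x =
  (r (rho x))^* \o (Q (fam2 a (iota \x x)) \o (fam2 b (rho x) \o Q (rb (iota \x x)))).
Proof.
rewrite fam2_rot_r mateE.
set n := RHS; set n' := (r _)^* \o (_ \o (_ \o _)).
have nat_n : Q ((rb (iota \x x))^*) \o n' = n \o Q ((rb (iota \x x))^*).
  exact/esym/closure_nat.
clearbody n n'.
rewrite vcompA -ucells_nat -vcompA -lw_comp lw_comp -vcompA -ucell_nat !vcompA.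
by rewrite z2 vcomp1l nat_n -vcompA z2 vcomp1r.
Qed.

Lemma mate_ucell a b (X : C) (x : cell1 X N) :
  Q (fam1 (mate a b) x) \o r x =
  (r (rho x))^* \o (Q (fam2 a (iota \x x)) \o (fam2 b (rho x) \o w x)).
Proof. by rewrite -rot_ucell rot_mate wcell.unlock -!vcompA. Qed.

(** Closing b on both sides can be done in either order: this links the mate l of one
    partial closure of b to the mate l' of the other. *)
Lemma closure_link b : exists l l' : cell2 iota iota,
  [/\ forall (X : C) (x : cell1 X N),
        (r x)^* \o Q (fam1 l x) \o r x = (w x)^* \o fam2 b (rho x) \o w x,
      forall (X : C) (x : cell1 X N),
        (r x)^* \o Q (fam1 l' x) \o r x = (w x)^* \o Q (P (fam2 b x)) \o w x &
      forall (X : C) (y : cell1 X M),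
        (rb y)^* \o fam1 l (iotab \x y) \o rb y = (rb y)^* \o fam1 l' (iotab \x y) \o rb y].
Proof.
have tr := tensorial_ucell r0; have trb := tensorial_ucell rb0.
pose y1 (X : C) (y : cell1 X M) := Q ((rb y)^*) \o (fam2 b (iotab \x y) \o Q (rb y)).
have ty1 : tensorial y1.
  apply: tensorial_comp; first exact: (tensorial_lw _ (tensorial_star trb)).
  apply: tensorial_comp; first exact: (tensorial_pre iotab (tensorial_fam2 b)).
  exact: (tensorial_lw _ trb).
have y1_nat (X : C) (y y' : cell1 X M) (s : cell2 y y') : y1 _ y' \o Q s = Q s \o y1 _ y.
  rewrite /y1 -!vcompA -lw_comp ucell_nat lw_comp [fam2 b _ \o _]vcompA fam2_nat.
  by rewrite -!vcompA vcompA -lw_comp ucells_nat lw_comp -vcompA.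
have y1E X (y : cell1 X M) : y1 X y = Q ((rb y)^*) \o (fam2 b (iotab \x y) \o Q (rb y)).
  by [].
clearbody y1.
have [l lE] : exists l : cell2 iota iota, forall (X : C) (x : cell1 X N),
    fam1 l x = P ((r x)^*) \o (P (y1 _ (iota \x x)) \o rb (iota \x x)).
  apply: fam1_exists; apply: tensorial_comp.
    exact: (tensorial_lw _ (tensorial_star tr)).
  apply: tensorial_comp; last exact: (tensorial_pre _ trb).
  exact: (tensorial_lw _ (tensorial_pre _ ty1)).
have [l' l'E] : exists l : cell2 iota iota, forall (X : C) (x : cell1 X N),
    fam1 l x = (rb (iota \x x))^* \o (P (fam2 b x) \o rb (iota \x x)).
  apply: fam1_exists; apply: tensorial_comp.
    exact: (tensorial_pre _ (tensorial_star trb)).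
  apply: tensorial_comp; last exact: (tensorial_pre _ trb).
  exact: (tensorial_lw _ (tensorial_fam2 b)).
exists l, l'; split=> X x.
- rewrite lE !lw_comp !vcompA ucells_nat -[_ \o _ \o Q (P (y1 _ _))]vcompA ucells_nat.
  rewrite !vcompA -[_ \o _ \o Q (rb _)]vcompA z1' vcomp1r.
  by rewrite wcells wcell.unlock y1E -!vcompA.
- by rewrite l'E !lw_comp wcells wcell.unlock -!vcompA.
- have -> : (rb x)^* \o fam1 l (iotab \x x) \o rb x = (rb x)^* \o (P (y1 _ x) \o rb x).
    rewrite -vcompA; congr (_ \o _); rewrite lE -!vcompA ucell_nat.
    rewrite [P (y1 _ _) \o _]vcompA -lw_comp y1_nat lw_comp !vcompA -lw_comp.
    by rewrite z1' lw_id vcomp1l.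
  rewrite y1E l'E !lw_comp !vcompA ucells_nat -!vcompA; congr (_ \o (_ \o (_ \o _))).
  by rewrite ucell_nat.
Qed.
End HalfTurns.

(** * Depth two, and twisted conjugacy equations *)

Section Depth2.
Variables (R : realType) (C : cstar_two_cat R).
Variables (N M : C) (iota : cell1 N M) (iotab : cell1 M N).
Variables (r0 : cell2 (unit1 N) (iotab \x iota)) (rb0 : cell2 (unit1 M) (iota \x iotab)).
Hypothesis cp : conj_pair r0 rb0.

Local Notation P := (lw iota).
Local Notation Q := (lw iotab).
Local Notation r := (ucell r0).
Local Notation rb := (ucell rb0).
Local Notation rho x := (iotab \x (iota \x x)).
Local Notation w := (wcell r0 rb0).

Let pc := conj_pair_sym cp.

Lemma vcomp_sumr (S T : C) (a b c : cell1 S T) I (s : seq I) (F : I -> cell2 a b)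
    (t : cell2 b c) : t \o (\sum_(i <- s) F i)%R = (\sum_(i <- s) (t \o F i)%cell)%R.
Proof. exact: (bil_sumr vcomp_bil). Qed.

Lemma vcomp_suml (S T : C) (a b c : cell1 S T) I (s : seq I) (F : I -> cell2 b c)
    (t : cell2 a b) : (\sum_(i <- s) F i)%R \o t = (\sum_(i <- s) (F i \o t)%cell)%R.
Proof. exact: (bil_suml vcomp_bil). Qed.

Definition fam3 (V : cell2 iota (iota \x iotab \x iota)) (X : C) (x : cell1 X N) :
    cell2 (iota \x x) (iota \x (iotab \x (iota \x x))) :=
  @fam R C N M (w1 iota) (w3 iota iotab iota) V X x.

Lemma fam3_nat V (X : C) (x y : cell1 X N) (s : cell2 x y) :
  fam3 V y \o P s = P (Q (P s)) \o fam3 V x.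
Proof. exact: (@fam_nat R C N M (w1 iota) (w3 iota iotab iota) V). Qed.

Lemma tensorial_fam3 V : tensorial (fam3 V).
Proof. exact: (@tensorial_fam R C N M (w1 iota) (w3 iota iotab iota) V). Qed.

Lemma fam3_sum n (V : 'I_n -> cell2 iota (iota \x iotab \x iota)) (X : C) (x : cell1 X N) :
  (\sum_(i < n) (V i \o (V i)^*)%cell)%R = id2 (iota \x iotab \x iota) ->
  (\sum_(i < n) (fam3 (V i) x \o (fam3 (V i) x)^*)%cell)%R = id2 _.
Proof.
move=> h.
have <- := @fam_id R C N M (w3 iota iotab iota) X x.
have := fun_sum (@fam_lin R C N M (w3 iota iotab iota) (w3 iota iotab iota) X x).
move=> /(_ _ (index_enum _) predT (fun i : 'I_n => (V i \o (V i)^*)%cell)); rewrite h => ->.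
apply: eq_bigr => i _.
rewrite (@fam_comp R C N M (w3 iota iotab iota) (w1 iota) (w3 iota iotab iota)).
by rewrite (@fam_star R C N M (w1 iota) (w3 iota iotab iota)).
Qed.

(** Transposing the decomposition of the identity of iota x iotab x iota by the
    half turn decomposes the other triple product. *)
Lemma depth2_turned n (V : 'I_n -> cell2 iota (iota \x iotab \x iota)) :
  (\sum_(i < n) (V i \o (V i)^*)%cell)%R = id2 (iota \x iotab \x iota) ->
  exists (a : 'I_n -> cell2 (iota \x iotab) (iota \x iotab))
    (b : 'I_n -> cell2 (iotab \x iota) (iotab \x iota)),
  forall (X : C) (x : cell1 X N),
    (\sum_(i < n) (fam2 (b i) x \o ((r (rho x))^* \o Q (fam2 (a i) (iota \x x))))%cell)%R
    = Q (P ((r x)^*)).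
Proof.
move=> hV; have tr := tensorial_ucell r0; have trb := tensorial_ucell rb0.
have aE (i : 'I_n) : exists a : cell2 (iota \x iotab) (iota \x iotab),
    forall (X : C) (y : cell1 X M), fam2 a y =
    (rb (iota \x (iotab \x y)))^* \o (P ((r (iotab \x (iota \x (iotab \x y))))^*) \o
      P (Q (fam3 (V i) (iotab \x y) \o rb y))).
  apply: fam2_exists; apply: tensorial_comp.
    exact: (tensorial_pre iotab (tensorial_pre iota (tensorial_star trb))).
  apply: tensorial_comp.
    apply: tensorial_lw.
    exact: (tensorial_pre iotab (tensorial_pre iota (tensorial_pre iotab (tensorial_star tr)))).
  apply: tensorial_lw; apply: tensorial_lw.
  exact: (tensorial_comp (tensorial_pre iotab (tensorial_fam3 (V i))) trb).
have bE (i : 'I_n) : exists b : cell2 (iotab \x iota) (iotab \x iota),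
    forall (X : C) (x : cell1 X N), fam2 b x =
    (r (rho x))^* \o (Q ((fam3 (V i) (rho x))^*) \o Q (P (w x))).
  apply: fam2_exists; apply: tensorial_comp.
    exact: (tensorial_pre iota (tensorial_pre iotab (tensorial_star tr))).
  apply: tensorial_comp.
    apply: tensorial_lw.
    exact: (tensorial_pre iota (tensorial_pre iotab (tensorial_star (tensorial_fam3 (V i))))).
  do 2 apply: tensorial_lw; rewrite wcell.unlock.
  exact: (tensorial_comp (tensorial_lw _ (tensorial_pre _ trb)) tr).
exists (fun i => projT1 (cid (aE i))), (fun i => projT1 (cid (bE i))) => X x.
have hx := fam3_sum (rho x) hV.
transitivity ((w (rho x))^* \o (Q (P ((r (rho (rho x)))^*)) \o Q (P (Q (
   (\sum_(i < n) (fam3 (V i) (rho x) \o (fam3 (V i) (rho x))^*)%cell)%R \o P (w x)))))).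
  rewrite vcomp_suml !(fun_sum lw_lin) !vcomp_sumr.
  apply: eq_bigr => i _.
  case: (cid (aE i)) => a {}aE; case: (cid (bE i)) => b {}bE /=.
  have key : fam3 (V i) (rho x) \o (fam3 (V i) (rho x))^* \o P (w x) =
      P (Q (P (fam2 b x))) \o (fam3 (V i) (rho x) \o rb (iota \x x)).
    rewrite vcompA -fam3_nat -!vcompA; congr (_ \o _).
    by rewrite bE -lw_comp lw_comp -vcompA -ucell_nat vcompA pc.2 vcomp1l.
  rewrite key aE (lw_comp iotab) [(r _)^* \o _]vcompA -wcells vcompA -wcells_nat.
  rewrite -vcompA -lw_comp [P _ \o (P _ \o _)]vcompA -lw_comp -ucells_nat lw_comp.
  by rewrite -!lw_comp -vcompA -lw_comp.
rewrite hx vcomp1l -!lw_comp ucells_nat !lw_comp vcompA (wcell_z1 cp) vcomp1l.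
by [].
Qed.
End Depth2.

Lemma ucell_comp (R : realType) (C : cstar_two_cat R) (N M : C) (iota : cell1 N M)
    (iotab : cell1 M N) (r0 : cell2 (unit1 N) (iotab \x iota)) t (X : C) (x : cell1 X N) :
  ucell (t \o r0) x = fam2 t x \o ucell r0 x.
Proof. exact: (@fam_comp R C N N (w0 N) (w2 iotab iota) (w2 iotab iota)). Qed.

Section ChangeOfPair.
Variables (R : realType) (C : cstar_two_cat R).
Variables (N M : C) (iota : cell1 N M) (iotab : cell1 M N).

(** A twist of r0 by an invertible self-adjoint element is undone by its inverse in rb0. *)
Lemma conj_pair_change (r0 : cell2 (unit1 N) (iotab \x iota))
    (rb0 : cell2 (unit1 M) (iota \x iotab)) (d d' : cell2 iota iota) :
  conj_pair r0 rb0 -> d^* = d -> d'^* = d' -> d \o d' = id2 iota -> d' \o d = id2 iota ->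
  conj_pair ((id2 iotab \xx d) \o r0) ((d' \xx id2 iotab) \o rb0).
Proof.
move=> [z1 z2] ds ds' dd' d'd; split=> X x.
  rewrite !ucell_comp star_vcomp -!fam2_star star_hcomp star_id ds' fam2_l fam2_r.
  rewrite -vcompA fam1_nat lw_comp !vcompA ucells_nat -[_ \o _ \o lw _ _]vcompA z1.
  by rewrite vcomp1r -fam1M dd' fam1_1.
rewrite !ucell_comp star_vcomp -!fam2_star star_hcomp star_id ds' fam2_l fam2_r.
by rewrite vcompA -lw_comp -[_ \o fam1 d' _ \o _]vcompA -fam1M d'd fam1_1 vcomp1r z2.
Qed.
End ChangeOfPair.

(** Whiskering the conjugacy equations by x, and removing the associators. *)
Lemma conj_pair_of_equations (R : realType) (C : cstar_two_cat R) (N M : C)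
    (iota : cell1 N M) (iotab : cell1 M N)
    (Rbar : cell2 (unit1 M) (iota \x iotab)) (R0 : cell2 (unit1 N) (iotab \x iota)) :
  conjugacy_equations Rbar R0 -> conj_pair R0 Rbar.
Proof.
have hu (N' M' : C) (i : cell1 N' M') (ib : cell1 M' N')
    (t : cell2 (unit1 N') (ib \x i)) (X : C) (x : cell1 X N') :
    hq (ucell t x) (t \xx id2 x) by exact: (@hq_famE R C N' N' (w0 N') (w2 ib i)).
have hus (N' M' : C) (i : cell1 N' M') (ib : cell1 M' N')
    (t : cell2 (unit1 N') (ib \x i)) (X : C) (x : cell1 X N') :
    hq ((ucell t x)^*) (t^* \xx id2 x).
  by apply: hq_trans (hq_star (hu _ _ _ _ t X x)) _; rewrite star_hcomp star_id; apply: hq_refl.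
have split2 (S T X : C) (a b c : cell1 S T) (s : cell2 b c) (t : cell2 a b) (x : cell1 X S) :
    (s \o t) \xx id2 x = (s \xx id2 x) \o (t \xx id2 x).
  by rewrite -Defs.interchange vcomp1l.
case; rewrite -!vcompA [_ \o ((_ \xx _) \o _)]vcompA => e1.
rewrite [_ \o ((_ \xx _) \o _)]vcompA => e2; split=> X x; apply: hq_eq.
- rewrite -hcomp_id2 -e1 split2.
  apply: hq_vcomp.
    apply: hq_trans (hus _ _ _ _ _ _ _) _; rewrite -hcomp_id2.
    apply: hq_trans (hq_A _ _ _) (hq_hcomp (hq_sym (hq_eq2l _ _)) (hq_refl _)).
  apply: hq_trans (hq_lw _ (hu _ _ _ _ _ _ _)) _; apply: hq_trans (hq_A _ _ _) _.
  apply: hq_hcomp (hq_refl _); apply: hq_sym.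
  exact: hq_trans (hq_eq2l _ _) (hq_eq2r _ _).
- rewrite -hcomp_id2 -e2 split2.
  apply: hq_vcomp.
    apply: hq_trans (hq_lw _ (hus _ _ _ _ _ _ _)) _; apply: hq_trans (hq_A _ _ _) _.
    exact: (hq_hcomp (hq_sym (hq_eq2l _ _)) (hq_refl _)).
  apply: hq_trans (hu _ _ _ _ _ _ _) _; rewrite -hcomp_id2.
  apply: hq_trans (hq_A _ _ _) (hq_hcomp _ (hq_refl _)); apply: hq_sym.
  exact: hq_trans (hq_eq2l _ _) (hq_eq2r _ _).
Qed.

(** * Inner products on spaces of 2-cells *)

Section EndUnit.
Variables (R : realType) (C : cstar_two_cat R) (N : C).
Notation K := R[i].

Lemma end_unit_comm (s t : cell2 (unit1 N) (unit1 N)) : s \o t = t \o s.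
Proof.
apply: hq_eq; apply: (@hq_trans _ _ _ _ _ _ _ _ _ _ _ (s \xx t)).
  apply: hq_trans (hq_vcomp (hq_sym (hq_1r s)) (hq_sym (hq_1l t))) _.
  by rewrite -Defs.interchange vcomp1r vcomp1l; apply: hq_refl.
apply: hq_sym; apply: hq_trans (hq_vcomp (hq_sym (hq_1l t)) (hq_sym (hq_1r s))) _.
by rewrite -Defs.interchange vcomp1r vcomp1l; apply: hq_refl.
Qed.

(** A faithful positive functional on End (unit). The last clause, y^* y <= phi (y^* y),
    compares it with the order of the algebra in a form that composition preserves. *)
Record end_state (phi : cell2 (unit1 N) (unit1 N) -> K) : Prop := EndState {
  es_lin : linear (phi : _ -> K^o);
  es_pos : forall y : cell2 (unit1 N) (unit1 N), y <> 0%R -> (0 < phi (y^* \o y)%cell)%R;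
  es_star : forall x : cell2 (unit1 N) (unit1 N), phi (x^*) = ((phi x)^*)%R;
  es_dom : forall y : cell2 (unit1 N) (unit1 N), exists s : cell2 (unit1 N) (unit1 N),
    (phi (y^* \o y)%cell *: id2 (unit1 N) - (y^* \o y)%cell)%R = s^* \o s
}.

(** End (unit) is commutative, so its regular trace will do. *)
Lemma end_state_exists : finite_dimensional (End2 (unit1 N)) -> exists phi, end_state phi.
Proof.
move=> fd; have [phi [h1 h2 h3 h4]] := comm_trace fd (@end_unit_comm).
by exists phi; split.
Qed.
End EndUnit.

Section Forms.
Variables (R : realType) (C : cstar_two_cat R) (N : C).
Notation K := R[i].
Local Notation u := (unit1 N).
Variables (phi : cell2 u u -> K) (es : end_state phi).

Lemma vstar_eq0 (S T : C) (a b : cell1 S T) (t : cell2 a b) : t^* \o t = 0%R -> t = 0%R.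
Proof.
move=> h; have := norm_star_vcomp t; rewrite h normr0 => /esym/eqP.
by rewrite expf_eq0 /= normr_eq0 => /eqP.
Qed.

Variable x : cell1 N N.
Implicit Types s t : cell2 u x.

Definition ip s t := phi (s^* \o t).

Lemma ip_lin s : linear (ip s : _ -> K^o).
Proof. by move=> k t t'; rewrite /ip vcomp_bil.2 (es_lin es). Qed.

Lemma ip_conj s t : ip s t = ((ip t s)^*)%R.
Proof. by rewrite /ip -(es_star es) star_vcomp starK. Qed.

Lemma ip_ge0 s : (0 <= ip s s)%R.
Proof.
rewrite /ip; have [v ->] := star_vcomp_pos s.
have [->|/eqP v0] := eqVneq v 0%R; last exact/ltW/(es_pos es).
by rewrite (bil0r vcomp_bil) (fun0 (es_lin es)).
Qed.

Lemma ip_eq0 s : ip s s = 0%R -> s = 0%R.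
Proof.
rewrite /ip; have [v h] := star_vcomp_pos s; rewrite h => e; apply: vstar_eq0; rewrite h.
have [->|/eqP /(es_pos es)] := eqVneq v 0%R; first by rewrite (bil0r vcomp_bil).
by rewrite e ltxx.
Qed.

Lemma ip_gt0 s : s <> 0%R -> (0 < ip s s)%R.
Proof.
move=> s0; rewrite lt_def ip_ge0 andbT; apply/eqP => /ip_eq0; exact: s0.
Qed.
End Forms.

Section FiniteEnd.
Variables (R : realType) (C : cstar_two_cat R).
Notation K := R[i].
Variables (N M : C) (iota : cell1 N M) (iotab : cell1 M N).
Variables (r0 : cell2 (unit1 N) (iotab \x iota)) (rb0 : cell2 (unit1 M) (iota \x iotab)).
Hypothesis cp : conj_pair r0 rb0.
Local Notation u := (unit1 N).
Variables (phi : cell2 u u -> K) (es : end_state phi).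

Local Notation P := (lw iota).
Local Notation Q := (lw iotab).
Local Notation r := (ucell r0).
Local Notation rb := (ucell rb0).
Local Notation rho x := (iotab \x (iota \x x)).
Local Notation w := (wcell r0 rb0).
Let pc := conj_pair_sym cp.
Local Notation ip := (ip phi).

Lemma vcomp_starN (S T : C) (a b : cell1 S T) (s t : cell2 a b) :
  ((s - t)%R)^* = (s^*%cell - t^*%cell)%R.
Proof.
have := star_antilinear (-1)%R t s; rewrite scaleN1r addrC => ->.
by rewrite rmorphN rmorph1 scaleN1r addrC.
Qed.

Lemma vcomp_star0 (S T : C) (a b : cell1 S T) : (0 : cell2 a b)%R^* = 0%R.
Proof. by have := vcomp_starN (0 : cell2 a b)%R 0%R; rewrite !subrr. Qed.

Lemma vcomp_starZ (S T : C) (a b : cell1 S T) (k : K) (s : cell2 a b) :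
  ((k *: s)%R)^* = (k^* *: s^*%cell)%R.
Proof.
by have := star_antilinear k s 0%R; rewrite vcomp_star0 !addr0.
Qed.

(** Bessel's inequality for vectors f_i of Hom (unit, rho unit) that are orthogonal
    over End (unit), cut by the vector w. *)
Lemma bessel n (f : 'I_n -> cell2 u (rho u)) (c : K) : (0 < c)%R ->
  (forall i j, i != j -> (f i)^* \o f j = 0%R) ->
  (forall i, phi ((f i)^* \o f i) = c) ->
  (\sum_(i < n) ip (Q (P ((f i)^*)) \o w u)%cell (Q (P ((f i)^*)) \o w u)%cell <= c * ip (w u) (w u))%R.
Proof.
move=> c0 ort fc.
have cr : (c^*)%R = c by apply: conj_Creal; apply: ger0_real; exact: ltW.
pose T := (\sum_(i < n) (f i \o (f i)^*)%cell)%R.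
have Ts : T^* = T.
  rewrite /T; elim/big_ind: _ => [|s t hs ht|i _].
  - exact: vcomp_star0.
  - by have := star_antilinear 1%R s t; rewrite !scale1r rmorph1 scale1r hs ht.
  - by rewrite star_vcomp starK.
have fT i : T \o f i = f i \o ((f i)^* \o f i).
  rewrite /T (bil_suml vcomp_bil) (bigD1 i)//= big1 ?addr0 ?vcompA// => j ji.
  by rewrite -vcompA ort// (bil0r vcomp_bil).
have [s sE] : exists s : 'I_n -> cell2 u u, forall i,
    (c *: id2 u - ((f i)^* \o f i)%cell)%R = (s i)^* \o s i.
  have h i : exists s : cell2 u u, (c *: id2 u - ((f i)^* \o f i)%cell)%R = s^* \o s.
    have [v vE] := star_vcomp_pos (f i).
    have [s hs] := es_dom es v; exists s; rewrite -hs -vE fc.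
    by [].
  by exists (fun i => projT1 (cid (h i))) => i; apply: (projT2 (cid (h i))).
(* c (c - T) = (c - T)^2 + (cT - T^2), and cT - T^2 is a sum of squares *)
have key : (c *: (c *: id2 (rho u) - T))%R =
   (((c *: id2 (rho u) - T)%R^* \o (c *: id2 (rho u) - T)%R)%cell +
     \sum_(i < n) ((s i \o (f i)^*)^* \o (s i \o (f i)^*))%cell)%R.
  have -> : (\sum_(i < n) ((s i \o (f i)^*)^* \o (s i \o (f i)^*))%cell)%R
      = (c *: T - (T \o T)%cell)%R.
    transitivity (\sum_(i < n) (f i \o (c *: id2 u - ((f i)^* \o f i)%cell)%R \o (f i)^*)%cell)%R.
      by apply: eq_bigr => i _; rewrite sE star_vcomp starK !vcompA.
    rewrite {1}/T scaler_sumr {2}/T (bil_sumr vcomp_bil) -sumrB.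
    apply: eq_bigr => i _; rewrite (bilBr vcomp_bil) (bilBl vcomp_bil).
    by rewrite (bilZr vcomp_bil) (bilZl vcomp_bil) vcomp1r [T \o _]vcompA fT.
  rewrite vcomp_starN Ts vcomp_starZ star_id cr.
  rewrite !(bilBl vcomp_bil) !(bilBr vcomp_bil).
  rewrite !(bilZl vcomp_bil) !(bilZr vcomp_bil) !vcomp1l !vcomp1r.
  rewrite scalerBr; move: (c *: T)%R (c *: _)%R (T \o T) => a b d.
  by rewrite subrK.
have dist : c * ip (w u) (w u) - \sum_(i < n) ip (Q (P ((f i)^*)) \o w u)%cell (Q (P ((f i)^*)) \o w u)%cell
    = phi ((w u)^* \o (Q (P (c *: id2 (rho u) - T)%R) \o w u))%cell.
  rewrite !(funB lw_lin) !(funZ lw_lin) !lw_id.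
  rewrite (bilBl vcomp_bil) (bilBr vcomp_bil) (bilZl vcomp_bil).
  rewrite (bilZr vcomp_bil) vcomp1l (funB (es_lin es)) (funZ (es_lin es)).
  congr (_ - _); rewrite /T !(fun_sum lw_lin).
  rewrite (bil_suml vcomp_bil) (bil_sumr vcomp_bil) (fun_sum (es_lin es)).
  apply: eq_bigr => i _; congr phi.
  by rewrite star_vcomp !lw_star starK !lw_comp -!vcompA.
suff : (0 <= c * phi ((w u)^* \o (Q (P (c *: id2 (rho u) - T)%R) \o w u))%cell)%R.
  by rewrite pmulr_rge0// -dist subr_ge0.
rewrite -[(c * _)%R]/(c *: (_ : K^o))%R -(funZ (es_lin es)) -(bilZr vcomp_bil).
rewrite -(bilZl vcomp_bil) -!(funZ lw_lin) key.
rewrite !(funD lw_lin) (bilDl vcomp_bil) (bilDr vcomp_bil).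
rewrite (funD (es_lin es)) !(fun_sum lw_lin) (bil_suml vcomp_bil).
rewrite (bil_sumr vcomp_bil) (fun_sum (es_lin es)).
have pos S (z : cell2 (rho u) S) :
    (0 <= phi ((w u)^* \o (Q (P (z^* \o z)) \o w u))%cell)%R.
  rewrite !lw_comp -!lw_star -vcompA vcompA -star_vcomp.
  exact: (ip_ge0 es).
by apply: addr_ge0; [exact: pos | apply: sumr_ge0 => i _; exact: pos].
Qed.

Lemma ucell_slide (z : cell2 (iota \x u) (iota \x u)) :
  Q z \o r u = Q (P ((Q (z^*) \o r u)^*)) \o w u.
Proof.
rewrite star_vcomp lw_star starK !lw_comp wcell.unlock vcompA.
rewrite -[_ \o Q (P (Q z)) \o _]vcompA -!(lw_comp iotab) -ucell_nat vcompA.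
by rewrite pc.2 vcomp1l.
Qed.

Lemma ucell_mate (z : cell2 u (rho u)) : Q ((rb (iota \x u))^* \o P z) \o r u = z.
Proof. by rewrite lw_comp -vcompA -ucell_nat vcompA cp.2 vcomp1l. Qed.

(** By [bessel] the squared norms of the vectors f_i^* w sum to at most (w, w); by the same
    inequality for each of these vectors, whose partner is f_i, each squared norm is at
    least 1 / (w, w). *)
Lemma orthogonal_bound n (f : 'I_n -> cell2 u (rho u)) :
  (forall i j, i != j -> (f i)^* \o f j = 0%R) -> (forall i, phi ((f i)^* \o f i) = 1%R) ->
  (n%:R <= (ip (w u) (w u)) ^+ 2)%R.
Proof.
move=> ort f1; set W := ip (w u) (w u).
have W0 : (0 <= W)%R by exact: (ip_ge0 es).
have h1 := bessel ltr01 ort f1; rewrite mul1r -/W in h1.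
have low i : (1 <= ip (Q (P ((f i)^*)) \o w u)%cell (Q (P ((f i)^*)) \o w u)%cell * W)%R.
  set g := Q (P ((f i)^*)) \o w u.
  pose z := (rb (iota \x u))^* \o P (f i).
  have fz : f i = Q z \o r u by rewrite ucell_mate.
  have gz : g = Q (z^*) \o r u by rewrite /g fz -[z]starK -ucell_slide starK.
  have fg : f i = Q (P (g^*)) \o w u by rewrite gz -ucell_slide.
  have g0 : (0 < ip g g)%R.
    apply: (ip_gt0 es) => g0; have := f1 i; rewrite fg g0.
    rewrite vcomp_star0 !(fun0 lw_lin) (bil0l vcomp_bil).
    rewrite (bil0r vcomp_bil) (fun0 (es_lin es)) => /esym/eqP.
    by rewrite oner_eq0.
  have := @bessel 1 (fun=> g) (ip g g) g0; rewrite big_ord1 -fg /ip f1; apply=> //.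
  by move=> a b; rewrite [a]ord1 [b]ord1 eqxx.
rewrite expr2; apply: (@le_trans _ _ ((\sum_(i < n) ip (Q (P ((f i)^*)) \o w u)%cell
   (Q (P ((f i)^*)) \o w u)%cell) * W)%R); last exact: ler_wpM2r.
rewrite mulr_suml; apply: (@le_trans _ _ (\sum_(i < n) 1)%R).
  by rewrite sumr_const card_ord.
exact: ler_sum.
Qed.
End FiniteEnd.

(** * Finite dimensional endomorphism algebras *)

Lemma nat_bound (R : realType) (c : R[i]) : exists m : nat, forall n : nat,
  (n%:R <= c)%R -> (n <= m)%N.
Proof.
case: c => a b; exists (Num.bound `|a|%R) => n; rewrite -(rmorph_nat (real_complex R)).
rewrite lecE /= => /andP[_ na].
have := archi_boundP (normr_ge0 a) => h.
have : (n%:R < (Num.bound `|a|%R)%:R :> R)%R.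
  by apply: le_lt_trans h; apply: le_trans na _; apply: ler_norm.
by rewrite ltr_nat => /ltnW.
Qed.

Section FiniteDimension.
Variables (R : realType) (C : cstar_two_cat R).
Notation K := R[i].
Variables (N M : C) (iota : cell1 N M) (iotab : cell1 M N).
Variables (r0 : cell2 (unit1 N) (iotab \x iota)) (rb0 : cell2 (unit1 M) (iota \x iotab)).
Hypothesis cp : conj_pair r0 rb0.
Local Notation u := (unit1 N).
Hypothesis fdN : finite_dimensional (End2 u).

Local Notation P := (lw iota).
Local Notation Q := (lw iotab).
Local Notation r := (ucell r0).
Local Notation rb := (ucell rb0).
Local Notation rho x := (iotab \x (iota \x x)).
Local Notation w := (wcell r0 rb0).

(** A maximal orthonormal system over End (unit) exists by [orthogonal_bound]. The part of
    a vector orthogonal to its End (unit)-span is orthogonal to it over End (unit), so it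
    would enlarge the system if it were not 0. *)
Lemma fd_hom : finite_dimensional (cell2 u (rho u)).
Proof.
have [phi es] := end_state_exists fdN.
pose good n := `[< exists f : 'I_n -> cell2 u (rho u),
  (forall i j, i != j -> (f i)^* \o f j = 0%R) /\
  (forall i, phi ((f i)^* \o f i) = 1%R) >].
have good0 : exists n, good n.
  by exists 0%N; apply/asboolP; exists (fun=> 0%R); split => [[]|[]].
have [m bm] := nat_bound ((ip phi (w u) (w u)) ^+ 2)%R.
have goodm n : good n -> (n <= m)%N.
  by move=> /asboolP[f [f1 f2]]; apply: bm; exact: (orthogonal_bound cp es f1 f2).
case: (ex_maxnP good0 goodm) => n /asboolP[f [ort f1]] nmax.
have [p [z zE]] := fd_basis fdN.
pose e (ij : 'I_n * 'I_p) : cell2 u (rho u) := f ij.1 \o z ij.2.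
apply: (@fd_span _ _ _ e) => h.
have [c hc] := orth_proj (@ip_lin _ _ _ _ es _) (@ip_conj _ _ _ _ es _) (@ip_eq0 _ _ _ _ es _) e h.
exists c; apply/eqP; rewrite -subr_eq0; apply/eqP; set h' := (h - _)%R in hc *.
have of' i : (f i)^* \o h' = 0%R.
  set t := _ \o _; apply: contrapT => /(es_pos es).
  have [d dE] := zE t; rewrite {1}dE.
  suff -> : phi ((\sum_i d i *: z i)%R^* \o t) = 0%R by rewrite ltxx.
  rewrite -[LHS]conjCK -(es_star es) star_vcomp starK (bil_sumr vcomp_bil).
  rewrite (fun_sum (es_lin es)) big1 ?rmorph0// => j _.
  rewrite (bilZr vcomp_bil) (funZ (es_lin es)) -[X in (_ *: X)%R]conjCK.
  rewrite -(es_star es) star_vcomp starK /t vcompA -star_vcomp.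
  by have := hc (i, j); rewrite /ip /e /= => ->; rewrite rmorph0 scaler0.
apply: contrapT => h0; have t0 := ip_gt0 es h0.
have : good n.+1.
  apply/asboolP; pose k := (sqrtC (ip phi h' h'))^-1%R.
  have kr : (k^* = k)%R.
    by apply: conj_Creal; apply: ger0_real; rewrite invr_ge0 sqrtC_ge0; apply: ltW.
  have k1 : phi ((k *: h')%R^* \o (k *: h')%R) = 1%R.
    rewrite vcomp_starZ (bilZl vcomp_bil) (bilZr vcomp_bil) kr.
    rewrite !(funZ (es_lin es)) -[LHS]/(k * (k * ip phi h' h'))%R mulrA -expr2 exprVn.
    by rewrite sqrtCK mulVf// gt_eqF.
  exists (fun i => if unlift ord_max i is Some j then f j else (k *: h')%R).
  split=> [i j|i]; last by case: unliftP.
  case: unliftP => [i' ->|->]; case: unliftP => [j' ->|->] //.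
  - by move=> ij; apply: ort; apply: contraNneq ij => ->.
  - by move=> _; rewrite (bilZr vcomp_bil) of' scaler0.
  - move=> _; rewrite vcomp_starZ (bilZl vcomp_bil) -[h'^* \o _]starK star_vcomp starK.
    by rewrite of' vcomp_star0 scaler0.
  - by rewrite eqxx.
by move=> /nmax; rewrite ltnn.
Qed.

Lemma fd_end1 : finite_dimensional (End2 iota).
Proof.
have [p [z zE]] := fd_basis fd_hom.
apply: (@fd_iso _ (cell2 (iota \x u) (iota \x u)) _
  (fun t => projT1 (cid (fam1_unit_exists t)))).
- move=> k s t; apply: fam1_unit_inj; rewrite (fam1_lin u).
  by case: cid => /= ? ->; case: cid => /= ? ->; case: cid => /= ? ->.
- exists (fun l : End2 iota => fam1 l u) => l /=; first by case: cid.
  by apply: fam1_unit_inj; case: cid.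
apply: (@fd_span _ _ _ (fun i => (rb (iota \x u))^* \o P (z i))) => t.
have [c cE] := zE (Q t \o r u); exists c.
transitivity ((rb (iota \x u))^* \o P (Q t \o r u)).
  by rewrite lw_comp vcompA ucells_nat -vcompA cp.1 vcomp1r.
rewrite cE (fun_sum lw_lin) (bil_sumr vcomp_bil).
by apply: eq_bigr => i _; rewrite (funZ lw_lin) (bilZr vcomp_bil).
Qed.

(** By depth two an endomorphism of iotab x iota is a sum, over the V_i, of terms that
    depend on an element of End iota only. *)
Lemma fd_end2 : depth2 iota iotab -> finite_dimensional (End2 (iotab \x iota)).
Proof.
case=> n [V hV]; have [p [l lE]] := fd_basis fd_end1.
have vE := fam3_sum u hV.
apply: (@fd_iso _ (cell2 (rho u) (rho u)) _
  (fun t => projT1 (cid (fam2_unit_exists t)))).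
- move=> k s t; apply: fam2_unit_inj; rewrite (fam2_lin u).
  by case: cid => /= ? ->; case: cid => /= ? ->; case: cid => /= ? ->.
- exists (fun b : End2 (iotab \x iota) => fam2 b u) => l' /=; first by case: cid.
  by apply: fam2_unit_inj; case: cid.
pose e (ij : 'I_n * 'I_p) := (r (rho u))^* \o Q (fam3 (V ij.1) u \o fam1 (l ij.2) u).
apply: (@fd_span _ _ _ e) => t.
have hl i : exists c : 'I_p -> K, (fam3 (V i) u)^* \o (P t \o rb (iota \x u)) =
    (\sum_j c j *: fam1 (l j) u)%R.
  have [m mE] := fam1_unit_exists ((fam3 (V i) u)^* \o (P t \o rb (iota \x u))).
  have [c cE] := lE m; exists c; rewrite -mE cE (fun_sum (fam1_lin u)).
  by apply: eq_bigr => j _; rewrite (funZ (fam1_lin u)).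
have [c cE] : exists c : 'I_n -> 'I_p -> K, forall i,
    (fam3 (V i) u)^* \o (P t \o rb (iota \x u)) = (\sum_j c i j *: fam1 (l j) u)%R.
  by exists (fun i => projT1 (cid (hl i))) => i; apply: (projT2 (cid (hl i))).
exists (fun ij => c ij.1 ij.2).
transitivity ((r (rho u))^* \o Q (P t \o rb (iota \x u))).
  by rewrite lw_comp vcompA ucells_nat -vcompA (conj_pair_sym cp).1 vcomp1r.
rewrite -[P t \o _]vcomp1l -vE (bil_suml vcomp_bil).
rewrite (fun_sum lw_lin) (bil_sumr vcomp_bil).
rewrite -(pair_bigA _ (fun i j => c i j *: e (i, j))%R)/=.
apply: eq_bigr => i _; rewrite -vcompA cE.
rewrite (bil_sumr vcomp_bil) (fun_sum lw_lin).
rewrite (bil_sumr vcomp_bil); apply: eq_bigr => j _.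
by rewrite (bilZr vcomp_bil) (funZ lw_lin) (bilZr vcomp_bil).
Qed.
End FiniteDimension.

(** * Spherical normalisation *)

Section Normalisation.
Variables (R : realType) (C : cstar_two_cat R).
Notation K := R[i].
Variables (N M : C) (iota : cell1 N M) (iotab : cell1 M N).
Local Notation u := (unit1 N).
Local Notation v := (iota \x u).
Local Notation P := (lw iota).
Local Notation Q := (lw iotab).

Section Closures.
Variables (phi : cell2 u u -> K) (es : end_state phi).

(** The state of End iota obtained by closing on the left with r0, and the one
    obtained by closing first on the right with rb0. *)
Definition tau (r0 : cell2 u (iotab \x iota)) (l : End2 iota) : K :=
  phi ((ucell r0 u)^* \o Q (fam1 l u) \o ucell r0 u).

Definition kappa (r0 : cell2 u (iotab \x iota)) (rb0 : cell2 (unit1 M) (iota \x iotab))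
    (l : End2 iota) : K :=
  phi ((ucell r0 u)^* \o Q ((ucell rb0 v)^* \o fam1 l (iotab \x v) \o ucell rb0 v) \o ucell r0 u).

Lemma tau_lin r0 : linear (tau r0 : End2 iota -> K^o).
Proof.
move=> k s t; rewrite /tau (fam1_lin u) lw_lin.
by rewrite vcomp_bil.2 vcomp_bil.1 (es_lin es).
Qed.

Lemma kappa_lin r0 rb0 : linear (kappa r0 rb0 : End2 iota -> K^o).
Proof.
move=> k s t; rewrite /kappa (fam1_lin _) vcomp_bil.2 vcomp_bil.1.
by rewrite lw_lin vcomp_bil.2 vcomp_bil.1 (es_lin es).
Qed.

Lemma tau_star r0 l : tau r0 (adj l) = ((tau r0 l)^*)%R.
Proof.
rewrite /tau -(es_star es); congr phi.
by rewrite !star_vcomp starK lw_star -fam1_star vcompA.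
Qed.

Lemma kappa_star r0 rb0 l : kappa r0 rb0 (adj l) = ((kappa r0 rb0 l)^*)%R.
Proof.
rewrite /kappa -(es_star es); congr phi.
by rewrite !star_vcomp !starK lw_star !star_vcomp starK -fam1_star !vcompA.
Qed.

Lemma ucell_vcompl_inj r0 rb0 (x y : cell1 N N) (s t : cell2 (iota \x x) (iota \x y)) :
  conj_pair r0 rb0 -> Q s \o ucell r0 x = Q t \o ucell r0 x -> s = t.
Proof.
move=> cp h; have E (z : cell2 (iota \x x) (iota \x y)) :
    z = (ucell rb0 (iota \x y))^* \o P (Q z \o ucell r0 x).
  by rewrite lw_comp vcompA ucells_nat -vcompA cp.1 vcomp1r.
by rewrite (E s) (E t) h.
Qed.

Lemma tau_pos r0 rb0 : conj_pair r0 rb0 -> pos_def (tau r0).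
Proof.
move=> cp y y0; rewrite /tau.
have -> : (ucell r0 u)^* \o Q (fam1 (adj y ** y) u) \o ucell r0 u =
    (Q (fam1 y u) \o ucell r0 u)^* \o (Q (fam1 y u) \o ucell r0 u).
  by rewrite star_vcomp lw_star -fam1_star !vcompA -[in RHS](vcompA _ (Q _) (Q _)) -lw_comp -fam1M.
apply: (ip_gt0 es) => h; apply: y0; apply: fam1_unit_inj.
apply: (ucell_vcompl_inj cp); rewrite h (fun0 (fam1_lin u)) (fun0 lw_lin).
by rewrite (bil0l vcomp_bil).
Qed.

Lemma kappa_pos r0 rb0 rb1 : conj_pair r0 rb0 -> (exists r1, conj_pair r1 rb1) ->
  pos_def (kappa r0 rb1).
Proof.
move=> cp [r1 cp1] y y0; rewrite /kappa.
pose t := fam1 y (iotab \x v) \o ucell rb1 v.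
have -> : (ucell rb1 v)^* \o fam1 (adj y ** y) (iotab \x v) \o ucell rb1 v = t^* \o t.
  by rewrite star_vcomp -fam1_star !vcompA -[in RHS](vcompA _ (fam1 _ _) (fam1 _ _)) -fam1M.
rewrite lw_comp vcompA -lw_star -star_vcomp -vcompA.
apply: (ip_gt0 es) => h; apply: y0; apply: fam1_unit_inj.
have t0 : t = 0%R.
  apply: (ucell_vcompl_inj cp); rewrite h.
  by rewrite (fun0 lw_lin) (bil0l vcomp_bil).
transitivity (P ((ucell r1 u)^*) \o t); last first.
  by rewrite t0 (bil0r vcomp_bil) (fun0 (fam1_lin u)).
rewrite /t vcompA -fam1_nat -vcompA.
by rewrite (conj_pair_sym cp1).2 vcomp1r.
Qed.

Lemma tau_change r0 (d l : End2 iota) : d^* = d -> tau ((id2 iotab \xx d) \o r0) l = tau r0 (d ** l ** d).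
Proof.
move=> ds; rewrite /tau ucell_comp fam2_r star_vcomp lw_star -fam1_star ds.
by rewrite !fam1M !lw_comp !vcompA.
Qed.

Lemma kappa_change r0 rb0 (d l : End2 iota) : d^* = d ->
  kappa r0 ((d \xx id2 iotab) \o rb0) l = kappa r0 rb0 (d ** l ** d).
Proof.
move=> ds; rewrite /kappa ucell_comp fam2_l star_vcomp -fam1_star ds.
by rewrite !fam1M !vcompA.
Qed.
End Closures.

(** A solution r0, rb0 of the conjugacy equations for which closing endomorphisms of iota
    on either side gives the same state, with density p^2 for a trace of index one.
    The second closure is completed to a scalar by an auxiliary vector rn. *)
Record normalised (phi : cell2 u u -> K) (r0 rn : cell2 u (iotab \x iota))
    (rb0 : cell2 (unit1 M) (iota \x iotab)) (p p' : End2 iota) (tr : End2 iota -> K)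
    : Prop := Normalised {
  nm_phi : end_state phi;
  nm_pair : conj_pair r0 rb0;
  nm_sph : forall l, kappa phi rn rb0 l = tau phi r0 l;
  nm_p : [/\ adj p = p, adj p' = p', p ** p' = aone _ & p' ** p = aone _];
  nm_comm : forall c, c ** (p ** p) = p ** p ** c -> c ** p = p ** c;
  nm_tr : forall l, tau phi r0 l = tr (p ** p ** l);
  nm_lin : linear (tr : End2 iota -> K^o);
  nm_trC : forall x y, tr (x ** y) = tr (y ** x);
  nm_dual : exists (m : nat) (x y : 'I_m -> End2 iota),
    (forall a, a = (\sum_q tr (y q ** a) *: x q)%R) /\ (\sum_q y q ** x q)%R = aone _
}.

(** Twisting r0 by h^(-1/2), where h is the density of tau, makes tau the trace tr. If k is
    then the density of kappa, a further twist by p = k^(1/4) multiplies the density 1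
    of tau by p^2 and the density p^4 of kappa by p^-2. *)
Lemma normalised_exists r0 rb0 : conj_pair r0 rb0 -> finite_dimensional (End2 u) ->
  exists phi r1 rb1 p p' tr, normalised phi r1 r0 rb1 p p' tr.
Proof.
move=> cp fdN; have fdL := fd_end1 cp fdN.
have [phi es] := end_state_exists fdN.
have psp (y : End2 iota) t E (sr : spec_res (adj y ** y) t E) : {in t, forall l : K, (0 <= l)%R}.
  exact: (eigen_ge0 sr (tau_lin es r0) (tau_pos es cp) erefl).
have [tr [trl trC trp trh [_ dual]]] := positive_trace fdL psp.
have [h [q [q' [hE qs qs' [qq' q'q] [hq _]]]]] :=
  density_root fdL trl trC trp trh (tau_lin es r0) (tau_star es r0) (tau_pos es cp).
pose d := q' ** q'; pose d' := q ** q.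
have ds : adj d = d by rewrite adjM qs'.
have ds' : adj d' = d' by rewrite adjM qs.
have dd' : d ** d' = aone _ by rewrite amulA -(amulA q') q'q amul1r q'q.
have d'd : d' ** d = aone _ by rewrite amulA -(amulA q) qq' amul1r qq'.
have hd : h = d' ** d' by rewrite hq.
clearbody d d'; clear hq qq' q'q qs qs' q q'.
pose r1 := (id2 iotab \xx d) \o r0; pose rb1 := (d' \xx id2 iotab) \o rb0.
have cp1 : conj_pair r1 rb1 := conj_pair_change cp ds ds' dd' d'd.
have tau1 l : tau phi r1 l = tr l.
  rewrite tau_change// hE trC -!amulA trC.
  rewrite -!amulA [d ** (h ** d)]amulA hd [d ** (d' ** d')]amulA dd' amul1l d'd.
  by rewrite amul1r.
have [k [p [p' [kE ps ps' [pp' p'p] [kp comm]]]]] := density_root fdL trl trC trp trh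
  (kappa_lin es r0 rb1) (kappa_star es r0 rb1) (kappa_pos es cp (ex_intro _ r1 cp1)).
exists phi, ((id2 iotab \xx p) \o r1), ((p' \xx id2 iotab) \o rb1), p, p', tr.
have tE l : tau phi ((id2 iotab \xx p) \o r1) l = tr (p ** p ** l).
  by rewrite tau_change// tau1 (trC (p ** l)) amulA.
split=> //.
- have h1 := conj_pair_change cp1 ps ps' pp' p'p.
  exact: h1.
- move=> l; rewrite tE kappa_change// kE kp (trC _ (_ ** p')) -!amulA.
  rewrite (trC p') -!amulA pp' amul1r [p' ** (p ** _)]amulA p'p amul1l trC -!amulA.
  by rewrite trC -!amulA.
- move=> c cpp; apply: comm; rewrite kp; move: (p ** p) cpp => q cq.
  by rewrite amulA cq -(amulA q c) cq amulA.
Qed.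
End Normalisation.

(** * The closure of End (iotab x iota) is a trace *)

Section Consequences.
Variables (R : realType) (C : cstar_two_cat R).
Notation K := R[i].
Variables (N M : C) (iota : cell1 N M) (iotab : cell1 M N).
Local Notation u := (unit1 N).
Variables (phi : cell2 u u -> K) (r0 rn : cell2 u (iotab \x iota)).
Variables (rb0 : cell2 (unit1 M) (iota \x iotab)) (p p' : End2 iota) (tr : End2 iota -> K).
Hypothesis nm : normalised phi r0 rn rb0 p p' tr.

Local Notation A := (End2 (iota \x iotab)).
Local Notation B := (End2 (iotab \x iota)).
Local Notation L := (End2 iota).
Local Notation P := (lw iota).
Local Notation Q := (lw iotab).
Local Notation r := (ucell r0).
Local Notation rb := (ucell rb0).
Local Notation rho x := (iotab \x (iota \x x)).
Local Notation w := (wcell r0 rb0).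
Local Notation F := (turn r0 : A -> B).
Local Notation rot := (half_turn r0 rb0 : B -> B).
Let cp := nm_pair nm.
Let es := nm_phi nm.

(** The closure of b by w on one side; [psi_outer] closes it on the other. *)
Definition psi (b : B) : K := phi ((w u)^* \o Q (P (fam2 b u)) \o w u).

Definition left_leg (l : L) : B := id2 iotab \xx l.
Definition right_leg (l : L) : A := l \xx id2 iotab.

Lemma psi_lin : linear (psi : B -> K^o).
Proof.
move=> k s t; rewrite /psi (fam2_lin u) !lw_lin.
by rewrite vcomp_bil.2 vcomp_bil.1 (es_lin es).
Qed.

Lemma psi_star (b : B) : psi (adj b) = ((psi b)^*)%R.
Proof.
rewrite /psi -(es_star es); congr phi.
by rewrite !star_vcomp starK !lw_star -fam2_star !vcompA.
Qed.

Lemma psi_pos : pos_def psi.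
Proof.
move=> y y0; rewrite /psi.
have -> : (w u)^* \o Q (P (fam2 (adj y ** y) u)) \o w u =
    (Q (P (fam2 y u)) \o w u)^* \o (Q (P (fam2 y u)) \o w u).
  rewrite star_vcomp !lw_star -fam2_star !vcompA -[in RHS](vcompA _ (Q _) (Q _)).
  by rewrite -!lw_comp -fam2M.
apply: (ip_gt0 es) => h; apply: y0; apply: fam2_unit_inj.
apply: (wcell_inj cp); rewrite h (fun0 (fam2_lin u)) !(fun0 lw_lin).
by rewrite (bil0l vcomp_bil).
Qed.

Lemma psi_nondeg (x : B) : (forall b, psi (x ** b) = 0%R) -> x = 0%R.
Proof.
move=> h; rewrite -[x]adjK; set y := adj x; suff -> : y = 0%R by rewrite adj0.
by apply: contrapT => /psi_pos; rewrite {1}/y adjK h ltxx.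
Qed.

(** By [closure_link] the two closures of b are tau l and tau l' for elements l, l' of
    End iota with kappa l = kappa l', and tau = kappa. *)
Lemma psi_outer (b : B) : psi b = phi ((w u)^* \o fam2 b (rho u) \o w u).
Proof.
have [l [l' [h1 h2 h3]]] := closure_link cp b.
have e1 := h1 _ u; have e2 := h2 _ u; rewrite /psi -e1 -e2.
have := nm_sph nm l; rewrite /kappa h3 -/(kappa phi rn rb0 l') (nm_sph nm l').
by [].
Qed.

Lemma psi_rot (b : B) : psi (rot b) = psi b.
Proof. by rewrite /psi (rot_out cp) -psi_outer. Qed.

Lemma psi_rotC (c d : B) : psi (c ** rot d) = psi (rot c ** d).
Proof.
rewrite psi_outer /psi !fam2M !lw_comp -!vcompA (rot_in cp) vcompA -(rot_out cp) -!vcompA.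
by [].
Qed.

Lemma rot_lin : linear (rot : B -> B).
Proof.
by move=> k b b'; rewrite /half_turn !turn_lin.
Qed.

Lemma psi_modular (c d : B) : psi (c ** d) = psi (rot (rot d) ** c).
Proof.
rewrite /psi !fam2M !lw_comp -!vcompA -[Q (P (fam2 d u)) \o _](rot_in cp).
rewrite [Q (P (fam2 c u)) \o _]vcompA -[Q (P _) \o fam2 _ _]fam2_nat -!vcompA.
by rewrite vcompA -(rot_out cp) -!vcompA.
Qed.

Lemma half_turnM (b b' : B) : rot (b ** b') = rot b' ** rot b.
Proof. exact: (rotM cp). Qed.

(** The half turn is an involution: its square is the modular automorphism of the
    rot-invariant state psi and equals its own inverse, and an involutive modular
    automorphism of a faithful positive state is trivial. *)
Lemma half_turnK : involutive rot.
Proof.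
pose sg b := rot (rot b).
have sl : linear sg by move=> k b b'; rewrite /sg !rot_lin.
have s2 d : sg (sg d) = d.
  apply/eqP; rewrite -subr_eq0; apply/eqP/psi_nondeg => c.
  rewrite amulBl (funB psi_lin) {1}/sg -psi_modular psi_rotC.
  by rewrite -half_turnM psi_rot subrr.
move=> b; rewrite -/(sg b); pose y : B := (b - sg b)%R.
have sy : sg y = (- y)%R by rewrite /y (funB sl) s2 opprB.
(* y is in the -1 eigenspace, where psi (y^* y) = - psi (y y^* ) *)
suff y0 : y = 0%R by apply/eqP; rewrite eq_sym -subr_eq0 -/y y0.
apply: contrapT => y0; have ys0 : adj y <> 0%R.
  by move=> h; apply: y0; rewrite -[y]adjK h adj0.
have := psi_modular (adj y) y; rewrite -/(sg y) sy amulNl (funN psi_lin) => h.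
have := psi_pos y0; have := psi_pos ys0; rewrite h adjK oppr_gt0 => h1 h2.
by have := lt_trans h1 h2; rewrite ltxx.
Qed.

Lemma psiC (c d : B) : psi (c ** d) = psi (d ** c).
Proof. by rewrite psi_modular !half_turnK. Qed.

Lemma half_turn_adj (b : B) : rot (adj b) = adj (rot b).
Proof. by rewrite -[adj b](rot_star cp) half_turnK. Qed.

Local Notation G := (fun b => turn rb0 (half_turn r0 rb0 b) : A).

Lemma turnK (a : A) : G (F a) = a.
Proof.
by apply: (turn_inj cp); rewrite -[LHS]/(rot (rot (F a))) half_turnK.
Qed.

Lemma turnKV (b : B) : F (G b) = b.
Proof. exact: half_turnK. Qed.

Lemma left_leg_lin : linear left_leg.
Proof. exact: (hcomp_bilinear _ _ _ _).2. Qed.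

Lemma left_legM (l l' : L) : left_leg (l ** l') = left_leg l ** left_leg l'.
Proof. by rewrite /left_leg -[X in hcomp X _](vcomp1l (id2 iotab)) Defs.interchange. Qed.

Lemma left_leg1 : left_leg (aone L) = aone B.
Proof. exact: hcomp_id2. Qed.

Lemma left_leg_adj (l : L) : left_leg (adj l) = adj (left_leg l).
Proof. by rewrite -[RHS]/((_ \xx _)^*) star_hcomp star_id. Qed.

Lemma right_leg_lin : linear right_leg.
Proof. exact: (hcomp_bilinear _ _ _ _).1. Qed.

Lemma right_legM (l l' : L) : right_leg (l ** l') = right_leg l ** right_leg l'.
Proof. by rewrite /right_leg -[X in hcomp _ X](vcomp1l (id2 iotab)) Defs.interchange. Qed.

Lemma right_leg1 : right_leg (aone L) = aone A.
Proof. exact: hcomp_id2. Qed.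

Lemma turn_cap (b : B) : exists l : L, b ** F (aone A) = left_leg l ** F (aone A).
Proof.
have [l lE] := fam2_ucell cp b; exists l; apply: fam2_inj => X x.
by rewrite !fam2M !turn_id fam2_r !vcompA lE.
Qed.

Lemma turn_cup (a : A) : exists l : L, a ** G (aone B) = right_leg l ** G (aone B).
Proof.
have r1 : rot (aone B) = aone B.
  by have := half_turnM (rot (aone B)) (aone B); rewrite amul1r !half_turnK amul1r.
have [l lE] := fam2_ucellb cp a; exists l; apply: fam2_inj => X x.
by rewrite !fam2M r1 !turn_id fam2_l !vcompA lE.
Qed.
Lemma turn_one (X : C) (x : cell1 X N) : fam2 (F (aone A)) x = r x \o (r x)^*.
Proof. exact: turn_id. Qed.

Local Notation act := (act r0 rb0 : A -> B -> B).
Local Notation mate := (mate r0 rb0 : A -> B -> L).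

Lemma outer_turn (a : A) :
  (w u)^* \o Q (P (fam2 (F a) u)) = (r u)^* \o Q (P ((r u)^*) \o fam2 a (iota \x u)).
Proof. by rewrite wcells -vcompA -lw_comp (turn_char cp). Qed.

Lemma psi_act (a a' : A) (b : B) :
  psi (F a' ** rot (act a b)) = psi (F (a' ** a) ** rot b).
Proof.
rewrite !psi_rotC !psi_outer !fam2M; congr phi.
have out c : (w u)^* \o fam2 (rot (F c)) (rho u) =
    (r u)^* \o Q (P ((r u)^*) \o fam2 c (iota \x u)).
  by rewrite -(rot_out cp) half_turnK outer_turn.
rewrite !vcompA !out fam2M -!vcompA wcell.unlock [fam2 (act a b) _ \o _]vcompA (act_cap cp).
by rewrite !lw_comp -!vcompA.
Qed.

(** Composing with the cap and cup of F (1) only straightens a strand. *)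
Lemma act_turn1 (a : A) : act a (F (aone A)) = F a.
Proof.
have E (b : B) (X : C) (x : cell1 X N) :
    fam2 b x = Q (P ((r x)^*)) \o (fam2 b (rho x) \o Q (rb (iota \x x))).
  by rewrite vcompA -fam2_nat -vcompA -lw_comp (conj_pair_sym cp).2 lw_id vcomp1r.
apply: fam2_inj => X x; rewrite E (act_cap cp) [RHS]E !(turn_char_inner cp).
by rewrite [fam2 (aone A) _]fam2_1 lw_id vcomp1l.
Qed.

Lemma tau_psi (l : L) : tau phi r0 l = psi (left_leg l ** F (aone A)).
Proof.
rewrite /psi /tau fam2M fam2_r turn_one; congr phi.
have e : Q (P ((r u)^*)) \o w u = r u.
  by rewrite wcell.unlock vcompA -lw_comp (conj_pair_sym cp).2 lw_id vcomp1l.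
rewrite !lw_comp -!vcompA e !vcompA; congr (_ \o _).
apply: star_inj; rewrite !star_vcomp !lw_star !starK.
rewrite wcell.unlock [Q (P (Q _)) \o _]vcompA -lw_comp -ucell_nat lw_comp -!vcompA.
by rewrite vcompA -lw_comp (conj_pair_sym cp).2 lw_id vcomp1l.
Qed.

Lemma tau_mate (l : L) (a : A) (b : B) :
  tau phi r0 (l ** mate a b) = psi (F a ** left_leg l ** rot b).
Proof.
rewrite psi_rotC psi_outer !fam2M /tau fam1M; congr phi.
rewrite lw_comp -!vcompA (mate_ucell cp) [RHS]vcompA -(rot_out cp) half_turnK fam2M.
rewrite fam2_r !lw_comp [(w u)^* \o (_ \o _)]vcompA outer_turn lw_comp.
rewrite -!vcompA [Q (fam2 a _) \o (Q _ \o _)]vcompA -lw_comp fam2_nat lw_comp -!vcompA.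
rewrite [Q (P _) \o (Q (P (Q _)) \o _)]vcompA -!lw_comp [(r u)^* \o (Q (P _) \o _)]vcompA.
by rewrite ucells_nat -!vcompA.
Qed.

Lemma turn_right_leg_l (l : L) (a : A) : F (right_leg l ** a) = left_leg l ** F a.
Proof. exact: turn_mull. Qed.

Lemma turn_right_leg_r (a : A) (l : L) : F (a ** right_leg l) = rot (left_leg l) ** F a.
Proof. exact: turn_mulr. Qed.

(** tau l = psi (i(l) F(1)), and a leg can go around F(1) by changing sides twice. *)
Lemma tau_trace (l l' : L) : tau phi r0 (l ** l') = tau phi r0 (l' ** l).
Proof.
pose e := F (aone A).
have ie m : rot (left_leg m) ** e = left_leg m ** e.
  by rewrite -turn_right_leg_r -turn_right_leg_l amul1l amul1r.
have re : rot e = e.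
  have e_adj : adj e = e.
    apply: fam2_inj => X x; rewrite [LHS]fam2_star !turn_one star_vcomp starK.
    by [].
  have : F (adj (aone A)) = rot (adj e) by exact: turn_star.
  by rewrite adj1 e_adj.
have ei m : e ** rot (left_leg m) = e ** left_leg m.
  by rewrite -{1}re -half_turnM -ie half_turnM half_turnK re.
have ij m m' : left_leg m ** rot (left_leg m') = rot (left_leg m') ** left_leg m.
  have := turn_right_leg_l m (G (aone B) ** right_leg m').
  rewrite amulA turn_right_leg_r turn_right_leg_l turn_right_leg_r turnKV !amul1r.
  by [].
rewrite !tau_psi -/e !left_legM -!amulA.
have -> : left_leg l ** (left_leg l' ** e) = rot (left_leg l') ** (left_leg l ** e).
  by rewrite -ie amulA ij -amulA.
by rewrite psiC -amulA ei amulA psiC.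
Qed.

(** The density p^2 of a trace for a trace is central, and p is a function of p^2. *)
Lemma density_central (l : L) : p ** l = l ** p.
Proof.
have [m [nx [ny [nE _]]]] := nm_dual nm.
have nd (z : L) : (forall z', tr (z' ** z) = 0%R) -> z = 0%R.
  by move=> h; rewrite [z]nE big1// => q _; rewrite h scale0r.
symmetry; apply: (nm_comm nm); apply/eqP; rewrite -subr_eq0; apply/eqP/nd => z.
rewrite amulBr (funB (nm_lin nm)).
have := tau_trace l z; rewrite !(nm_tr nm) => h.
by rewrite (amulA z l) (nm_trC nm (z ** l)) -h (nm_trC nm z) -(amulA (p ** p)) subrr.
Qed.

Section Depth2.
Variables (n : nat) (ak : 'I_n -> A) (bk : 'I_n -> B).
Hypothesis hab : forall (X : C) (x : cell1 X N),
  (\sum_(i < n) (fam2 (bk i) x \o ((r (rho x))^* \o Q (fam2 (ak i) (iota \x x))))%cell)%R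
  = Q (P ((r x)^*)).

Lemma quasi_basis (b : B) : b = (\sum_k bk k ** rot (left_leg (mate (ak k) b)))%R.
Proof.
apply: fam2_inj => X x; rewrite (fun_sum (fam2_lin x)).
transitivity (Q (P ((r x)^*)) \o (fam2 b (rho x) \o Q (rb (iota \x x)))).
  by rewrite vcompA -fam2_nat -vcompA -lw_comp (conj_pair_sym cp).2 lw_id vcomp1r.
rewrite -hab vcomp_suml; apply: eq_bigr => k _.
by rewrite fam2M (rot_mate cp) -!vcompA.
Qed.

(** A product of a and b, one strand apart, is rearranged with the b_k on the left: the
    depth two relation [hab] is inserted in the strand that straightens b. *)
Lemma quasi_turn (a : A) (b : B) (X : C) (x : cell1 X N) :
  fam2 a (iota \x x) \o P (fam2 b x) =
  (\sum_k (P (fam2 (bk k) x) \o fam2 (G (F a ** act (ak k) b)) (iota \x x))%cell)%R.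
Proof.
(* a family is recovered from its quarter turn by straightening a strand *)
have GE (c : A) (Y : C) (y : cell1 Y M) : fam2 c y =
    (rb (iota \x (iotab \x y)))^* \o P (fam2 (F c) (iotab \x y) \o Q (rb y)).
  rewrite lw_comp vcompA (turn_char cp) -vcompA fam2_nat vcompA -lw_comp.
  by rewrite (conj_pair_sym cp).1 lw_id vcomp1l.
transitivity (fam2 a (iota \x x) \o
    P (Q (P ((r x)^*)) \o (fam2 b (rho x) \o Q (rb (iota \x x))))).
  rewrite [in RHS]vcompA -[in RHS]fam2_nat -[in RHS]vcompA -[in RHS](lw_comp iotab).
  by rewrite (conj_pair_sym cp).2 lw_id vcomp1r.
rewrite lw_comp vcompA fam2_nat -hab (fun_sum lw_lin) !vcomp_suml.
apply: eq_bigr => k _; rewrite [in RHS]GE turnKV fam2M -[_ \o _ \o Q (rb _)]vcompA (act_cap cp).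
rewrite [in RHS]lw_comp [_ \o (P (fam2 (F a) _) \o _)]vcompA (turn_char cp).
rewrite !lw_comp -!vcompA; congr (_ \o (_ \o _)).
by rewrite [RHS]vcompA [in RHS]fam2_nat -vcompA.
Qed.

Lemma turn_quasi (a a' : A) (b : B) :
  F (a' ** a) ** b = (\sum_k F (G (F a' ** bk k) ** G (F a ** act (ak k) b)))%R.
Proof.
apply: fam2_inj => X x; rewrite (fun_sum (fam2_lin x)) fam2M turnE fam2M.
rewrite -vcompA ucell_nat vcompA -lw_comp -!vcompA quasi_turn !vcomp_sumr.
rewrite (fun_sum lw_lin) vcomp_suml.
apply: eq_bigr => k _; rewrite [RHS]turnE fam2M [in RHS]vcompA -[in RHS](turn_char cp) turnKV fam2M.
by rewrite [P (_ \o _)]lw_comp [(rb _)^* \o (_ \o _)]vcompA (turn_char cp) -!vcompA.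
Qed.
End Depth2.
End Consequences.

(** * Duality of the endomorphism algebras *)

Section Instance.
Variables (R : realType) (C : cstar_two_cat R).
Notation K := R[i].
Variables (N M : C) (iota : cell1 N M) (iotab : cell1 M N).
Local Notation u := (unit1 N).
Variables (phi : cell2 u u -> K) (r0 rn : cell2 u (iotab \x iota)).
Variables (rb0 : cell2 (unit1 M) (iota \x iotab)) (p p' : End2 iota) (tr : End2 iota -> K).
Hypothesis nm : normalised phi r0 rn rb0 p p' tr.
Hypothesis d2 : depth2 iota iotab.
Let cp := nm_pair nm.

Local Notation A := (End2 (iota \x iotab)).
Local Notation B := (End2 (iotab \x iota)).
Local Notation L := (End2 iota).

(** delta is the inverse of p, since tau has density p^2 with respect to tr. *)
Definition paired_ends : paired_algebras A B L.
Proof.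
have cpc := conj_pair_sym cp.
have [pa pa' pp' p'p] := nm_p nm.
apply: (@PairedAlgebras R A B L (psi phi r0 rb0) (half_turn r0 rb0) (turn r0)
  (fun b => turn rb0 (half_turn r0 rb0 b)) (@left_leg _ _ _ _ _ _) (@right_leg _ _ _ _ _ _)
  (act r0 rb0) (mate r0 rb0) p' p).
- exact: (psi_lin nm).
- exact: (psiC nm).
- exact: (psi_star nm).
- exact: (psi_nondeg nm).
- exact: rot_lin.
- exact: (half_turnM nm).
- exact: (half_turnK nm).
- exact: (half_turn_adj nm).
- exact: (psi_rot nm).
- exact: turn_lin.
- exact: (turnK nm).
- exact: (turnKV nm).
- by move=> l a; exact: turn_mull.
- by move=> a l; exact: (turn_mulr cp).
- by move=> a; exact: (turn_star cp).
- move=> a a'; rewrite !(half_turnK nm); exact: (rotM cpc).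
- exact: left_leg_lin.
- exact: left_legM.
- exact: left_leg1.
- exact: left_leg_adj.
- exact: right_leg_lin.
- exact: right_legM.
- exact: right_leg1.
- exact: (turn_cap nm).
- exact: (turn_cup nm).
- exact: (psi_act nm).
- exact: (act_turn1 nm).
- by move=> l a b; have := tau_mate nm l a b; rewrite (tau_psi nm); exact.
- have [n [V hV]] := d2; have [ak [bk hab]] := depth2_turned cp hV.
  exists n, ak, bk; split; first exact: (quasi_basis nm hab).
  exact: (turn_quasi nm hab).
- move=> l; rewrite -[RHS]amul1l -p'p -amulA (amulA p) (density_central nm) -amulA pp'.
  by rewrite amul1r.
- exact: pa'.
- exact: p'p.
- have [m [nx [ny [nE n1]]]] := nm_dual nm; exists m, nx, ny; split=> // l.
  rewrite [LHS]nE; apply: eq_bigr => q _; rewrite -(tau_psi nm) (nm_tr nm).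
  by rewrite !amulA -(amulA p) pp' amul1r pp' amul1l.
Qed.
End Instance.

Theorem theorem3p2 (R : realType) (C : cstar_two_cat R) (N M : C)
    (iota : cell1 N M) (iotab : cell1 M N)
    (Rbar : cell2 (unit1 M) (iota \x iotab)%cell)
    (R0 : cell2 (unit1 N) (iotab \x iota)%cell)
    (Hconj : conjugacy_equations Rbar R0)
    (Hdepth : depth2 iota iotab)
    (Hfin : finite_dimensional (End2 (unit1 N))) :
  let A := End2 (iota \x iotab)%cell in
  let B := End2 (iotab \x iota)%cell in
  finite_dimensional A /\ finite_dimensional B /\
  exists form : {bilinear A -> B -> R[i]^o},
    nondegenerate_form form /\
    exists (hA : cstar_weak_hopf A) (hB : cstar_weak_hopf B),
      in_duality hA hB form.
Proof.
move=> A B; have cp := conj_pair_of_equations Hconj.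
have [phi [r [rb [p [p' [tr nm]]]]]] := normalised_exists cp Hfin.
have fdB : finite_dimensional B := fd_end2 cp Hfin Hdepth.
pose D := paired_ends nm Hdepth; have fb := pairing_bilinear D.
have fdA : finite_dimensional A.
  by apply: (fd_iso (pa_G_lin D) _ fdB); exists (pa_F D); [exact: (pa_GK D) | exact: (pa_FK D)].
split=> //; split=> //.
pose form : {bilinear A -> B -> R[i]^o} :=
  HB.pack_for {bilinear A -> B -> R[i]^o} (pairing D : A -> B -> R[i]^o)
    (@bilinear_isBilinear.Build R[i] A B R[i]^o *:%R *:%R (pairing D) fb).
by exists form; exact: (pairing_duality D fdA fdB).
Qed.
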